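(* Let the potential $v$ of the Dirac system $\frac{d}{dx}y(x,z)=\mathrm{i}(zj+jV(x))y(x,z)$ be square-summable on $(0,\mathbf{T})$, $0<\mathbf{T}<\infty$, let $\gamma(x)=\begin{bmatrix}0&I_{m_2}\end{bmatrix}u(x,0)$, and let $K\in B(L^2_{m_2}(0,\mathbf{T}))$ be the operator $$(Kf)(x)=\mathrm{i}\int_0^x\gamma(x)j\gamma(t)^*f(t)\,dt .$$ Then there is a (boundedly invertible) similarity transformation operator $E\in B(L^2_{m_2}(0,\mathbf{T}))$ such that $$K=EAE^{-1},\qquad (Af)(x):=-\mathrm{i}\int_0^xf(t)\,dt,$$ $$(Ef)(x)=f(x)+\int_0^xN(x,t)f(t)\,dt,\qquad E^{-1}\gamma_2\equiv I_{m_2},$$ where $N$ is a Hilbert-Schmidt kernel, $\gamma_2$ is the right $m_2\times m_2$ block of $\gamma$, and $E^{-1}$ is applied to $\gamma_2$ columnwise. Moreover, the operators $E$ and $E^{-1}$ map differentiable functions with a square-summable derivative into differentiable functions with a square-summable derivative.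
   Context: Let $m_1,m_2\ge 1$ be integers, $m=m_1+m_2$, $j=\begin{bmatrix} I_{m_1}&0\\0&-I_{m_2}\end{bmatrix}$ and $V(x)=\begin{bmatrix}0&v(x)\\ v(x)^*&0\end{bmatrix}$, where $v$ is a measurable $m_1\times m_2$ complex matrix function (the potential). $u(x,z)$ is the fundamental ($m\times m$) solution of the Dirac system normalized by $u(0,z)=I_m$. A matrix function is square-summable if its entries are in $L^2$. $L^2_r(0,\mathbf{T})$ is the space of square-integrable $\mathbb{C}^r$-valued functions and $B(H)$ is the algebra of bounded operators on $H$. ''Differentiable with a square-summable derivative'' is understood as absolutely continuous with a.e. derivative in $L^2$, i.e. $f(x)=f_0+\int_0^x\widetilde f(t)\,dt$ with $f_0$ constant and $\widetilde f$ square-summable. A Hilbert-Schmidt kernel is a measurable kernel with $\int_0^{\mathbf{T}}\int_0^x\|N(x,t)\|^2dt\,dx<\infty$. *)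

(* Defs.v *)
From HB Require Import structures.
From mathcomp Require Import all_boot all_order all_algebra complex.
From mathcomp Require Import all_classical all_reals all_analysis.

Set Implicit Arguments.
Unset Strict Implicit.
Unset Printing Implicit Defensive.

Import Order.TTheory GRing.Theory Num.Theory.
Import numFieldNormedType.Exports.

Local Open Scope classical_set_scope.
Local Open Scope sesquilinear_scope.
Local Open Scope ring_scope.

(* Measurability is Borel measurability, as for [lebesgue_measure].  This is no
   restriction: every Lebesgue measurable function agrees almost everywhere
   with a Borel one, and all notions below depend only on a.e. classes. *)

Section MatrixFunctions.
Context {R : realType}.
Local Notation C := R[i].
Local Notation mu := (@lebesgue_measure R).

Definition cmeasurable {d} {X : measurableType d} (D : set X) (f : X -> C) :=
  measurable_fun D (fun x => complex.Re (f x)) /\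
  measurable_fun D (fun x => complex.Im (f x)).

Definition cintegral (D : set R) (f : R -> C) : C :=
  Complex (\int[mu]_(t in D) complex.Re (f t)) (\int[mu]_(t in D) complex.Im (f t)).

Definition mx_integral {p q : nat} (D : set R) (F : R -> 'M[C]_(p, q)) :
    'M[C]_(p, q) :=
  \matrix_(i, k) cintegral D (fun t => F t i k).

Definition mx_integrable {p q : nat} (D : set R) (F : R -> 'M[C]_(p, q)) :=
  forall i k,
    mu.-integrable D (fun t => (complex.Re (F t i k))%:E) /\
    mu.-integrable D (fun t => (complex.Im (F t i k))%:E).

Definition sq_summable {p q : nat} (T : R) (F : R -> 'M[C]_(p, q)) :=
  forall i k,
    cmeasurable `]0, T[ (fun x => F x i k) /\
    (\int[mu]_(x in `]0%R, T[) ((Normc.normc (F x i k)) ^+ 2)%:E < +oo)%E.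

(* The squared Hilbert-Schmidt norm; the Euclidean one on column vectors. *)
Definition mx_normsq {p q : nat} (A : 'M[C]_(p, q)) : R :=
  \sum_(i < p) \sum_(k < q) Normc.normc (A i k) ^+ 2.

Definition antiderivative {p q : nat} (F0 : 'M[C]_(p, q))
    (F : R -> 'M[C]_(p, q)) (x : R) : 'M[C]_(p, q) :=
  F0 + mx_integral `]0, x[ F.

(* Elements of L^2_r(0, T) are represented by functions on R, of which only
   the a.e. class on ]0, T[ is relevant. *)

Definition L2 {r : nat} (T : R) (f : R -> 'cV[C]_r) := sq_summable T f.

Definition L2eq {p q : nat} (T : R) (F G : R -> 'M[C]_(p, q)) :=
  F = G %[ae mu in `]0, T[%classic].

Definition L2norm {r : nat} (T : R) (f : R -> 'cV[C]_r) : R :=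
  Num.sqrt (\int[mu]_(x in `]0, T[) mx_normsq (f x)).

(* F induces an element of B(L^2_r(0, T)). *)
Record bounded_op {r : nat} (T : R) (F : (R -> 'cV[C]_r) -> (R -> 'cV[C]_r)) :
    Prop := BoundedOp {
  bop_L2 : forall f, L2 T f -> L2 T (F f) ;
  bop_ae : forall f g, L2 T f -> L2 T g -> L2eq T f g -> L2eq T (F f) (F g) ;
  bop_linear : forall (a : C) f g, L2 T f -> L2 T g ->
    L2eq T (F (fun x => a *: f x + g x)) (fun x => a *: F f x + F g x) ;
  bop_bounded : exists c : R, forall f, L2 T f -> L2norm T (F f) <= c * L2norm T f
}.

(* F and G are mutually inverse on L^2_r(0, T). *)
Definition L2inverse {r : nat} (T : R)
    (F G : (R -> 'cV[C]_r) -> (R -> 'cV[C]_r)) :=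
  forall f, L2 T f -> L2eq T (F (G f)) f /\ L2eq T (G (F f)) f.

Definition columnwise {p q : nat} (F : (R -> 'cV[C]_p) -> (R -> 'cV[C]_p))
    (G : R -> 'M[C]_(p, q)) (x : R) : 'M[C]_(p, q) :=
  \matrix_(i, k) F (fun y => col k (G y)) x i 0.

(* The class of f has an absolutely continuous representative whose
   derivative is square-summable. *)
Definition L2differentiable {r : nat} (T : R) (f : R -> 'cV[C]_r) :=
  L2 T f /\
  exists (f0 : 'cV[C]_r) (f' : R -> 'cV[C]_r),
    L2 T f' /\ L2eq T f (antiderivative f0 f').

Definition HSkernel {r : nat} (T : R) (N : R -> R -> 'M[C]_r) :=
  (forall i k, cmeasurable
     [set p : measurableTypeR R * measurableTypeR R | 0 < p.2 < p.1 /\ p.1 < T]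
     (fun p => N p.1 p.2 i k)) /\
  (\int[mu]_(x in `]0%R, T[) \int[mu]_(t in `]0%R, x[)
     (mx_normsq (N x t))%:E < +oo)%E.

End MatrixFunctions.

Section Dirac.
Context {R : realType} {m1 m2 : nat}.
Local Notation C := R[i].
Local Notation mu := (@lebesgue_measure R).

Definition jmx : 'M[C]_(m1 + m2) := block_mx 1%:M 0 0 (- 1%:M).

Definition Vmx (v : R -> 'M[C]_(m1, m2)) (x : R) : 'M[C]_(m1 + m2) :=
  block_mx 0 (v x) ((v x)^t*) 0.

(* For every z, u(., z) is absolutely continuous on [0, T] with derivative w,
   solves the Dirac system a.e., and u(0, z) = I. *)
Definition fundamental_solution (T : R) (v : R -> 'M[C]_(m1, m2))
    (u : R -> C -> 'M[C]_(m1 + m2)) :=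
  forall z : C,
    u 0 z = 1%:M /\
    exists w : R -> 'M[C]_(m1 + m2),
      [/\ mx_integrable `]0, T[ w,
          forall x, 0 <= x <= T -> u x z = antiderivative (u 0 z) w x &
          w =
            (fun x => 'i%C *: ((z *: jmx + jmx *m Vmx v x) *m u x z))
              %[ae mu in `]0, T[%classic]].

Definition gammamx (u : R -> C -> 'M[C]_(m1 + m2)) (x : R) :
    'M[C]_(m2, m1 + m2) :=
  row_mx 0 1%:M *m u x 0.

Definition opK (gamma : R -> 'M[C]_(m2, m1 + m2)) (f : R -> 'cV[C]_m2) (x : R) :
    'cV[C]_m2 :=
  'i%C *: mx_integral `]0, x[ (fun t => gamma x *m jmx *m (gamma t)^t* *m f t).

End Dirac.

Definition opA {R : realType} {r : nat} (f : R -> 'cV[R[i]]_r) (x : R) :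
    'cV[R[i]]_r :=
  - 'i%C *: mx_integral `]0, x[ f.

(* Main.v *)
(* Write [(J f)(x) = int_0^x f] and [B = J v^* J v].  As [gamma j gamma^* = -1],
   integration by parts shows that [h = K f] solves [h = B h - i J f], and the
   columns [h] of [gamma_2] solve [h = h(0) + B h].  The kernel [N] of [E] is
   obtained by Picard iteration, in a sup norm with an exponential weight, from
   the equations of the transmutation operator along characteristics,
     [L(x, t) = v(t) + int_t^x v(y) N(y, t) dy],
     [N(x, t) = int_(x-t)^x v(y)^* L(y, y - x + t) dy],
   and Fubini's theorem turns them into [E F = F_0 + B E F + J E f] for every
   primitive [F = F_0 + J f].  Since [h = a + B h] has only one bounded
   solution, this single identity yields [E 1 = gamma_2] and [K E = E A], and
   it shows that [E] and [E^-1] preserve the differentiable functions. *)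
Require Import Defs.
From HB Require Import structures.
From mathcomp Require Import all_boot all_order all_algebra complex.
From mathcomp Require Import all_classical all_reals all_analysis.
From mathcomp Require Import measurable_realfun ring lra.
Import Order.TTheory GRing.Theory Num.Theory.
Import numFieldNormedType.Exports.
Local Open Scope classical_set_scope.
Local Open Scope ring_scope.

Set Implicit Arguments.
Unset Strict Implicit.
Unset Printing Implicit Defensive.
Local Open Scope sesquilinear_scope.

(** * Matrix-valued functions and their integrals *)

Section ComplexL1Norm.
Context {R : realType}.
Local Notation C := R[i].

(** The potential is only square-summable, and this shapes the proof. The kernel [L] contains the
    term [v(t)], which lies in no sup norm, so [L] is eliminated and the fixed point is sought for
    [N] alone: its first iterate is an integral of a product of [v^*] with a translate of [v],
    bounded by the sum of two squared norms. Thus [N] is bounded and not merely Hilbert-Schmidt. The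
    operator with kernel [N] then sends integrable functions to bounded ones, and this gain allows
    [1 + N] to be inverted on L^2 by the same sup norm contraction that constructs [N]. The weight
    [exp(l x)], with [l] large, makes each integration against [|v|] halve the norm, so [T] need not
    be small. No derivative is ever computed. An absolutely continuous function is an initial value
    together with its derivative, and the Leibniz rule is an identity between integrals, obtained
    from Fubini's theorem. It is applied to products of block rows of [u(., 0)] with
    [int_0^x j gamma^* f]. There the upper block row [beta] appears beside [gamma]; the relation
    [beta j gamma^* = 0] eliminates it and leaves an equation for [K f] alone. *)

Definition absC (z : C) : R := `|complex.Re z| + `|complex.Im z|.

Lemma absC_ge0 z : 0 <= absC z. Proof. by rewrite addr_ge0. Qed.

Lemma absC0 : absC 0 = 0. Proof. by rewrite /absC /= !normr0 addr0. Qed.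

Lemma absCD (y z : C) : absC (y + z) <= absC y + absC z.
Proof.
case: y z => [a b] [c e]; rewrite /absC /=.
have := ler_normD a c; have := ler_normD b e; lra.
Qed.

Lemma absCN (z : C) : absC (- z) = absC z.
Proof. by case: z => a b; rewrite /absC /= !normrN. Qed.

Lemma absCM (y z : C) : absC (y * z) <= absC y * absC z.
Proof.
case: y z => [a b] [c e]; rewrite /absC /=.
have := ler_normB (a * c) (b * e); have := ler_normD (a * e) (b * c).
rewrite !normrM; lra.
Qed.

Lemma absC_conj (z : C) : absC (Num.conj z) = absC z.
Proof. by case: z => a b; rewrite /absC /= normrN. Qed.

Lemma normc_le_absC (z : C) : Normc.normc z <= absC z.
Proof.
case: z => a b; rewrite /absC /=.
rewrite -[leRHS]ger0_norm ?addr_ge0// -sqrtr_sqr ler_wsqrtr//.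
rewrite sqrrD !real_normK ?num_real// lerD2r lerDl mulrn_wge0//.
Qed.

Lemma absC_le_normc (z : C) : absC z <= 2 * Normc.normc z.
Proof.
case: z => a b; rewrite /absC /=.
have ha : `|a| <= Num.sqrt (a ^+ 2 + b ^+ 2).
  by rewrite -sqrtr_sqr ler_wsqrtr// lerDl sqr_ge0.
have hb : `|b| <= Num.sqrt (a ^+ 2 + b ^+ 2).
  by rewrite -sqrtr_sqr ler_wsqrtr// lerDr sqr_ge0.
lra.
Qed.

Lemma normc_ge0 (z : C) : 0 <= Normc.normc z.
Proof. by case: z => a b; exact: sqrtr_ge0. Qed.

(** This norm is submultiplicative and invariant under the adjoint, and its measurability and
    integrability reduce to real and imaginary parts of entries without square roots. All estimates
    use it; [mx_normsq_le_nrm] and [nrm_sq_le_normsq] convert to the Hilbert-Schmidt norm. *)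
Definition nrm {p q} (A : 'M[C]_(p, q)) : R := \sum_i \sum_k absC (A i k).

Lemma nrm_ge0 p q (A : 'M[C]_(p, q)) : 0 <= nrm A.
Proof. by apply: sumr_ge0 => i _; apply: sumr_ge0 => k _; exact: absC_ge0. Qed.

Lemma absC_le_nrm p q (A : 'M[C]_(p, q)) i k : absC (A i k) <= nrm A.
Proof.
rewrite /nrm (bigD1 i)//= (bigD1 k)//= -addrA lerDl addr_ge0//.
  by apply: sumr_ge0 => j _; exact: absC_ge0.
by apply: sumr_ge0 => j _; apply: sumr_ge0 => l _; exact: absC_ge0.
Qed.

Lemma nrm0 p q : nrm (0 : 'M[C]_(p, q)) = 0.
Proof. by rewrite /nrm big1// => i _; rewrite big1// => k _; rewrite mxE absC0. Qed.

Lemma nrm_eq0 p q (A : 'M[C]_(p, q)) : nrm A = 0 -> A = 0.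
Proof.
move=> A0; apply/matrixP => i k; rewrite mxE.
have : absC (A i k) = 0.
  by apply/eqP; rewrite eq_le absC_ge0 andbT -A0 absC_le_nrm.
case: (A i k) => a b; rewrite /absC /= => /eqP.
by rewrite paddr_eq0// !normr_eq0 => /andP[/eqP -> /eqP ->].
Qed.

Lemma nrmN p q (A : 'M[C]_(p, q)) : nrm (- A) = nrm A.
Proof. by apply: eq_bigr => i _; apply: eq_bigr => k _; rewrite mxE absCN. Qed.

Lemma nrmD p q (A B : 'M[C]_(p, q)) : nrm (A + B) <= nrm A + nrm B.
Proof.
rewrite /nrm -big_split/=; apply: ler_sum => i _; rewrite -big_split/=.
by apply: ler_sum => k _; rewrite mxE absCD.
Qed.

Lemma nrmB p q (A B : 'M[C]_(p, q)) : nrm (A - B) <= nrm A + nrm B.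
Proof. by rewrite -(nrmN B) nrmD. Qed.

Lemma nrmZ p q c (A : 'M[C]_(p, q)) : nrm (c *: A) <= absC c * nrm A.
Proof.
rewrite /nrm mulr_sumr; apply: ler_sum => i _.
by rewrite mulr_sumr; apply: ler_sum => k _; rewrite mxE absCM.
Qed.

Lemma nrmM p q r (A : 'M[C]_(p, q)) (B : 'M[C]_(q, r)) :
  nrm (A *m B) <= nrm A * nrm B.
Proof.
rewrite /nrm mulr_suml; apply: ler_sum => i _.
rewrite mulr_suml exchange_big/=.
apply: (@le_trans _ _ (\sum_k \sum_j absC (A i j) * absC (B j k))).
  apply: ler_sum => k _; rewrite mxE.
  elim/big_ind2: _ => [|x1 x2 y1 y2 h1 h2|j _]; first by rewrite absC0.
    exact: le_trans (absCD _ _) (lerD h1 h2).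
  exact: absCM.
rewrite exchange_big/=; apply: ler_sum => j _; rewrite -mulr_sumr.
rewrite ler_wpM2l ?absC_ge0//; apply: ler_sum => k _.
by rewrite (bigD1 j)//= lerDl sumr_ge0// => l _; exact: absC_ge0.
Qed.

Lemma nrm_adj p q (A : 'M[C]_(p, q)) : nrm (A^t*) = nrm A.
Proof.
rewrite /nrm exchange_big/=; apply: eq_bigr => i _; apply: eq_bigr => k _.
by rewrite !mxE absC_conj.
Qed.

Lemma mx_normsq_ge0 p q (A : 'M[C]_(p, q)) : 0 <= mx_normsq A.
Proof. by apply: sumr_ge0 => i _; apply: sumr_ge0 => k _; exact: sqr_ge0. Qed.

Lemma mx_normsq_le_nrm p q (A : 'M[C]_(p, q)) : mx_normsq A <= nrm A ^+ 2.
Proof.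
rewrite expr2 /nrm mulr_suml; apply: ler_sum => i _.
rewrite mulr_suml; apply: ler_sum => k _.
rewrite expr2 ler_pM ?normc_ge0//; first exact: normc_le_absC.
exact: le_trans (normc_le_absC _) (absC_le_nrm _ _ _).
Qed.

(** Each of the [p * q] entries has [absC] at most twice the Hilbert-Schmidt norm. The constant is
    crude, but only its finiteness matters. *)
Lemma nrm_sq_le_normsq p q (A : 'M[C]_(p, q)) :
  nrm A ^+ 2 <= (2 * (p * q)%:R) ^+ 2 * mx_normsq A.
Proof.
have le i k : absC (A i k) <= 2 * Num.sqrt (mx_normsq A).
  apply: le_trans (absC_le_normc _) _; rewrite ler_pM2l//.
  rewrite -[leLHS]ger0_norm ?normc_ge0// -sqrtr_sqr ler_wsqrtr//.
  rewrite /mx_normsq (bigD1 i)//= (bigD1 k)//= -addrA lerDl addr_ge0//.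
    by apply: sumr_ge0 => j _; exact: sqr_ge0.
  by apply: sumr_ge0 => j _; apply: sumr_ge0 => l _; exact: sqr_ge0.
rewrite -[X in _ * X]sqr_sqrtr ?mx_normsq_ge0// -exprMn lerXn2r ?nnegrE//.
  exact: nrm_ge0.
apply: (@le_trans _ _ (\sum_(i < p) \sum_(k < q) 2 * Num.sqrt (mx_normsq A))).
  by apply: ler_sum => i _; apply: ler_sum => k _; exact: le.
rewrite !sumr_const !card_ord -mulrnA -[_ *+ (q * p)]mulr_natr (mulnC q).
by rewrite mulrAC.
Qed.

End ComplexL1Norm.

(** * Measurability of matrix functions *)

Section MatrixMeasurability.
Context {R : realType} d (X : measurableType d).
Local Notation C := R[i].
Local Notation mu := (@lebesgue_measure R).

Definition mxmeas {p q} (F : X -> 'M[C]_(p, q)) :=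
  forall i k, cmeasurable setT (fun x => F x i k).

Lemma mxmeas_cst p q (A : 'M[C]_(p, q)) : mxmeas (fun=> A).
Proof. by move=> i k; split; exact: measurable_cst. Qed.

Lemma mxmeasD p q (F G : X -> 'M[C]_(p, q)) :
  mxmeas F -> mxmeas G -> mxmeas (fun x => F x + G x).
Proof.
move=> mF mG i k; have [F1 F2] := mF i k; have [G1 G2] := mG i k; split.
  under eq_fun do rewrite mxE raddfD; exact: measurable_funD.
under eq_fun do rewrite mxE raddfD; exact: measurable_funD.
Qed.

Lemma mxmeasN p q (F : X -> 'M[C]_(p, q)) :
  mxmeas F -> mxmeas (fun x => - F x).
Proof.
move=> mF i k; have [F1 F2] := mF i k; split.
  under eq_fun do rewrite mxE raddfN; exact: measurable_funN.
under eq_fun do rewrite mxE raddfN; exact: measurable_funN.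
Qed.

Lemma mxmeasB p q (F G : X -> 'M[C]_(p, q)) :
  mxmeas F -> mxmeas G -> mxmeas (fun x => F x - G x).
Proof. by move=> mF mG; apply: mxmeasD => //; exact: mxmeasN. Qed.

Lemma mxmeasM p q r (F : X -> 'M[C]_(p, q)) (G : X -> 'M[C]_(q, r)) :
  mxmeas F -> mxmeas G -> mxmeas (fun x => F x *m G x).
Proof.
move=> mF mG i k; split.
  under eq_fun do rewrite mxE raddf_sum; apply: measurable_sum => j.
  have [F1 F2] := mF i j; have [G1 G2] := mG j k.
  rewrite (_ : (fun _ => _) = (fun x => complex.Re (F x i j) * complex.Re (G x j k)
     - complex.Im (F x i j) * complex.Im (G x j k))).
    by apply: measurable_funB; exact: measurable_funM.
  by apply/funext => x; case: (F x i j) (G x j k) => ? ? [].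
under eq_fun do rewrite mxE raddf_sum; apply: measurable_sum => j.
have [F1 F2] := mF i j; have [G1 G2] := mG j k.
rewrite (_ : (fun _ => _) = (fun x => complex.Re (F x i j) * complex.Im (G x j k)
   + complex.Im (F x i j) * complex.Re (G x j k))).
  by apply: measurable_funD; exact: measurable_funM.
by apply/funext => x; case: (F x i j) (G x j k) => ? ? [].
Qed.

Lemma mxmeasZ p q c (F : X -> 'M[C]_(p, q)) :
  mxmeas F -> mxmeas (fun x => c *: F x).
Proof.
move=> mF; under eq_fun do rewrite -mul_scalar_mx.
by apply: mxmeasM => //; exact: mxmeas_cst.
Qed.

Lemma mxmeas_adj p q (F : X -> 'M[C]_(p, q)) :
  mxmeas F -> mxmeas (fun x => (F x)^t*).
Proof.
move=> mF i k; have [F1 F2] := mF k i; split.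
  rewrite (_ : (fun _ => _) = (fun x => complex.Re (F x k i)))//.
  by apply/funext => x; rewrite !mxE; case: (F x k i).
rewrite (_ : (fun _ => _) = (fun x => - complex.Im (F x k i))).
  exact: measurable_funN.
by apply/funext => x; rewrite !mxE; case: (F x k i).
Qed.

Lemma mxmeas_if p q (b : X -> bool) (F G : X -> 'M[C]_(p, q)) :
  measurable_fun setT b -> mxmeas F -> mxmeas G ->
  mxmeas (fun x => if b x then F x else G x).
Proof.
move=> mb mF mG i k; have [F1 F2] := mF i k; have [G1 G2] := mG i k; split.
  rewrite (_ : (fun _ => _) = (fun x => if b x then complex.Re (F x i k)
                                        else complex.Re (G x i k))).
    exact: measurable_fun_ifT.
  by apply/funext => x; case: ifP.
rewrite (_ : (fun _ => _) = (fun x => if b x then complex.Im (F x i k)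
                                      else complex.Im (G x i k))).
  exact: measurable_fun_ifT.
by apply/funext => x; case: ifP.
Qed.

Lemma measurable_nrm p q (F : X -> 'M[C]_(p, q)) :
  mxmeas F -> measurable_fun setT (fun x => nrm (F x)).
Proof.
move=> mF; apply: measurable_sum => i; apply: measurable_sum => k.
have [F1 F2] := mF i k.
by apply: measurable_funD; exact: measurableT_comp.
Qed.

(** Serves to make the pointwise limit of the Picard iterates measurable. *)
Lemma mxmeas_cvg p q (F : nat -> X -> 'M[C]_(p, q)) (G : X -> 'M[C]_(p, q)) :
  (forall n, mxmeas (F n)) ->
  (forall x, nrm (F n x - G x) @[n --> \oo] --> 0) -> mxmeas G.
Proof.
move=> mF FG i k; have small x n : `|complex.Re (F n x i k) - complex.Re (G x i k)|
    <= nrm (F n x - G x) /\ `|complex.Im (F n x i k) - complex.Im (G x i k)|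
    <= nrm (F n x - G x).
  have := absC_le_nrm (F n x - G x) i k; rewrite !mxE /absC !raddfB /=.
  have := normr_ge0 (complex.Re (F n x i k) - complex.Re (G x i k)).
  have := normr_ge0 (complex.Im (F n x i k) - complex.Im (G x i k)).
  by lra.
have cvg0 (f : nat -> R) l (g : nat -> R) :
    (forall n, `|f n - l| <= g n) -> g @ \oo --> 0 -> f @ \oo --> l.
  move=> fg g0; apply/cvgrPdist_le => e e0.
  move/cvgrPdist_le : g0 => /(_ e e0); apply: filterS => n /=.
  rewrite sub0r normrN => h; rewrite distrC (le_trans (fg n))//.
  exact: le_trans (ler_norm _) h.
split.
  apply: (@measurable_fun_cvg _ X R setT (fun n x => complex.Re (F n x i k)) (fun x => complex.Re (G x i k))).
    by move=> n; case: (mF n i k).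
  by move=> x _; apply: cvg0 (FG x) => n; case: (small x n).
apply: (@measurable_fun_cvg _ X R setT (fun n x => complex.Im (F n x i k)) (fun x => complex.Im (G x i k))).
  by move=> n; case: (mF n i k).
by move=> x _; apply: cvg0 (FG x) => n; case: (small x n).
Qed.

(** Tonelli's theorem applies to the positive and the negative part separately, and [fine] is
    measurable with value 0 at infinity; hence integrability of the slices does not enter. *)
Lemma measurable_Rintegral_param (f : X * measurableTypeR R -> R) :
  measurable_fun setT f ->
  measurable_fun setT (fun x => \int[mu]_t f (x, t)).
Proof.
move=> mf; have mF : measurable_fun setT (EFin \o f) by exact/measurable_EFinP.
apply: (measurableT_comp (fine_measurable _)) => //.
rewrite (_ : (fun _ => _) = (fun x => \int[mu]_t (EFin \o f)^\+%E (x, t)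
   - \int[mu]_t (EFin \o f)^\-%E (x, t))%E).
  apply: emeasurable_funB.
    apply: (measurable_fun_fubini_tonelli_F (EFin \o f)^\+%E) => //.
    exact: measurable_funepos.
  apply: (measurable_fun_fubini_tonelli_F (EFin \o f)^\-%E) => //.
  exact: measurable_funeneg.
apply/funext => x; rewrite integralE.
by congr (_ - _)%E; apply: eq_integral => t _; rewrite ?funeposE ?funenegE.
Qed.

Lemma mxmeas_integral p q (F : X * measurableTypeR R -> 'M[C]_(p, q)) :
  (forall i k, cmeasurable setT (fun x => F x i k)) ->
  mxmeas (fun x => mx_integral setT (fun t => F (x, t))).
Proof.
move=> mF i k; have [F1 F2] := mF i k; split.
  under eq_fun do rewrite mxE; exact: (measurable_Rintegral_param F1).
under eq_fun do rewrite mxE; exact: (measurable_Rintegral_param F2).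
Qed.

End MatrixMeasurability.

Lemma mxmeas_comp (R : realType) d d' (X : measurableType d)
    (Y : measurableType d') p q (F : Y -> 'M[R[i]]_(p, q)) (g : X -> Y) :
  mxmeas F -> measurable_fun setT g -> mxmeas (fun x => F (g x)).
Proof.
move=> mF mg i k; have [F1 F2] := mF i k.
by split; [exact: (measurableT_comp F1 mg)|exact: (measurableT_comp F2 mg)].
Qed.

Section Ae.
Context {R : realType}.
Local Notation mu := (@lebesgue_measure R).

#[local] Instance ae_lebesgue_filter : Filter (almost_everywhere mu).
Proof. exact: (@ae_filter_ringOfSetsType _ (measurableTypeR R) R mu). Qed.

Lemma aeS (P Q : R -> Prop) : {ae mu, forall t, P t} ->
  (forall t, P t -> Q t) -> {ae mu, forall t, Q t}.
Proof. by move=> hP PQ; apply: filterS hP => t /PQ. Qed.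

Lemma aeI (P Q : R -> Prop) : {ae mu, forall t, P t} -> {ae mu, forall t, Q t} ->
  {ae mu, forall t, P t /\ Q t}.
Proof. by move=> hP hQ; apply: filterS2 hP hQ. Qed.

Lemma ae_eq_on V (D : set R) (f g : R -> V) :
  {ae mu, forall t, D t -> f t = g t} -> @ae_eq _ (measurableTypeR R) R mu (fun=> V) D f g.
Proof. by []. Qed.

End Ae.

(** * Linearity of complex integrals *)

Section ComplexIntegral.
Context {R : realType}.
Local Notation C := R[i].
Local Notation mu := (@lebesgue_measure R).

Definition cintegrable (f : R -> C) :=
  mu.-integrable setT (EFin \o (fun t => complex.Re (f t))) /\
  mu.-integrable setT (EFin \o (fun t => complex.Im (f t))).

Lemma integrableDr (f g : R -> R) :
  mu.-integrable setT (EFin \o f) -> mu.-integrable setT (EFin \o g) ->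
  mu.-integrable setT (EFin \o (fun t => f t + g t)).
Proof. by move=> If Ig; have := integrableD measurableT If Ig. Qed.

Lemma integrableBr (f g : R -> R) :
  mu.-integrable setT (EFin \o f) -> mu.-integrable setT (EFin \o g) ->
  mu.-integrable setT (EFin \o (fun t => f t - g t)).
Proof. by move=> If Ig; have := integrableB measurableT If Ig. Qed.

Lemma integrableZr' (c : R) (f : R -> R) :
  mu.-integrable setT (EFin \o f) ->
  mu.-integrable setT (EFin \o (fun t => c * f t)).
Proof. by move=> If; have := integrableZl measurableT c If. Qed.

Lemma cintegrableD f g : cintegrable f -> cintegrable g ->
  cintegrable (fun t => f t + g t).
Proof.
case=> [f1 f2] [g1 g2]; split.
  under eq_fun do rewrite raddfD; exact: integrableDr.
under eq_fun do rewrite raddfD; exact: integrableDr.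
Qed.

Lemma cintegralD f g : cintegrable f -> cintegrable g ->
  cintegral setT (fun t => f t + g t) = cintegral setT f + cintegral setT g.
Proof.
case=> [f1 f2] [g1 g2]; rewrite /cintegral.
under eq_Rintegral do rewrite raddfD.
under [X in Complex _ X]eq_Rintegral do rewrite raddfD.
by rewrite !RintegralD.
Qed.

Lemma cintegrableZ c f : cintegrable f -> cintegrable (fun t => c * f t).
Proof.
case: c => a b [f1 f2]; split.
  rewrite (_ : (fun _ => _) = (fun t => a * complex.Re (f t) - b * complex.Im (f t))).
    by apply: integrableBr; exact: integrableZr'.
  by apply/funext => t; case: (f t).
rewrite (_ : (fun _ => _) = (fun t => a * complex.Im (f t) + b * complex.Re (f t))).
  by apply: integrableDr; exact: integrableZr'.
by apply/funext => t; case: (f t).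
Qed.

Lemma cintegralZ c f : cintegrable f ->
  cintegral setT (fun t => c * f t) = c * cintegral setT f.
Proof.
case: c => a b [f1 f2]; rewrite /cintegral.
rewrite (_ : (fun t => complex.Re _) =
    (fun t => a * complex.Re (f t) - b * complex.Im (f t))); last first.
  by apply/funext => t; case: (f t).
rewrite (_ : (fun t => complex.Im (_ * _)) =
    (fun t => a * complex.Im (f t) + b * complex.Re (f t))); last first.
  by apply/funext => t; case: (f t).
rewrite RintegralB//; [|exact: integrableZr'..].
by rewrite RintegralD ?RintegralZl//; exact: integrableZr'.
Qed.

Lemma cintegral_sum n (f : 'I_n -> R -> C) : (forall j, cintegrable (f j)) ->
  cintegrable (fun t => \sum_j f j t) /\
  cintegral setT (fun t => \sum_j f j t) = \sum_j cintegral setT (f j).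
Proof.
elim: n f => [|n IH] f fi.
  under eq_fun do rewrite big_ord0; rewrite big_ord0; split.
    by split; exact: integrable0.
  by rewrite /cintegral /= !Rintegral_cst// !mul0r.
have [IH1 IH2] := IH (fun j => f (lift ord0 j)) (fun j => fi _).
under eq_fun do rewrite big_ord_recl; split; first exact: cintegrableD.
by rewrite cintegralD// IH2 big_ord_recl.
Qed.

End ComplexIntegral.

(** * Integrals of matrix functions: linearity, norm bounds, Fubini, translation *)

Section MatrixIntegral.
Context {R : realType}.
Local Notation C := R[i].
Local Notation mu := (@lebesgue_measure R).
Local Notation RR := (measurableTypeR R).
Local Notation mmeas F := (@mxmeas R _ RR _ _ F).
Local Notation intg b := (mu.-integrable setT (EFin \o b)).
Local Notation mxint := (mx_integrable setT).
Local Notation I := (mx_integral setT).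

Lemma intg_dom (f b : R -> R) : measurable_fun [set: RR] f -> intg b ->
  (forall t, `|f t| <= b t) -> intg f.
Proof.
move=> mf bi fb; apply: (@le_integrable _ RR R mu setT measurableT _ (EFin \o b)) => //.
  exact/measurable_EFinP.
by move=> x _ /=; rewrite lee_fin (le_trans (fb x))// ler_norm.
Qed.

Lemma intg_meas (f : R -> R) : intg f -> measurable_fun [set: RR] f.
Proof. by move=> /integrableP[/measurable_EFinP]. Qed.

Lemma mxint_dom p q (F : R -> 'M[C]_(p, q)) b : mmeas F -> intg b ->
  (forall t, nrm (F t) <= b t) -> mxint F.
Proof.
move=> mF bi Fb i k; have [F1 F2] := mF i k.
have le t := le_trans (absC_le_nrm (F t) i k) (Fb t).
split.
  apply: (intg_dom F1 bi) => t; apply: le_trans (le t).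
  by rewrite /absC lerDl.
apply: (intg_dom F2 bi) => t; apply: le_trans (le t).
by rewrite /absC lerDr.
Qed.

Lemma mxint_meas p q (F : R -> 'M[C]_(p, q)) : mxint F -> mmeas F.
Proof. by move=> Fi i k; have [/intg_meas ? /intg_meas ?] := Fi i k. Qed.

Lemma mxint_nrm p q (F : R -> 'M[C]_(p, q)) : mxint F -> intg (fun t => nrm (F t)).
Proof.
move=> Fi; rewrite (_ : EFin \o _ =
    (fun t => \sum_i \sum_k (absC (F t i k))%:E)%E); last first.
  by apply/funext => t /=; rewrite /nrm -sumEFin; apply: eq_bigr => i _; rewrite sumEFin.
apply: integrable_sum => // i _; apply: integrable_sum => // k _.
have [F1 F2] := Fi i k.
have := integrableDr (integrable_norm F1) (integrable_norm F2).
by [].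
Qed.

Lemma mx_integralE p q (F : R -> 'M[C]_(p, q)) i k :
  I F i k = cintegral setT (fun t => F t i k).
Proof. by rewrite mxE. Qed.

Lemma mxintD p q (F G : R -> 'M[C]_(p, q)) : mxint F -> mxint G ->
  mxint (fun t => F t + G t).
Proof.
move=> Fi Gi i k; have := cintegrableD (Fi i k) (Gi i k).
rewrite (_ : (fun t => F t i k + G t i k) = (fun t => (F t + G t) i k))//.
by apply/funext => t; rewrite mxE.
Qed.

Lemma mx_integralD p q (F G : R -> 'M[C]_(p, q)) : mxint F -> mxint G ->
  I (fun t => F t + G t) = I F + I G.
Proof.
move=> Fi Gi; apply/matrixP => i k; rewrite !mxE.
rewrite -(cintegralD (Fi i k) (Gi i k)).
by congr cintegral; apply/funext => t; rewrite mxE.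
Qed.

Lemma mxintMl p q r (A : 'M[C]_(p, q)) (F : R -> 'M[C]_(q, r)) : mxint F ->
  mxint (fun t => A *m F t).
Proof.
move=> Fi i k; change (cintegrable (fun t => (A *m F t) i k)).
rewrite (_ : (fun t => (A *m F t) i k) =
  (fun t => \sum_j A i j * F t j k)).
  by apply: (cintegral_sum _).1 => j; apply: cintegrableZ; exact: Fi.
by apply/funext => t; rewrite mxE.
Qed.

Lemma mx_integralMl p q r (A : 'M[C]_(p, q)) (F : R -> 'M[C]_(q, r)) : mxint F ->
  I (fun t => A *m F t) = A *m I F.
Proof.
move=> Fi; apply/matrixP => i k; rewrite !mxE.
rewrite (_ : (fun t => (A *m F t) i k) =
  (fun t => \sum_j A i j * F t j k)); last by apply/funext => t; rewrite mxE.
rewrite (cintegral_sum _).2; last by move=> j; apply: cintegrableZ; exact: Fi.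
by apply: eq_bigr => j _; rewrite cintegralZ ?mxE//; exact: Fi.
Qed.

Lemma mxintMr p q r (A : 'M[C]_(q, r)) (F : R -> 'M[C]_(p, q)) : mxint F ->
  mxint (fun t => F t *m A).
Proof.
move=> Fi i k; change (cintegrable (fun t => (F t *m A) i k)).
rewrite (_ : (fun t => (F t *m A) i k) =
  (fun t => \sum_j A j k * F t i j)).
  by apply: (cintegral_sum _).1 => j; apply: cintegrableZ; exact: Fi.
by apply/funext => t; rewrite mxE; apply: eq_bigr => j _; rewrite mulrC.
Qed.

Lemma mx_integralMr p q r (A : 'M[C]_(q, r)) (F : R -> 'M[C]_(p, q)) : mxint F ->
  I (fun t => F t *m A) = I F *m A.
Proof.
move=> Fi; apply/matrixP => i k; rewrite !mxE.
rewrite (_ : (fun t => (F t *m A) i k) =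
  (fun t => \sum_j A j k * F t i j)); last first.
  by apply/funext => t; rewrite mxE; apply: eq_bigr => j _; rewrite mulrC.
rewrite (cintegral_sum _).2; last by move=> j; apply: cintegrableZ; exact: Fi.
by apply: eq_bigr => j _; rewrite cintegralZ ?mxE 1?mulrC//; exact: Fi.
Qed.

Lemma mxintZ p q c (F : R -> 'M[C]_(p, q)) : mxint F -> mxint (fun t => c *: F t).
Proof. by move=> Fi; under eq_fun do rewrite -mul_scalar_mx; exact: mxintMl. Qed.

Lemma mx_integralZ p q c (F : R -> 'M[C]_(p, q)) : mxint F ->
  I (fun t => c *: F t) = c *: I F.
Proof.
by move=> Fi; under eq_fun do rewrite -mul_scalar_mx; rewrite mx_integralMl// mul_scalar_mx.
Qed.

Lemma mxintN p q (F : R -> 'M[C]_(p, q)) : mxint F -> mxint (fun t => - F t).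
Proof. by move=> Fi; under eq_fun do rewrite -scaleN1r; exact: mxintZ. Qed.

Lemma mx_integralN p q (F : R -> 'M[C]_(p, q)) : mxint F ->
  I (fun t => - F t) = - I F.
Proof.
by move=> Fi; under eq_fun do rewrite -scaleN1r; rewrite mx_integralZ// scaleN1r.
Qed.

Lemma mxintB p q (F G : R -> 'M[C]_(p, q)) : mxint F -> mxint G ->
  mxint (fun t => F t - G t).
Proof. by move=> Fi Gi; apply: mxintD => //; exact: mxintN. Qed.

Lemma mx_integralB p q (F G : R -> 'M[C]_(p, q)) : mxint F -> mxint G ->
  I (fun t => F t - G t) = I F - I G.
Proof. by move=> Fi Gi; rewrite mx_integralD ?mx_integralN//; exact: mxintN. Qed.

Lemma mx_integral0 p q : I (fun=> 0 : 'M[C]_(p, q)) = 0.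
Proof.
apply/matrixP => i k; rewrite !mxE /cintegral.
by rewrite /= !Rintegral_cst// !mul0r.
Qed.

Lemma eq_mx_integral p q (F G : R -> 'M[C]_(p, q)) : F =1 G -> I F = I G.
Proof. by move=> FG; congr mx_integral; exact/funext. Qed.

Lemma RintegralZ_sum n (f : 'I_n -> R -> R) : (forall j, intg (f j)) ->
  intg (fun t => \sum_j f j t) /\
  \int[mu]_t (\sum_j f j t) = \sum_j \int[mu]_t f j t.
Proof.
elim: n f => [|n IH] f fi.
  under eq_fun do rewrite big_ord0; rewrite big_ord0; split.
    exact: integrable0.
  by rewrite Rintegral_cst// mul0r.
have [IH1 IH2] := IH (fun j => f (lift ord0 j)) (fun j => fi _).
under eq_fun do rewrite big_ord_recl; split; first exact: integrableDr.
by rewrite RintegralD// IH2 big_ord_recl.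
Qed.

Lemma nrm_mx_integral p q (F : R -> 'M[C]_(p, q)) b : mmeas F -> intg b ->
  (forall t, nrm (F t) <= b t) -> nrm (I F) <= \int[mu]_t b t.
Proof.
move=> mF bi Fb; have Fi := mxint_dom mF bi Fb.
have ai i k : intg (fun t => absC (F t i k)).
  by have [F1 F2] := Fi i k; exact: integrableDr (integrable_norm F1) (integrable_norm F2).
have ri i : intg (fun t => \sum_k absC (F t i k)) by exact: (RintegralZ_sum (ai i)).1.
apply: (@le_trans _ _ (\int[mu]_t nrm (F t))); last first.
  by apply: le_Rintegral => //; exact: mxint_nrm.
rewrite (RintegralZ_sum ri).2; apply: ler_sum => i _.
rewrite (RintegralZ_sum (ai i)).2; apply: ler_sum => k _.
have [F1 F2] := Fi i k; rewrite /absC RintegralD//; [|exact: integrable_norm..].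
rewrite mxE; apply: lerD; exact: le_normr_Rintegral.
Qed.

(** Every interval is absorbed into the integrand, so that all integrals run over the whole line and
    neither a translation nor an exchange of integrals has to alter a domain. *)
Lemma mx_integral_itv p q x (F : R -> 'M[C]_(p, q)) :
  mx_integral `]0, x[ F = I (fun t => if 0 < t < x then F t else 0).
Proof.
have mem t : (t \in `]0, x[%classic) = (0 < t < x).
  by apply/idP/idP; rewrite inE /= in_itv.
apply/matrixP => i k; rewrite !mxE /cintegral; congr Complex.
  rewrite Rintegral_mkcond; apply: eq_Rintegral => t _.
  by rewrite patchE mem; case: ifP; rewrite ?mxE.
rewrite Rintegral_mkcond; apply: eq_Rintegral => t _.
by rewrite patchE mem; case: ifP; rewrite ?mxE.
Qed.

Lemma ae_mx_integral p q (F G : R -> 'M[C]_(p, q)) : mmeas F -> mmeas G ->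
  {ae mu, forall t, F t = G t} -> I F = I G.
Proof.
move=> mF mG FG; apply/matrixP => i k; rewrite !mxE /cintegral.
have [F1 F2] := mF i k; have [G1 G2] := mG i k; congr Complex; congr fine.
  apply: ae_eq_integral => //; [exact/measurable_EFinP..|].
  by apply: ae_eq_on; refine (aeS FG _) => t ->.
apply: ae_eq_integral => //; [exact/measurable_EFinP..|].
by apply: ae_eq_on; refine (aeS FG _) => t ->.
Qed.

Lemma RFubini (h : RR * RR -> R) : measurable_fun setT h ->
  (\int[mu]_x \int[mu]_y `|h (x, y)|%:E < +oo)%E ->
  \int[mu]_x \int[mu]_y h (x, y) = \int[mu]_y \int[mu]_x h (x, y).
Proof.
move=> mh hoo; have mH : measurable_fun setT (EFin \o h) by exact/measurable_EFinP.
have Hi : (mu \x mu)%E.-integrable setT (EFin \o h) by exact/integrable12ltyP.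
(* Only almost every slice is integrable. On the others the real-valued integral takes a default
   value, so the two kinds of inner integral agree merely almost everywhere. *)
have inner (g : RR -> RR -> R) : measurable_fun setT (fun p : RR * RR => g p.1 p.2) ->
    {ae mu, forall x, mu.-integrable setT (EFin \o g x)} ->
    (\int[mu]_x (\int[mu]_y g x y)%:E = \int[mu]_x \int[mu]_y (g x y)%:E)%E.
  move=> mg gi; apply: ae_eq_integral => //.
  - apply/measurable_EFinP.
    exact: (@measurable_Rintegral_param _ _ RR (fun p => g p.1 p.2)).
  - have mg' : measurable_fun setT (EFin \o (fun p : RR * RR => g p.1 p.2)).
      exact/measurable_EFinP.
    rewrite (_ : (fun _ => _) = (fun x => \int[mu]_y
      (EFin \o (fun p : RR * RR => g p.1 p.2))^\+%E (x, y)
      - \int[mu]_y (EFin \o (fun p : RR * RR => g p.1 p.2))^\-%E (x, y))%E).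
      apply: emeasurable_funB.
        apply: (measurable_fun_fubini_tonelli_F
          (EFin \o (fun p : RR * RR => g p.1 p.2))^\+%E) => //.
        exact: measurable_funepos.
      apply: (measurable_fun_fubini_tonelli_F
        (EFin \o (fun p : RR * RR => g p.1 p.2))^\-%E) => //.
      exact: measurable_funeneg.
    apply/funext => x; rewrite integralE.
    by congr (_ - _)%E; apply: eq_integral => t _; rewrite ?funeposE ?funenegE.
  - apply: ae_eq_on; refine (aeS gi _) => x /= gx _; rewrite fineK//.
    exact: (integrable_fin_num measurableT gx).
rewrite {1 3}/Rintegral; congr fine.
rewrite (inner (fun x y => h (x, y))); last 2 first.
- by rewrite (_ : (fun _ => _) = h)//; apply/funext => -[].
- exact: ae_integrable1 Hi.
rewrite (inner (fun y x => h (x, y))); last 2 first.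
- apply: (measurableT_comp mh); apply: measurable_fun_pair => //.
- exact: ae_integrable2 Hi.
exact: (Fubini Hi).
Qed.

Lemma mx_Fubini p q (G : R -> R -> 'M[C]_(p, q)) (b : R -> R) :
  mxmeas (fun z : RR * RR => G z.1 z.2) -> intg b ->
  (forall x, \int[mu]_y (nrm (G x y))%:E <= (b x)%:E)%E ->
  I (fun x => I (fun y => G x y)) = I (fun y => I (fun x => G x y)).
Proof.
move=> mG bi Gb.
have lty (h : RR * RR -> R) : measurable_fun setT h ->
    (forall x y, `|h (x, y)| <= nrm (G x y)) ->
    (\int[mu]_x \int[mu]_y `|h (x, y)|%:E < +oo)%E.
  move=> mh hG; apply: le_lt_trans (integrable_lty measurableT bi).
  have mabs : measurable_fun setT (fun z : RR * RR => `|h z|%:E).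
    by apply/measurable_EFinP; exact: measurableT_comp.
  apply: ge0_le_integral => //=.
  - by move=> x _; apply: integral_ge0 => y _; rewrite lee_fin.
  - exact: (measurable_fun_fubini_tonelli_F (fun z : RR * RR => `|h z|%:E)).
  - by apply/measurable_EFinP; exact: (intg_meas bi).
  move=> x _; apply: le_trans (Gb x); apply: ge0_le_integral => //.
  - apply: (measurableT_comp mabs); exact: pair1_measurable.
  - apply/measurable_EFinP.
    apply: (@measurable_nrm _ _ RR).
    apply: (@mxmeas_comp _ _ _ RR _ _ _ (fun z => G z.1 z.2) (fun y => (x, y))) => //.
    exact: pair1_measurable.
  - by move=> y _; rewrite lee_fin.
apply/matrixP => i k; have [G1 G2] := mG i k.
have le x y := absC_le_nrm (G x y) i k.
have E (H : R -> R -> 'M[C]_(p, q)) : I (fun x => I (fun y => H x y)) i k =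
    cintegral setT (fun x => cintegral setT (fun y => H x y i k)).
  by rewrite mx_integralE; congr cintegral; apply/funext => x; rewrite mx_integralE.
have FR : \int[mu]_x \int[mu]_y complex.Re (G x y i k) =
    \int[mu]_y \int[mu]_x complex.Re (G x y i k).
  apply: (@RFubini (fun z => complex.Re (G z.1 z.2 i k)) G1).
  by apply: (lty _ G1) => x y; apply: le_trans (le x y); rewrite /absC lerDl.
have FI : \int[mu]_x \int[mu]_y complex.Im (G x y i k) =
    \int[mu]_y \int[mu]_x complex.Im (G x y i k).
  apply: (@RFubini (fun z => complex.Im (G z.1 z.2 i k)) G2).
  by apply: (lty _ G2) => x y; apply: le_trans (le x y); rewrite /absC lerDr.
refine (etrans (E G) (etrans _ (esym (E (fun y x => G x y))))).
exact (f_equal2 (@Complex R) FR FI).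
Qed.

(** By uniqueness of the Lebesgue measure it suffices that the translated measure gives each
    half-open interval its length. *)
Lemma lebesgue_measure_shift (c : R) (A : set RR) : measurable A ->
  pushforward mu ((fun t => t + c) : RR -> RR) A = mu A.
Proof.
have ms : measurable_fun setT ((fun t => t + c) : RR -> RR).
  exact: measurable_funD.
pose sm := isMeasurableFun.Build _ _ _ _ _ ms.
pose sh : {mfun RR >-> RR} := HB.pack ((fun t => t + c) : RR -> RR) sm.
move=> mA; apply/esym.
apply: (@lebesgue_measure_unique _ (pushforward mu sh)) => //= _ [[a b]] _ <-.
rewrite /pushforward (_ : _ @^-1` _ = `]a - c, b - c]%classic); last first.
  by apply/seteqP; split => t /=; rewrite !in_itv/= ltrBlDr lerBrDr.
rewrite !lebesgue_measure_itv/= !lte_fin ltrD2r.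
by case: ifP => // _; rewrite -!EFinB; congr EFin; ring.
Qed.

Lemma ge0_integral_shift (c : R) (f : R -> \bar R) :
  measurable_fun [set: RR] f -> (forall t, 0 <= f t)%E ->
  (\int[mu]_t f (t + c)%R = \int[mu]_t f t)%E.
Proof.
move=> mf f0.
have ms : measurable_fun setT ((fun t => t + c) : RR -> RR).
  exact: measurable_funD.
transitivity (\int[pushforward mu ((fun t => (t + c)%R) : RR -> RR)]_t f t)%E.
  by rewrite ge0_integral_pushforward// preimage_setT.
by apply: eq_measure_integral => A mA _; exact: lebesgue_measure_shift.
Qed.

Lemma Rintegral_shift (c : R) (f : R -> R) : measurable_fun [set: RR] f ->
  \int[mu]_t f (t + c) = \int[mu]_t f t.
Proof.
move=> mf; congr fine; have mF : measurable_fun [set: RR] (EFin \o f) by exact/measurable_EFinP.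
rewrite integralE [RHS]integralE; congr (_ - _)%E.
  transitivity (\int[mu]_t (EFin \o f)^\+%E (t + c)%R)%E.
    by apply: eq_integral => t _; rewrite [RHS]funeposE [LHS]funeposE.
  exact: ge0_integral_shift (measurable_funepos mF) (funepos_ge0 _).
transitivity (\int[mu]_t (EFin \o f)^\-%E (t + c)%R)%E.
  by apply: eq_integral => t _; rewrite [RHS]funenegE [LHS]funenegE.
exact: ge0_integral_shift (measurable_funeneg mF) (funeneg_ge0 _).
Qed.

Lemma mx_integral_shift p q (c : R) (F : R -> 'M[C]_(p, q)) : mmeas F ->
  I (fun t => F (t + c)) = I F.
Proof.
move=> mF; apply/matrixP => i k; rewrite !mxE /cintegral.
have [F1 F2] := mF i k; congr Complex.
  exact: (@Rintegral_shift c (fun t => complex.Re (F t i k))).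
exact: (@Rintegral_shift c (fun t => complex.Im (F t i k))).
Qed.

End MatrixIntegral.

(** * Contractions in weighted sup norms *)

Section WeightedFixedPoint.
Context {R : realType}.
Local Notation C := R[i].

Lemma le0_half_pow (a q : R) : (forall n, a <= q * 2^-1 ^+ n) -> a <= 0.
Proof.
move=> h; rewrite leNgt; apply/negP => a0.
have q0 : 0 < q by have := h 0%N; rewrite expr0 mulr1; exact: lt_le_trans.
have : q * 2^-1 ^+ n @[n --> \oo] --> q * 0.
  apply: cvgMr; apply: cvg_expr; rewrite ger0_norm// invf_lt1//; lra.
rewrite mulr0 => /cvgrPdist_lt/(_ a a0)[n _ /(_ n (leqnn n))]/=.
rewrite sub0r normrN ger0_norm; last by rewrite mulr_ge0 ?exprn_ge0 ?invr_ge0// ltW.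
by rewrite ltNge h.
Qed.

(** Nested intervals: [u n - 2 q / 2^n] increases, [u n + 2 q / 2^n] decreases, and the supremum of
    the former lies between them. The factor 2 is the sum of the geometric series, and the rate of
    convergence comes along with the limit. *)
Lemma half_pow_limit (u : nat -> R) (q : R) :
  (forall n, `|u n.+1 - u n| <= q * 2^-1 ^+ n) ->
  exists l, forall n, `|u n - l| <= 2 * q * 2^-1 ^+ n.
Proof.
move=> hu; pose a n := u n - 2 * q * 2^-1 ^+ n; pose b n := u n + 2 * q * 2^-1 ^+ n.
have q0 : 0 <= q by have := hu 0%N; rewrite expr0 mulr1; exact: le_trans.
have ha n : a n <= a n.+1.
  by have := hu n; rewrite ler_norml => /andP[h1 h2]; rewrite /a exprS; set t := _ ^+ n in h1 h2 *; lra.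
have hb n : b n.+1 <= b n.
  by have := hu n; rewrite ler_norml => /andP[h1 h2]; rewrite /b exprS; set t := _ ^+ n in h1 h2 *; lra.
have homa : {homo a : m n / (m <= n)%N >-> m <= n} by apply: homo_leq => // x y z; exact: le_trans.
have homb : {homo b : m n / (m <= n)%N >-> n <= m}.
  by apply: (homo_leq (r := fun x y => y <= x)) => // y x z xy yz; exact: le_trans yz xy.
have ab n : a n <= b n.
  rewrite /a /b; have : 0 <= q * 2^-1 ^+ n by rewrite mulr_ge0 ?exprn_ge0.
  by set t := _ ^+ n; lra.
have abmn m n : a m <= b n.
  apply: le_trans (homa _ _ (leq_maxl m n)) _.
  exact: le_trans (ab _) (homb _ _ (leq_maxr m n)).
exists (sup (range a)) => n.
have h1 : a n <= sup (range a).
  by apply: ub_le_sup; [exists (b 0%N) => _ [m _ <-]|exists n].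
have h2 : sup (range a) <= b n.
  by apply: ge_sup; [exists (a 0%N); exists 0%N|move=> _ [m _ <-]].
by move: h1 h2; rewrite /a /b ler_norml; set t := _ ^+ n => h1 h2; apply/andP; split; lra.
Qed.

(** The factor 4 is 2 for the real part plus 2 for the imaginary part of each of the [p * q]
    entries. *)
Lemma mx_half_pow_limit p q (u : nat -> 'M[C]_(p, q)) (c : R) :
  (forall n, nrm (u n.+1 - u n) <= c * 2^-1 ^+ n) ->
  exists l, forall n, nrm (u n - l) <= 4 * (p * q)%:R * c * 2^-1 ^+ n.
Proof.
move=> hu.
have hR i k : {l | forall n, `|complex.Re (u n i k) - l| <= 2 * c * 2^-1 ^+ n}.
  apply/cid/half_pow_limit => n; apply: le_trans (hu n).
  have := absC_le_nrm (u n.+1 - u n) i k; rewrite !mxE /absC !raddfB /=.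
  by apply: le_trans; rewrite lerDl.
have hI i k : {l | forall n, `|complex.Im (u n i k) - l| <= 2 * c * 2^-1 ^+ n}.
  apply/cid/half_pow_limit => n; apply: le_trans (hu n).
  have := absC_le_nrm (u n.+1 - u n) i k; rewrite !mxE /absC !raddfB /=.
  by apply: le_trans; rewrite lerDr.
exists (\matrix_(i, k) Complex (sval (hR i k)) (sval (hI i k))) => n.
apply: (@le_trans _ _ (\sum_(i < p) \sum_(k < q) 4 * c * 2^-1 ^+ n)).
  apply: ler_sum => i _; apply: ler_sum => k _; rewrite !mxE /absC !raddfB /=.
  by have := svalP (hR i k) n; have := svalP (hI i k) n; set t := _ ^+ n; lra.
rewrite !sumr_const !card_ord -mulrnA -[_ *+ (q * p)]mulr_natr (mulnC q).
by rewrite le_eqVlt; apply/orP; left; apply/eqP; ring.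
Qed.

Context d (X : measurableType d) (w : X -> R).
Context p q (Phi : (X -> 'M[C]_(p, q)) -> X -> 'M[C]_(p, q)).

Definition wbounded (g : X -> 'M[C]_(p, q)) :=
  mxmeas g /\ exists c : R, forall x, nrm (g x) <= c * w x.

(** The constant [c] stands for the weighted sup norm of [g - h]. Since every admissible bound is
    halved, the supremum itself is never formed. *)
Definition wcontraction := forall g h (c : R), wbounded g -> wbounded h ->
  (forall x, nrm (g x - h x) <= c * w x) ->
  forall x, nrm (Phi g x - Phi h x) <= c * 2^-1 * w x.

Lemma wcontraction_uniq g h : wcontraction -> wbounded g -> wbounded h ->
  Phi g =1 g -> Phi h =1 h -> g =1 h.
Proof.
move=> cPhi bg bh gE hE x.
have [[mg [cg Hg]] [mh [ch Hh]]] := (bg, bh).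
have H n y : nrm (g y - h y) <= (cg + ch) * 2^-1 ^+ n * w y.
  elim: n y => [|n IH] y.
    rewrite expr0 mulr1 mulrDl; apply: le_trans (nrmB _ _) _; exact: lerD.
  have := cPhi g h _ bg bh IH y; rewrite gE hE exprS => /le_trans; apply.
  by rewrite le_eqVlt; apply/orP; left; apply/eqP; ring.
have : nrm (g x - h x) <= 0.
  apply: (@le0_half_pow _ ((cg + ch) * w x)) => n.
  by apply: le_trans (H n x) _; rewrite mulrAC.
move=> h0; apply/eqP; rewrite -subr_eq0; apply/eqP/nrm_eq0/eqP.
by rewrite eq_le h0 nrm_ge0.
Qed.

(** The iterates starting from 0 converge at each point with an explicit rate, so no completeness of
    a function space is involved. The constant in the bound is the one of [mx_half_pow_limit], read
    off at the iterate 0. *)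
Lemma wcontraction_fixpoint (c : R) : wcontraction ->
  (forall g, wbounded g -> mxmeas (Phi g)) ->
  (forall x, nrm (Phi (fun=> 0) x) <= c * w x) ->
  exists g, [/\ mxmeas g, forall x, nrm (g x) <= 4 * (p * q)%:R * c * w x &
    Phi g =1 g].
Proof.
move=> cPhi mPhi Phi0.
pose u n := iter n Phi (fun=> 0).
have b0 : wbounded (fun=> 0).
  by split; [exact: mxmeas_cst|exists 0 => x; rewrite nrm0 mul0r].
have bPhi g : wbounded g -> wbounded (Phi g).
  move=> bg; split; first exact: mPhi.
  have [mg [cg Hg]] := bg; exists (cg * 2^-1 + c) => x.
  rewrite -[Phi g x](subrK (Phi (fun=> 0) x)) mulrDl.
  apply: le_trans (nrmD _ _) (lerD _ (Phi0 x)).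
  by apply: cPhi => // y; rewrite subr0.
have bu n : wbounded (u n) by elim: n => [|n IH] //=; exact: bPhi.
have step n x : nrm (u n.+1 x - u n x) <= c * w x * 2^-1 ^+ n.
  elim: n x => [|n IH] x; first by rewrite expr0 mulr1 /= subr0.
  have := @cPhi (u n.+1) (u n) (c * 2^-1 ^+ n) (bu _) (bu _).
  move=> /(_ _ x); rewrite exprS => h; apply: le_trans (h _) _.
    by move=> y; apply: le_trans (IH y) _; rewrite mulrAC.
  by rewrite le_eqVlt; apply/orP; left; apply/eqP; ring.
pose K : R := 4 * (p * q)%:R.
have lim x : {l | forall n, nrm (u n x - l) <= K * (c * w x) * 2^-1 ^+ n}.
  exact/cid/mx_half_pow_limit.
pose g x := sval (lim x).
have ug n x : nrm (u n x - g x) <= K * c * 2^-1 ^+ n * w x.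
  by apply: le_trans (svalP (lim x) n) _; rewrite le_eqVlt; apply/orP; left; apply/eqP; ring.
have mg : mxmeas g.
  apply: (@mxmeas_cvg _ _ _ _ _ u) => [n|x]; first by case: (bu n).
  apply: (@squeeze_cvgr _ _ _ _ (fun=> 0) (fun n => K * c * w x * 2^-1 ^+ n)).
  - by apply: nearW => n; rewrite nrm_ge0/= (le_trans (ug n x))// mulrAC.
  - exact: cvg_cst.
  - rewrite -[X in _ --> X](mulr0 (K * c * w x)); apply: cvgMr; apply: cvg_expr.
    by rewrite ger0_norm// invf_lt1//; lra.
have gb x : nrm (g x) <= K * c * w x.
  by have := ug 0%N x; rewrite /= expr0 mulr1 sub0r nrmN.
have bg : wbounded g by split=> //; exists (K * c).
exists g; split => // x.
(* [Phi g] and [g] are both compared with [u n.+1], which is [Phi (u n)]; each difference is of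
   order [2^-n]. *)
have : nrm (Phi g x - g x) <= 0.
  apply: (@le0_half_pow _ (2 * K * c * w x)) => n.
  rewrite -[Phi g x](subrK (u n.+1 x)) -addrA; apply: le_trans (nrmD _ _) _.
  have h1 : nrm (Phi g x - u n.+1 x) <= K * c * 2^-1 ^+ n * 2^-1 * w x.
    apply: (cPhi g (u n)) => // y; rewrite -nrmN opprB; exact: ug.
  have h2 := ug n.+1 x; apply: le_trans (lerD h1 h2) _.
  have ge0 : 0 <= K * c * w x * 2^-1 ^+ n.
    have := le_trans (nrm_ge0 _) (ug n x); lra.
  by rewrite exprS; set t := _ ^+ n in ge0 *; lra.
move=> h0; apply/eqP; rewrite -subr_eq0; apply/eqP/nrm_eq0/eqP.
by rewrite eq_le h0 nrm_ge0.
Qed.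

End WeightedFixedPoint.

(** * Exponential weights and quadratic estimates on the line *)

Section RealLineIntegrals.
Context {R : realType}.
Local Notation mu := (@lebesgue_measure R).
Local Notation RR := (measurableTypeR R).
Local Notation intg b := (mu.-integrable setT (EFin \o b)).

Definition cutr (x : R) (f : R -> R) (t : R) : R := if 0 < t < x then f t else 0.

Lemma mem_itvoo (x t : R) : (t \in `]0, x[%classic) = (0 < t < x).
Proof. by apply/idP/idP; rewrite inE /= in_itv. Qed.

Lemma cutrE x f : cutr x f = f \_ `]0, x[.
Proof. by apply/funext => t; rewrite patchE mem_itvoo. Qed.

Lemma measurable_itv_cond (x : R) : measurable_fun [set: RR] (fun t : R => 0 < t < x).
Proof.
by apply: measurable_and; apply: measurable_fun_ltr => //; exact: measurable_cst.
Qed.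

Lemma measurable_cutr x f : measurable_fun [set: RR] f ->
  measurable_fun [set: RR] (cutr x f).
Proof.
by move=> mf; apply: measurable_fun_ifT => //; exact: measurable_itv_cond.
Qed.

Lemma intg_cutr1 x : intg (cutr x (fun=> 1)).
Proof.
have := @integrable_indic_itv R 0 x false true.
rewrite /= (_ : \1__ = cutr x (fun=> 1))//.
by apply/funext => t; rewrite indicE mem_itvoo /cutr; case: ifP.
Qed.

Lemma Rintegral_cutr1 x : 0 < x -> \int[mu]_t cutr x (fun=> 1) t = x.
Proof.
move=> x0; rewrite cutrE -Rintegral_mkcond Rintegral_cst// mul1r /=.
by rewrite lebesgue_measure_itv/= lte_fin x0 sube0.
Qed.

Lemma intg_cutr x f : intg f -> intg (cutr x f).
Proof.
move=> fi; apply: (intg_dom (b := fun t => `|f t|)).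
- exact: measurable_cutr (intg_meas fi).
- exact: integrable_norm.
- by move=> t; rewrite /cutr; case: ifP; rewrite ?normr0.
Qed.

Lemma le_Rintegralr (f g : R -> R) : intg f -> intg g -> (forall t, f t <= g t) ->
  \int[mu]_t f t <= \int[mu]_t g t.
Proof. by move=> fi gi fg; apply: le_Rintegral. Qed.

Lemma continuous_expRM (l : R) : continuous (fun t : R^o => expR (l * t)).
Proof.
move=> z; apply: continuous_comp; last exact: continuous_expR.
by apply: continuousM => //; exact: cst_continuous.
Qed.

Lemma intg_cutr_exp (l x : R) : 0 < l -> intg (cutr x (fun t => expR (l * t))).
Proof.
move=> l0.
apply: (intg_dom (b := fun t => expR (l * x) * cutr x (fun=> 1) t)).
- apply: measurable_cutr; apply: (measurableT_comp (@measurable_expR R)).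
  exact: measurable_funM.
- exact: integrableZr' (intg_cutr1 x).
- move=> t; rewrite /cutr; case: ifP => [/andP[_ tx]|_]; last by rewrite normr0 mulr0.
  by rewrite mulr1 ger0_norm ?expR_ge0// ler_expR ler_pM2l// ltW.
Qed.

Lemma Rintegral_exp_le (l x : R) : 0 < l ->
  \int[mu]_t cutr x (fun t => expR (l * t)) t <= l^-1 * expR (l * x).
Proof.
move=> l0; have [x0|x0] := leP x 0.
  under eq_Rintegral.
    move=> t _; rewrite /cutr ifF; last first.
      by apply/negP => /andP[t0 tx]; have := lt_trans t0 tx; rewrite ltNge x0.
    over.
  by rewrite Rintegral_cst// mul0r mulr_ge0 ?expR_ge0// invr_ge0 ltW.
pose F t := l^-1 * expR (l * t).
have cF : continuous (F : R^o -> R^o).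
  by move=> z; apply: cvgMr; exact: continuous_expRM.
have FTC : (\int[mu]_(t in `[0%R, x]) (expR (l * t))%:E = (F x)%:E - (F 0)%:E)%E.
  apply: continuous_FTC2 => //.
  - by apply: continuous_subspaceT; exact: continuous_expRM.
  - split.
    + by move=> z _; exact: ex_derive.
    + by apply/cvg_at_right_filter; exact: cF.
    + by apply/cvg_at_left_filter; exact: cF.
  - move=> z _; rewrite /F derive1E deriveM// derive_cst scaler0 addr0.
    rewrite -derive1E derive1_comp// derive1E; have /funeqP -> := @derive_expR R.
    by rewrite derive1Ml// derive1_id mulr1 [_ *: _]mulrCA mulVf ?mulr1// gt_eqF.
have le : (\int[mu]_t (cutr x (fun t => expR (l * t)) t)%:E <= (F x)%:E)%E.
  rewrite [leLHS](_ : _ = \int[mu]_(t in `]0%R, x[) (expR (l * t))%:E)%E; last first.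
    rewrite [RHS]integral_mkcond; apply: eq_integral => t _.
    by rewrite patchE mem_itvoo /cutr; case: ifP.
  apply: (@le_trans _ _ (\int[mu]_(t in `[0%R, x]) (expR (l * t))%:E)%E).
    apply: ge0_subset_integral => //.
    - apply/measurable_EFinP; apply: measurable_funTS.
      apply: (measurableT_comp (@measurable_expR R)); exact: measurable_funM.
    - by move=> t /=; rewrite !in_itv/= => /andP[/ltW -> /ltW ->].
  rewrite FTC -EFinB lee_fin gerBl mulr_ge0 ?expR_ge0// invr_ge0 ltW//.
rewrite -lee_fin /Rintegral fineK//.
exact: (integrable_fin_num measurableT (intg_cutr_exp x l0)).
Qed.

(** Young's inequality from [e (a - 1/e)^2 >= 0]. It trades a first power for a square with a free
    parameter, which is how square-summability enters the linear estimates. *)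
Lemma ger0_sq_bound (a e : R) : 0 < e -> a <= e * a ^+ 2 + e^-1.
Proof.
move=> e0; have : 0 <= e * (a - e^-1) ^+ 2 by rewrite mulr_ge0 ?sqr_ge0// ltW.
have -> : e * (a - e^-1) ^+ 2 = e * a ^+ 2 - 2 * a + e^-1 by field; lra.
have : 0 < e^-1 by rewrite invr_gt0.
have [a0|a0] := leP 0 a; first lra.
have : 0 <= e * a ^+ 2 by rewrite mulr_ge0 ?sqr_ge0// ltW.
lra.
Qed.

Lemma intg_of_sq (a : R -> R) x : measurable_fun [set: RR] a ->
  intg (fun t => a t ^+ 2) -> (forall t, 0 <= a t) ->
  intg (cutr x a).
Proof.
move=> ma ai a0; apply: (intg_dom (b := fun t => a t ^+ 2 + cutr x (fun=> 1) t)).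
- exact: measurable_cutr.
- exact: integrableDr ai (intg_cutr1 x).
- move=> t; rewrite /cutr; case: ifP => _; last by rewrite normr0 addr0 sqr_ge0.
  by rewrite ger0_norm//; have := ger0_sq_bound (a t) ltr01; rewrite invr1 mul1r.
Qed.

(* The weight turns a Volterra operator with a square-integrable kernel factor
   into a contraction. *)
Lemma exp_weight (a : R -> R) (e : R) : measurable_fun [set: RR] a ->
  intg (fun t => a t ^+ 2) -> (forall t, 0 <= a t) -> 0 < e ->
  exists2 l : R, 0 < l & forall x,
    intg (cutr x (fun t => a t * expR (l * t))) /\
    \int[mu]_t cutr x (fun t => a t * expR (l * t)) t <= e * expR (l * x).
Proof.
move=> ma ai a0 e0.
pose S := \int[mu]_t a t ^+ 2.
have S0 : 0 <= S by apply: Rintegral_ge0 => t _; exact: sqr_ge0.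
(* Young's inequality with parameter [h] bounds [a] by [h a^2 + 1/h]. This [h] makes the first
   contribution [h S] at most [e / 2], and [l] is chosen so that the second, [1 / (h l)], equals
   [e / 2]. The summand 1 keeps the denominator positive when [S = 0]. *)
pose h := e / (2 * (S + 1)).
have h0 : 0 < h by rewrite divr_gt0//; lra.
pose l := 2 / (e * h).
have l0 : 0 < l by rewrite divr_gt0// mulr_gt0.
exists l => // x.
pose b t := h * expR (l * x) * a t ^+ 2 + h^-1 * cutr x (fun t => expR (l * t)) t.
have bi : intg b.
  by apply: integrableDr; apply: integrableZr' => //; exact: intg_cutr_exp.
have ab t : cutr x (fun t => a t * expR (l * t)) t <= b t.
  rewrite /b /cutr; case: ifP => [/andP[_ tx]|_]; last first.
    by rewrite mulr0 addr0 mulr_ge0 ?sqr_ge0// mulr_ge0 ?expR_ge0// ltW.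
  apply: (@le_trans _ _ ((h * a t ^+ 2 + h^-1) * expR (l * t))).
    by rewrite ler_wpM2r ?expR_ge0// ger0_sq_bound.
  rewrite mulrDl lerD2r mulrAC ler_wpM2r ?sqr_ge0// ler_wpM2l ?(ltW h0)//.
  by rewrite ler_expR ler_pM2l// ltW.
have fi : intg (cutr x (fun t => a t * expR (l * t))).
  apply: intg_dom bi _ => [|t].
    apply: measurable_cutr; apply: measurable_funM => //.
    apply: (measurableT_comp (@measurable_expR R)); exact: measurable_funM.
  rewrite ger0_norm//; last by rewrite /cutr; case: ifP => // _; rewrite mulr_ge0 ?expR_ge0.
split=> //; apply: le_trans (le_Rintegralr fi bi ab) _.
rewrite RintegralD//; [|exact: integrableZr'|exact: integrableZr' (intg_cutr_exp _ _)].
rewrite !RintegralZl//; last exact: intg_cutr_exp.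
have le := Rintegral_exp_le x l0.
have : h^-1 * \int[mu]_t cutr x (fun t => expR (l * t)) t <= h^-1 * (l^-1 * expR (l * x)).
  by rewrite ler_wpM2l// invr_ge0 ltW.
have -> : h^-1 * (l^-1 * expR (l * x)) = e / 2 * expR (l * x).
  by rewrite /l; field; rewrite !gt_eqF.
have : h * expR (l * x) * S <= e / 2 * expR (l * x).
  rewrite mulrAC ler_wpM2r ?expR_ge0// /h.
  have -> : e / (2 * (S + 1)) * S = e / 2 * (S / (S + 1)) by field; rewrite gt_eqF//; lra.
  rewrite ler_piMr//; first by rewrite divr_ge0// ltW.
  by rewrite ler_pdivrMr ?mul1r//; lra.
by rewrite -/S; lra.
Qed.

(* Cauchy-Schwarz against the constant function, from the nonnegativity of the
   variance. *)
Lemma sqr_Rintegral_le (a : R -> R) (x : R) : 0 < x -> measurable_fun [set: RR] a ->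
  intg (fun t => a t ^+ 2) -> (forall t, 0 <= a t) ->
  (\int[mu]_t cutr x a t) ^+ 2 <= x * \int[mu]_t cutr x (fun t => a t ^+ 2) t.
Proof.
move=> x0 ma ai a0.
have fi := intg_of_sq x ma ai a0.
set M := \int[mu]_t cutr x a t; pose c := M / x.
have si := intg_cutr x ai.
have : 0 <= \int[mu]_t (cutr x (fun t => a t ^+ 2) t - 2 * c * cutr x a t
    + c ^+ 2 * cutr x (fun=> 1) t).
  apply: Rintegral_ge0 => t _; rewrite /cutr; case: ifP => _; last by rewrite !mulr0 subrr addr0.
  have -> : a t ^+ 2 - 2 * c * a t + c ^+ 2 * 1 = (a t - c) ^+ 2 by ring.
  exact: sqr_ge0.
rewrite RintegralD//; last 2 first.
- by apply: integrableBr => //; exact: integrableZr'.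
- exact: integrableZr' (intg_cutr1 x).
rewrite RintegralB//; last exact: integrableZr'.
rewrite !RintegralZl//; last exact: intg_cutr1.
rewrite Rintegral_cutr1// -/M => h.
have : 0 <= x * (\int[mu]_t cutr x (fun t => a t ^+ 2) t - 2 * c * M + c ^+ 2 * x).
  by rewrite mulr_ge0// ltW.
have -> : x * (\int[mu]_t cutr x (fun t => a t ^+ 2) t - 2 * c * M + c ^+ 2 * x) =
   x * \int[mu]_t cutr x (fun t => a t ^+ 2) t - M ^+ 2.
  by rewrite /c; field; rewrite gt_eqF.
by rewrite subr_ge0.
Qed.

End RealLineIntegrals.

(** * Square-summable functions extended by zero *)

Section SquareIntegrable.
Context {R : realType}.
Local Notation C := R[i].
Local Notation mu := (@lebesgue_measure R).
Local Notation RR := (measurableTypeR R).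
Local Notation mmeas F := (@mxmeas R _ RR _ _ F).
Local Notation intg b := (mu.-integrable setT (EFin \o b)).
Local Notation mxint := (mx_integrable setT).
Local Notation I := (mx_integral setT).

Definition cutm {p q} (x : R) (F : R -> 'M[C]_(p, q)) (t : R) : 'M[C]_(p, q) :=
  if 0 < t < x then F t else 0.

Lemma cutm_in p q x (F : R -> 'M[C]_(p, q)) t : 0 < t < x -> cutm x F t = F t.
Proof. by rewrite /cutm => ->. Qed.

Lemma cutm_out p q x (F : R -> 'M[C]_(p, q)) t : ~~ (0 < t < x) -> cutm x F t = 0.
Proof. by rewrite /cutm => /negbTE ->. Qed.

Lemma eq_cutm p q p' q' x (f g : R -> 'M[C]_(p, q)) (F G : R -> 'M[C]_(p', q')) t :
  (f t = g t -> F t = G t) -> cutm x f t = cutm x g t -> cutm x F t = cutm x G t.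
Proof. by rewrite /cutm; case: ifP. Qed.

Lemma cutm_congr p q x (F G : R -> 'M[C]_(p, q)) t :
  (0 < t < x -> F t = G t) -> cutm x F t = cutm x G t.
Proof. by rewrite /cutm; case: ifP => // tx ->. Qed.

Lemma mx_integral_cutm p q x (F : R -> 'M[C]_(p, q)) :
  mx_integral `]0, x[ F = I (cutm x F).
Proof. exact: mx_integral_itv. Qed.

Lemma nrm_cutm p q x (F : R -> 'M[C]_(p, q)) t :
  nrm (cutm x F t) = cutr x (fun t => nrm (F t)) t.
Proof. by rewrite /cutm /cutr; case: ifP; rewrite ?nrm0. Qed.

Lemma mmeas_cutm p q x (F : R -> 'M[C]_(p, q)) : mmeas F -> mmeas (cutm x F).
Proof.
move=> mF; apply: mxmeas_if => //; exact: measurable_itv_cond.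
Qed.

Lemma mxint_cutm p q x (F : R -> 'M[C]_(p, q)) : mxint F -> mxint (cutm x F).
Proof.
move=> Fi; apply: (mxint_dom (b := fun t => nrm (F t))).
- by apply: mmeas_cutm; exact: mxint_meas.
- exact: mxint_nrm.
- by move=> t; rewrite /cutm; case: ifP => _; rewrite ?nrm0 ?nrm_ge0.
Qed.

(** The support condition selects the representative that is zero off []0, T[], which may be
    translated and integrated over the whole line. [cutm T] leads from [sq_summable] to this notion
    ([sq_summable_mxL2]) and back ([sq_summable_of_cutm]). *)
Definition mxL2 {p q} (T : R) (F : R -> 'M[C]_(p, q)) :=
  [/\ mmeas F, intg (fun t => nrm (F t) ^+ 2) & forall t, ~~ (0 < t < T) -> F t = 0].

Lemma mxL2_cutr p q T (F : R -> 'M[C]_(p, q)) : mxL2 T F ->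
  (fun t => nrm (F t)) = cutr T (fun t => nrm (F t)).
Proof.
case=> _ _ F0; apply/funext => t; rewrite /cutr.
by case: ifPn => // /F0 ->; rewrite nrm0.
Qed.

Lemma mxL2_intg p q T (F : R -> 'M[C]_(p, q)) : mxL2 T F -> intg (fun t => nrm (F t)).
Proof.
move=> FL; rewrite (mxL2_cutr FL); case: FL => mF Fi F0.
by apply: intg_of_sq => //; [exact: measurable_nrm|move=> t; exact: nrm_ge0].
Qed.

Lemma mxL2_mxint p q T (F : R -> 'M[C]_(p, q)) : mxL2 T F -> mxint F.
Proof.
move=> FL; have := mxL2_intg FL; case: FL => mF _ _ Fi.
exact: mxint_dom mF Fi _.
Qed.

Lemma mxL2_intgM p q p' q' T (F : R -> 'M[C]_(p, q)) (G : R -> 'M[C]_(p', q')) :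
  mxL2 T F -> mxL2 T G -> intg (fun t => nrm (F t) * nrm (G t)).
Proof.
case=> mF Fi _ [mG Gi _].
apply: (intg_dom (b := fun t => nrm (F t) ^+ 2 + nrm (G t) ^+ 2)).
- by apply: measurable_funM; exact: measurable_nrm.
- exact: integrableDr.
- move=> t; rewrite ger0_norm ?mulr_ge0 ?nrm_ge0//.
  have := sqr_ge0 (nrm (F t) - nrm (G t)); have := nrm_ge0 (F t); have := nrm_ge0 (G t).
  nra.
Qed.

Lemma mxL2_mxintM p q r T (F : R -> 'M[C]_(p, q)) (G : R -> 'M[C]_(q, r)) :
  mxL2 T F -> mxL2 T G -> mxint (fun t => F t *m G t).
Proof.
move=> FL GL; have := mxL2_intgM FL GL; case: FL GL => mF _ _ [mG _ _] bi.
by apply: mxint_dom bi _ => [|t]; [exact: mxmeasM|exact: nrmM].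
Qed.

Lemma mxL2_bounded p q T (F : R -> 'M[C]_(p, q)) (c : R) : mmeas F ->
  (forall t, 0 < t < T -> nrm (F t) <= c) -> mxL2 T (cutm T F).
Proof.
move=> mF Fc; split; first exact: mmeas_cutm.
- apply: (intg_dom (b := fun t => c ^+ 2 * cutr T (fun=> 1) t)).
  + by apply: measurable_funX; apply: measurable_nrm; exact: mmeas_cutm.
  + by apply: integrableZr'; exact: intg_cutr1.
  + move=> t; rewrite ger0_norm ?sqr_ge0// nrm_cutm /cutr.
    case: ifP => [/Fc tc|_]; last by rewrite mulr0 expr0n.
    by rewrite mulr1 lerXn2r ?nnegrE ?nrm_ge0// (le_trans _ tc) ?nrm_ge0.
- by move=> t; rewrite /cutm => /negbTE ->.
Qed.

Lemma mxL2D p q T (F G : R -> 'M[C]_(p, q)) : mxL2 T F -> mxL2 T G ->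
  mxL2 T (fun t => F t + G t).
Proof.
case=> mF Fi F0 [mG Gi G0]; split; first exact: mxmeasD.
- apply: (intg_dom (b := fun t => 2 * nrm (F t) ^+ 2 + 2 * nrm (G t) ^+ 2)).
  + by apply: measurable_funX; apply: measurable_nrm; exact: mxmeasD.
  + by apply: integrableDr; exact: integrableZr'.
  + move=> t; rewrite ger0_norm ?sqr_ge0//.
    have h := nrmD (F t) (G t).
    have : nrm (F t + G t) ^+ 2 <= (nrm (F t) + nrm (G t)) ^+ 2.
      by rewrite lerXn2r ?nnegrE ?addr_ge0 ?nrm_ge0.
    have := sqr_ge0 (nrm (F t) - nrm (G t)); nra.
- by move=> t t0; rewrite F0// G0// addr0.
Qed.

Lemma mxL2Ml p q r T (A : 'M[C]_(p, q)) (F : R -> 'M[C]_(q, r)) : mxL2 T F ->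
  mxL2 T (fun t => A *m F t).
Proof.
case=> mF Fi F0; split; first by apply: mxmeasM => //; exact: mxmeas_cst.
- apply: (intg_dom (b := fun t => nrm A ^+ 2 * nrm (F t) ^+ 2)).
  + apply: measurable_funX; apply: measurable_nrm.
    by apply: mxmeasM => //; exact: mxmeas_cst.
  + exact: integrableZr'.
  + move=> t; rewrite ger0_norm ?sqr_ge0// -exprMn lerXn2r ?nnegrE ?nrm_ge0 ?nrmM//.
    by rewrite mulr_ge0 ?nrm_ge0.
- by move=> t t0; rewrite F0// mulmx0.
Qed.

Lemma mxL2Z p q T c (F : R -> 'M[C]_(p, q)) : mxL2 T F -> mxL2 T (fun t => c *: F t).
Proof. by move=> FL; under eq_fun do rewrite -mul_scalar_mx; exact: mxL2Ml. Qed.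

Lemma mxL2N p q T (F : R -> 'M[C]_(p, q)) : mxL2 T F -> mxL2 T (fun t => - F t).
Proof. by move=> FL; under eq_fun do rewrite -scaleN1r; exact: mxL2Z. Qed.

Lemma mxL2B p q T (F G : R -> 'M[C]_(p, q)) : mxL2 T F -> mxL2 T G ->
  mxL2 T (fun t => F t - G t).
Proof. by move=> FL GL; apply: mxL2D => //; exact: mxL2N. Qed.

Lemma mxL2Ml_bounded p q r T (H : R -> 'M[C]_(p, q)) (F : R -> 'M[C]_(q, r)) (c : R) :
  mmeas H -> (forall t, nrm (H t) <= c) -> mxL2 T F ->
  mxL2 T (fun t => H t *m F t).
Proof.
move=> mH Hc [mF Fi F0]; split; first exact: mxmeasM.
- apply: (intg_dom (b := fun t => c ^+ 2 * nrm (F t) ^+ 2)).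
  + by apply: measurable_funX; apply: measurable_nrm; exact: mxmeasM.
  + exact: integrableZr'.
  + move=> t; have c0 := le_trans (nrm_ge0 _) (Hc t).
    rewrite ger0_norm ?sqr_ge0// -exprMn lerXn2r ?nnegrE ?nrm_ge0//.
      by rewrite mulr_ge0 ?nrm_ge0.
    by apply: le_trans (nrmM _ _) _; rewrite ler_wpM2r ?nrm_ge0.
- by move=> t t0; rewrite F0// mulmx0.
Qed.

Lemma mxL2_adj p q T (F : R -> 'M[C]_(p, q)) : mxL2 T F -> mxL2 T (fun t => (F t)^t*).
Proof.
case=> mF Fi F0; split; first exact: mxmeas_adj.
  by under eq_fun do rewrite nrm_adj.
by move=> t /F0 ->; rewrite trmx0 map_mx0.
Qed.

Lemma normc_sq (z : C) :
  Normc.normc z ^+ 2 = complex.Re z ^+ 2 + complex.Im z ^+ 2.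
Proof. by case: z => a b /=; rewrite sqr_sqrtr// addr_ge0 ?sqr_ge0. Qed.

Lemma sq_summable_mxL2 p q T (F : R -> 'M[C]_(p, q)) : sq_summable T F ->
  mxL2 T (cutm T F).
Proof.
move=> FT.
have mc (f : R -> R) : measurable_fun `]0%R, T[ f -> measurable_fun [set: RR] (cutr T f).
  move=> mf; apply: measurable_fun_if => //; first exact: measurable_itv_cond.
  rewrite (_ : _ `&` _ = `]0, T[%classic)//.
  by apply/seteqP; split => t /=; rewrite in_itv/=; [case|].
have mF : mmeas (cutm T F).
  move=> i k; have [[m1 m2] _] := FT i k; split.
    rewrite (_ : (fun _ => _) = cutr T (fun x => complex.Re (F x i k))); first exact: mc.
    by apply/funext => x; rewrite /cutm /cutr; case: ifP; rewrite ?mxE.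
  rewrite (_ : (fun _ => _) = cutr T (fun x => complex.Im (F x i k))); first exact: mc.
  by apply/funext => x; rewrite /cutm /cutr; case: ifP; rewrite ?mxE.
have gi i k : intg (cutr T (fun t => Normc.normc (F t i k) ^+ 2)).
  have [[m1 m2] lt] := FT i k; apply/integrableP; split.
    apply/measurable_EFinP; apply: mc.
    rewrite (_ : (fun _ => _) = (fun t => complex.Re (F t i k) ^+ 2 + complex.Im (F t i k) ^+ 2)).
      by apply: measurable_funD; exact: measurable_funX.
    by apply/funext => t; exact: normc_sq.
  apply: le_lt_trans lt; rewrite [leRHS]integral_mkcond le_eqVlt; apply/orP; left.
  apply/eqP; apply: eq_integral => t _; rewrite patchE mem_itvoo /= /cutr.
  by case: ifP => _; rewrite ger0_norm// sqr_ge0.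
split => //; last by move=> t; rewrite /cutm => /negbTE ->.
apply: (intg_dom (b := fun t => (2 * (p * q)%:R) ^+ 2 *
    \sum_i \sum_k cutr T (fun t => Normc.normc (F t i k) ^+ 2) t)).
- by apply: measurable_funX; exact: measurable_nrm.
- apply: integrableZr'; apply: (RintegralZ_sum _).1 => i.
  exact: (RintegralZ_sum (gi i)).1.
- move=> t; rewrite ger0_norm ?sqr_ge0// nrm_cutm /cutr; case: ifP => _.
    exact: nrm_sq_le_normsq.
  by rewrite expr0n/= mulr_ge0 ?sqr_ge0// sumr_ge0// => i _; rewrite sumr_ge0.
Qed.

Lemma sq_summable_ext p q T (F G : R -> 'M[C]_(p, q)) :
  (forall t, 0 < t < T -> F t = G t) -> sq_summable T F -> sq_summable T G.
Proof.
move=> FG FT i k; have [[m1 m2] lt] := FT i k; split.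
  split.
    apply: eq_measurable_fun m1 => t; rewrite inE/= in_itv/= => tT.
    by rewrite FG.
  apply: eq_measurable_fun m2 => t; rewrite inE/= in_itv/= => tT.
  by rewrite FG.
apply: le_lt_trans lt; rewrite le_eqVlt; apply/orP; left.
apply/eqP; apply: eq_integral => t; rewrite inE/= in_itv/= => tT.
by rewrite FG.
Qed.

Lemma mxL2_sq_summable p q T (F : R -> 'M[C]_(p, q)) : mxL2 T F -> sq_summable T F.
Proof.
case=> mF Fi F0 i k; have [m1 m2] := mF i k; split.
  by split; apply: measurable_funTS.
have ni : intg (fun t => Normc.normc (F t i k) ^+ 2).
  apply: intg_dom Fi _ => [|t].
    rewrite (_ : (fun _ => _) = (fun t => complex.Re (F t i k) ^+ 2 + complex.Im (F t i k) ^+ 2)).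
      by apply: measurable_funD; exact: measurable_funX.
    by apply/funext => t; exact: normc_sq.
  rewrite ger0_norm ?sqr_ge0// lerXn2r ?nnegrE ?normc_ge0 ?nrm_ge0//.
  exact: le_trans (normc_le_absC _) (absC_le_nrm _ _ _).
have := integrable_lty measurableT ni; apply: le_lt_trans.
apply: ge0_subset_integral => //.
- by apply/measurable_EFinP; exact: (intg_meas ni).
- by move=> t _; rewrite lee_fin sqr_ge0.
Qed.

Lemma sq_summable_of_cutm p q T (F : R -> 'M[C]_(p, q)) :
  mxL2 T (cutm T F) -> sq_summable T F.
Proof.
move=> /mxL2_sq_summable; apply: sq_summable_ext => t.
by rewrite /cutm => ->.
Qed.

Lemma cutm_id p q T (F : R -> 'M[C]_(p, q)) : mxL2 T F -> cutm T F = F.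
Proof.
by case=> _ _ F0; apply/funext => t; rewrite /cutm; case: ifPn => // /F0.
Qed.

End SquareIntegrable.

Lemma subrBB (V : zmodType) (a b c : V) : (a - b) - (a - c) = - (b - c).
Proof. by rewrite opprB [c - a]addrC addrACA subrr add0r opprB addrC. Qed.

(** * Volterra operators *)

Section VolterraKernel.
Context {R : realType}.
Local Notation C := R[i].
Local Notation mu := (@lebesgue_measure R).
Local Notation RR := (measurableTypeR R).
Local Notation mmeas F := (@mxmeas R _ RR _ _ F).
Local Notation intg b := (mu.-integrable setT (EFin \o b)).
Local Notation mxint := (mx_integrable setT).
Local Notation I := (mx_integral setT).
Context (T : R).

(** Vanishing off the triangle [0 < t < x < T] turns whole-line integration into Volterra
    integration and makes the operator blind to values off []0, T[] ([vop_cutm]). Boundedness,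
    stronger than the Hilbert-Schmidt condition, makes the operator take integrable functions to
    bounded ones ([vop_bound]). *)
Definition vkernel {p q} (c : R) (k : R -> R -> 'M[C]_(p, q)) :=
  [/\ mxmeas (fun z : RR * RR => k z.1 z.2), forall x t, nrm (k x t) <= c &
      forall x t, ~~ ((0 < t < x) && (x < T)) -> k x t = 0].

Definition vop {p q r} (k : R -> R -> 'M[C]_(p, q)) (f : R -> 'M[C]_(q, r)) (x : R) :=
  I (fun t => k x t *m f t).

Lemma mxmeas_slice p q (k : R -> R -> 'M[C]_(p, q)) x :
  mxmeas (fun z : RR * RR => k z.1 z.2) -> mmeas (k x).
Proof.
move=> mk; apply: (@mxmeas_comp _ _ _ RR _ _ _ (fun z => k z.1 z.2) (fun t => (x, t))) => //.
exact: pair1_measurable.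
Qed.

Section FixedKernel.
Context p q (c : R) (k : R -> R -> 'M[C]_(p, q)) (hk : vkernel c k).

Lemma vkernel_ge0 : 0 <= c.
Proof. by case: hk => _ kc _; exact: le_trans (nrm_ge0 _) (kc 0 0). Qed.

Lemma vop_mxint r (f : R -> 'M[C]_(q, r)) x : mxint f -> mxint (fun t => k x t *m f t).
Proof.
case: hk => mk kc _ fi; apply: (mxint_dom (b := fun t => c * nrm (f t))).
- by apply: mxmeasM; [exact: mxmeas_slice|exact: mxint_meas].
- by apply: integrableZr'; exact: mxint_nrm.
- by move=> t; apply: le_trans (nrmM _ _) _; rewrite ler_wpM2r ?nrm_ge0.
Qed.

Lemma vop_meas r (f : R -> 'M[C]_(q, r)) : mmeas f -> mmeas (vop k f).
Proof.
case: hk => mk _ _ mf.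
apply: (@mxmeas_integral _ _ RR _ _ (fun z => k z.1 z.2 *m f z.2)).
apply: mxmeasM => //; exact: mxmeas_comp mf measurable_snd.
Qed.

Lemma vop_supp r (f : R -> 'M[C]_(q, r)) x : ~~ (0 < x < T) -> vop k f x = 0.
Proof.
case: hk => _ _ k0 xT; rewrite /vop -[RHS](mx_integral0 _ _); apply: eq_mx_integral => t.
rewrite k0 ?mul0mx//; apply: contra xT => /andP[/andP[t0 tx] ->].
by rewrite (lt_trans t0 tx).
Qed.

Lemma vop_bound r (f : R -> 'M[C]_(q, r)) x : mxint f ->
  nrm (vop k f x) <= c * \int[mu]_t nrm (f t).
Proof.
case: hk => mk kc _ fi; rewrite -RintegralZl//; last exact: mxint_nrm.
apply: nrm_mx_integral => [||t].
- by apply: mxmeasM; [exact: mxmeas_slice|exact: mxint_meas].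
- by apply: integrableZr'; exact: mxint_nrm.
- by apply: le_trans (nrmM _ _) _; rewrite ler_wpM2r ?nrm_ge0.
Qed.

Lemma vop_mxL2 r (f : R -> 'M[C]_(q, r)) : mxint f -> mxL2 T (vop k f).
Proof.
move=> fi; rewrite (_ : vop k f = cutm T (vop k f)); last first.
  by apply/funext => x; rewrite /cutm; case: ifPn => // /vop_supp ->.
apply: (mxL2_bounded (c := c * \int[mu]_t nrm (f t))); first exact: vop_meas (mxint_meas fi).
by move=> t _; exact: vop_bound.
Qed.

Lemma vopD r (f g : R -> 'M[C]_(q, r)) x : mxint f -> mxint g ->
  vop k (fun t => f t + g t) x = vop k f x + vop k g x.
Proof.
move=> fi gi; rewrite /vop -mx_integralD; [|exact: vop_mxint..].
by apply: eq_mx_integral => t; rewrite mulmxDr.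
Qed.

Lemma vopZ r a (f : R -> 'M[C]_(q, r)) x : mxint f ->
  vop k (fun t => a *: f t) x = a *: vop k f x.
Proof.
move=> fi; rewrite /vop -mx_integralZ; last exact: vop_mxint.
by apply: eq_mx_integral => t; rewrite scalemxAr.
Qed.

Lemma vopN r (f : R -> 'M[C]_(q, r)) x : mxint f ->
  vop k (fun t => - f t) x = - vop k f x.
Proof.
move=> fi; rewrite /vop -mx_integralN; last exact: vop_mxint.
by apply: eq_mx_integral => t; rewrite mulmxN.
Qed.

Lemma vop_ae r (f g : R -> 'M[C]_(q, r)) x : mmeas f -> mmeas g ->
  {ae mu, forall t, f t = g t} -> vop k f x = vop k g x.
Proof.
case: hk => mk _ _ mf mg fg; apply: ae_mx_integral.
- by apply: mxmeasM => //; exact: mxmeas_slice.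
- by apply: mxmeasM => //; exact: mxmeas_slice.
- by refine (aeS fg _) => t ->.
Qed.

Lemma vop_cutm r (f : R -> 'M[C]_(q, r)) x : vop k (cutm T f) x = vop k f x.
Proof.
case: hk => _ _ k0; apply: eq_mx_integral => t; rewrite /cutm.
case: ifPn => // tT; rewrite k0 ?mul0mx//.
by apply: contra tT => /andP[/andP[-> tx] xT]; exact: lt_trans tx xT.
Qed.

Lemma vopE r (f : R -> 'M[C]_(q, r)) x : 0 < x < T ->
  vop k (cutm T f) x = mx_integral `]0, x[ (fun t => k x t *m f t).
Proof.
move=> /andP[x0 xT]; rewrite vop_cutm mx_integral_cutm; case: hk => _ _ k0.
apply: eq_mx_integral => t; rewrite /cutm; case: ifPn => // tx.
by rewrite k0 ?mul0mx// xT andbT.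
Qed.

End FixedKernel.

Lemma vop_exp_weight p q c (k : R -> R -> 'M[C]_(p, q)) : vkernel c k ->
  exists2 l : R, 0 < l & forall r (g h : R -> 'M[C]_(q, r)) (b : R), mmeas g -> mmeas h ->
    (exists b : R, forall x, nrm (g x) <= b * expR (l * x)) ->
    (exists b : R, forall x, nrm (h x) <= b * expR (l * x)) ->
    (forall x, nrm (g x - h x) <= b * expR (l * x)) ->
    forall x, nrm (vop k g x - vop k h x) <= b * 2^-1 * expR (l * x).
Proof.
move=> hk; have c0 := vkernel_ge0 hk.
(* The bound on the kernel plays the role of the potential in [exp_weight]; it is cut off at [T] to
   have an integrable square. *)
pose a := cutr T (fun=> c).
have ai : intg (fun t => a t ^+ 2).
  rewrite (_ : (fun _ => _) = fun t => c ^+ 2 * cutr T (fun=> 1) t).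
    by apply: integrableZr'; exact: intg_cutr1.
  by apply/funext => t; rewrite /a /cutr; case: ifP; rewrite ?mulr1 ?mulr0 ?expr0n.
have ma : measurable_fun [set: RR] a by apply: measurable_cutr; exact: measurable_cst.
have a0 t : 0 <= a t by rewrite /a /cutr; case: ifP.
have [|l l0 hl] := exp_weight ma ai a0 (e := 2^-1); first by rewrite invr_gt0.
exists l => // r g h b mg mh gb hb ghb x.
have [wi wl] := hl x.
have gint f : mmeas f -> (exists b : R, forall x, nrm (f x) <= b * expR (l * x)) ->
    mxint (fun t => k x t *m f t).
  move=> mf [d fd]; case: hk => mk kc k0.
  apply: (mxint_dom (b := fun t => d * cutr x (fun t => a t * expR (l * t)) t)).
  - by apply: mxmeasM => //; exact: mxmeas_slice.
  - exact: integrableZr'.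
  - move=> t; rewrite /cutr; case: ifPn => tx; last by rewrite k0 ?mul0mx ?nrm0 ?mulr0// negb_and tx.
    have [xT|xT] := ltP x T; last first.
      rewrite k0 ?mul0mx ?nrm0; last by rewrite (ltNge x) xT andbF.
      rewrite !mulr_ge0 ?expR_ge0//.
      by have := le_trans (nrm_ge0 _) (fd x); rewrite pmulr_lge0 ?expR_gt0.
    rewrite /a /cutr; have -> : 0 < t < T.
      by case/andP: tx => -> tx; exact: lt_trans tx xT.
    by apply: le_trans (nrmM _ _) _; rewrite mulrCA; apply: ler_pM; rewrite ?nrm_ge0.
have b0 : 0 <= b.
  by have := le_trans (nrm_ge0 _) (ghb x); rewrite pmulr_lge0 ?expR_gt0.
rewrite /vop -mx_integralB; [|exact: gint..].
apply: le_trans (_ : \int[mu]_t (b * cutr x (fun t => a t * expR (l * t)) t) <= _).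
  apply: nrm_mx_integral.
  - by apply: mxmeasB; apply: mxmeasM => //; case: hk => mk _ _; exact: mxmeas_slice.
  - exact: integrableZr'.
  - move=> t; rewrite -mulmxBr; case: hk => mk kc k0.
    rewrite /cutr; case: ifPn => tx; last by rewrite k0 ?mul0mx ?nrm0 ?mulr0// negb_and tx.
    have [xT|xT] := ltP x T; last first.
      rewrite k0 ?mul0mx ?nrm0; last by rewrite (ltNge x) xT andbF.
      by rewrite !mulr_ge0 ?expR_ge0.
    rewrite /a /cutr; have -> : 0 < t < T.
      by case/andP: tx => -> tx; exact: lt_trans tx xT.
    by apply: le_trans (nrmM _ _) _; rewrite mulrCA; apply: ler_pM; rewrite ?nrm_ge0.
by rewrite RintegralZl// -mulrA ler_wpM2l.
Qed.

(** The solution of [(1 + k) y = f] is sought as [y = f + h]. The equation for [h] has the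
    right-hand side [- k f], bounded even though [f] is only integrable, so the sup norm contraction
    applies. That [D] is independent of [f] later gives the boundedness of the inverse. *)
Lemma vop_fixpoint p c (k : R -> R -> 'M[C]_p) : vkernel c k ->
  exists D : R, 0 <= D /\ forall r (f : R -> 'M[C]_(p, r)), mxint f ->
    exists h, [/\ mxL2 T h, forall x, nrm (h x) <= r%:R * D * \int[mu]_t nrm (f t) &
      forall x, h x = - vop k f x - vop k h x].
Proof.
move=> hk; have c0 := vkernel_ge0 hk; have [l l0 hl] := vop_exp_weight hk.
(* [4 p] (times the number [r] of columns) comes from the fixed point theorem, [c] from [vop_bound],
   and the exponential is the largest value of the weight on []0, T[]. *)
exists (4 * p%:R * c * expR (l * T)); split.
  by rewrite !mulr_ge0 ?expR_ge0.
move=> r f fi; set M := \int[mu]_t nrm (f t).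
have M0 : 0 <= M by apply: Rintegral_ge0 => t _; exact: nrm_ge0.
pose w := fun x : RR => expR (l * x).
pose Phi (g : RR -> 'M[C]_(p, r)) (x : RR) := - vop k f x - vop k g x.
have [||x|h [mh hb hE]] := @wcontraction_fixpoint R _ RR w _ _ Phi (c * M).
- move=> g h b [mg gb] [mh hb] ghb x.
  rewrite /Phi subrBB nrmN; exact: hl.
- move=> g [mg _]; apply: mxmeasB; last exact: (vop_meas hk).
  apply: mxmeasN; exact: (vop_meas hk (mxint_meas fi)).
- rewrite /Phi; have -> : vop k (fun=> (0 : 'M[C]_(p, r))) x = 0.
    by rewrite /vop -[RHS](mx_integral0 _ _); apply: eq_mx_integral => t; rewrite mulmx0.
  rewrite subr0 nrmN; have [/andP[x0 _]|xT] := boolP (0 < x < T).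
    apply: le_trans (vop_bound hk _ fi) _; rewrite ler_peMr ?mulr_ge0//.
    by rewrite /w -expR0 ler_expR mulr_ge0// ltW.
  by rewrite (vop_supp hk)// nrm0 !mulr_ge0 ?expR_ge0.
have hsupp x : ~~ (0 < x < T) -> h x = 0.
  by move=> xT; rewrite -hE /Phi !(vop_supp hk)// !oppr0 addr0.
have hbound x : 0 < x < T -> nrm (h x) <= r%:R * (4 * p%:R * c * expR (l * T)) * M.
  move=> /andP[_ xT]; apply: le_trans (hb x) _.
  have -> : r%:R * (4 * p%:R * c * expR (l * T)) * M =
    4 * (p * r)%:R * (c * M) * expR (l * T) by rewrite natrM; ring.
  by rewrite ler_wpM2l ?mulr_ge0// ler_expR ler_pM2l// ltW.
exists h; split.
- rewrite (_ : h = cutm T h); first by apply: mxL2_bounded hbound.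
  by apply/funext => x; rewrite /cutm; case: ifPn => // /hsupp.
- move=> x; have [xT|xT] := boolP (0 < x < T); first exact: hbound.
  by rewrite hsupp// nrm0 !mulr_ge0 ?expR_ge0.
- by move=> x; rewrite -[LHS]hE.
Qed.

(** On []0, T[] the weight is at least 1, so a bounded function supported there obeys the weighted
    bound with the same constant. *)
Lemma vop_uniq p c (k : R -> R -> 'M[C]_p) r (f g h : R -> 'M[C]_(p, r)) b : vkernel c k ->
  mxL2 T g -> mxL2 T h -> (forall x, nrm (g x) <= b) -> (forall x, nrm (h x) <= b) ->
  (forall x, g x = f x - vop k g x) -> (forall x, h x = f x - vop k h x) -> g =1 h.
Proof.
move=> hk [mg _ g0] [mh _ h0] gb hb gE hE.
have [l l0 hl] := vop_exp_weight hk.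
have b0 : 0 <= b by exact: le_trans (nrm_ge0 _) (gb 0).
have wb (u : R -> 'M[C]_(p, r)) : (forall t, ~~ (0 < t < T) -> u t = 0) ->
    (forall x, nrm (u x) <= b) -> forall x, nrm (u x) <= b * expR (l * x).
  move=> u0 ub x; have [/andP[x0 _]|xT] := boolP (0 < x < T).
    apply: le_trans (ub x) _; rewrite ler_peMr// -expR0 ler_expR mulr_ge0// ltW//.
  by rewrite u0// nrm0 mulr_ge0 ?expR_ge0.
pose Phi (u : RR -> 'M[C]_(p, r)) (x : RR) := f x - vop k u x.
apply: (@wcontraction_uniq R _ RR (fun x => expR (l * x)) _ _ Phi).
- move=> u1 u2 d [mu1 u1b] [mu2 u2b] ud x.
  rewrite /Phi subrBB nrmN; exact: hl.
- by split => //; exists b; exact: wb.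
- by split => //; exists b; exact: wb.
- by move=> x; rewrite /Phi -gE.
- by move=> x; rewrite /Phi -hE.
Qed.

End VolterraKernel.

(** * Bounded operators on L^2 and inverses of Volterra perturbations of the identity *)

Section BoundedOperators.
Context {R : realType}.
Local Notation C := R[i].
Local Notation mu := (@lebesgue_measure R).
Local Notation RR := (measurableTypeR R).
Local Notation mmeas F := (@mxmeas R _ RR _ _ F).
Local Notation intg b := (mu.-integrable setT (EFin \o b)).
Local Notation mxint := (mx_integrable setT).
Local Notation I := (mx_integral setT).
Context (T : R) (T0 : 0 < T).

Lemma L2eqP p q (F G : R -> 'M[C]_(p, q)) :
  L2eq T F G <-> {ae mu, forall t, cutm T F t = cutm T G t}.
Proof.
split=> FG.
  refine (aeS FG _) => t /= h; rewrite /cutm; case: ifP => // tT; apply: h.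
refine (aeS FG _) => t; rewrite /cutm => + tT.
by have := mem_set tT; rewrite mem_itvoo => ->.
Qed.

Lemma L2eq_on p q (F G : R -> 'M[C]_(p, q)) :
  (forall t, 0 < t < T -> F t = G t) -> L2eq T F G.
Proof.
move=> FG; apply/L2eqP; apply: aeW => t; rewrite /cutm.
by case: ifP => // /FG.
Qed.

Lemma L2eq_sym p q (F G : R -> 'M[C]_(p, q)) : L2eq T F G -> L2eq T G F.
Proof. by move=> /L2eqP h; apply/L2eqP; refine (aeS h _) => t ->. Qed.

Lemma L2eq_trans p q (F G H : R -> 'M[C]_(p, q)) :
  L2eq T F G -> L2eq T G H -> L2eq T F H.
Proof.
move=> /L2eqP h1 /L2eqP h2; apply/L2eqP.
by refine (aeS (aeI h1 h2) _) => t [-> ->].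
Qed.

Lemma L2_cutm r (f : R -> 'cV[C]_r) : L2 T f -> mxL2 T (cutm T f).
Proof. exact: sq_summable_mxL2. Qed.

Lemma measurable_normsq p q (F : R -> 'M[C]_(p, q)) : mmeas F ->
  measurable_fun [set: RR] (fun t => mx_normsq (F t)).
Proof.
move=> mF; apply: measurable_sum => i; apply: measurable_sum => k.
have [m1 m2] := mF i k.
rewrite (_ : (fun _ => _) = (fun t => complex.Re (F t i k) ^+ 2 + complex.Im (F t i k) ^+ 2)).
  by apply: measurable_funD; exact: measurable_funX.
by apply/funext => t; exact: normc_sq.
Qed.

Lemma L2norm_cutm r (f : R -> 'cV[C]_r) :
  L2norm T f = Num.sqrt (\int[mu]_t mx_normsq (cutm T f t)).
Proof.
congr Num.sqrt; rewrite Rintegral_mkcond; apply: eq_Rintegral => t _.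
rewrite patchE mem_itvoo /cutm; case: ifP => // _.
rewrite /mx_normsq big1// => i _; rewrite big1// => k _.
by rewrite mxE Normc.normc0 expr0n.
Qed.

Lemma intg_normsq p q (F : R -> 'M[C]_(p, q)) : mxL2 T F ->
  intg (fun t => mx_normsq (F t)).
Proof.
case=> mF Fi _; apply: intg_dom Fi _ => [|t]; first exact: measurable_normsq.
by rewrite ger0_norm ?mx_normsq_ge0// mx_normsq_le_nrm.
Qed.

(* All operators at hand are dominated by f |-> |f(x)| + |f|_{L^1}. *)
Lemma bounded_op_of_bound r (F : (R -> 'cV[C]_r) -> R -> 'cV[C]_r) (D : R) :
  0 <= D ->
  (forall f, L2 T f -> mmeas (cutm T (F f))) ->
  (forall f, L2 T f -> forall x, 0 < x < T ->
    nrm (F f x) <= D * (nrm (f x) + \int[mu]_t nrm (cutm T f t))) ->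
  (forall f g, L2 T f -> L2 T g -> L2eq T f g -> L2eq T (F f) (F g)) ->
  (forall (a : C) f g, L2 T f -> L2 T g ->
    L2eq T (F (fun x => a *: f x + g x)) (fun x => a *: F f x + F g x)) ->
  bounded_op T F.
Proof.
move=> D0 mF Fb Fae Flin.
pose S (f : R -> 'cV[C]_r) := \int[mu]_t nrm (cutm T f t) ^+ 2.
pose M (f : R -> 'cV[C]_r) := \int[mu]_t nrm (cutm T f t).
have M0 f : 0 <= M f by apply: Rintegral_ge0 => t _; exact: nrm_ge0.
pose b f t := 2 * D ^+ 2 * nrm (cutm T f t) ^+ 2 + 2 * D ^+ 2 * M f ^+ 2 * cutr T (fun=> 1) t.
have bi f : L2 T f -> intg (b f).
  move=> /L2_cutm[_ fi _]; apply: integrableDr; apply: integrableZr' => //.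
  exact: intg_cutr1.
have le_b f : L2 T f -> forall t, nrm (cutm T (F f) t) ^+ 2 <= b f t.
  move=> fL t; rewrite /b {1}/cutm /cutr; case: ifPn => tT; last first.
    by rewrite nrm0 expr0n/= mulr0 addr0 !mulr_ge0 ?sqr_ge0 ?nrm_ge0.
  rewrite {1}/cutm tT mulr1.
  have h : nrm (F f t) ^+ 2 <= (D * (nrm (f t) + M f)) ^+ 2.
    rewrite lerXn2r ?nnegrE ?nrm_ge0 ?mulr_ge0 ?addr_ge0 ?nrm_ge0//.
    exact: Fb.
  apply: le_trans h _; rewrite [leRHS](_ : _ =
    D ^+ 2 * (2 * nrm (f t) ^+ 2 + 2 * M f ^+ 2)); last by ring.
  rewrite exprMn ler_wpM2l ?sqr_ge0//; have := sqr_ge0 (nrm (f t) - M f); nra.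
have FL f : L2 T f -> mxL2 T (cutm T (F f)).
  move=> fL; split; first exact: mF.
    apply: intg_dom (bi _ fL) _ => [|t].
      by apply: measurable_funX; apply: measurable_nrm; exact: mF.
    by rewrite ger0_norm ?sqr_ge0// le_b.
  by move=> t; rewrite /cutm => /negbTE ->.
split => //; first by move=> f fL; apply: sq_summable_of_cutm; exact: FL.
(* [M f ^+ 2 <= T * S f], integrated over an interval of length [T], produces [T ^+ 2]; the last
   factor returns from [nrm] to [mx_normsq]. *)
exists (Num.sqrt (2 * D ^+ 2 * (1 + T ^+ 2) * (2 * (r * 1)%:R) ^+ 2)) => f fL.
have fcL := L2_cutm fL.
rewrite !L2norm_cutm -sqrtrM; last first.
  by rewrite !mulr_ge0 ?sqr_ge0 ?nrm_ge0// addr_ge0 ?sqr_ge0.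
apply: ler_wsqrtr; apply: (@le_trans _ _ (\int[mu]_t b f t)).
  apply: le_Rintegralr (intg_normsq (FL _ fL)) (bi _ fL) _ => t.
  exact: le_trans (mx_normsq_le_nrm _) (le_b _ fL t).
have [mf fi f0] := fcL.
rewrite /b RintegralD//; last 2 first.
- exact: integrableZr'.
- by apply: integrableZr'; exact: intg_cutr1.
rewrite !RintegralZl//; last exact: intg_cutr1.
rewrite Rintegral_cutr1//.
have Mle : M f ^+ 2 <= T * S f.
  have := sqr_Rintegral_le T0 (measurable_nrm mf) fi (fun t => nrm_ge0 _).
  rewrite -(mxL2_cutr fcL) (_ : cutr T (fun t => nrm (cutm T f t) ^+ 2) =
    (fun t => nrm (cutm T f t) ^+ 2))//.
  apply/funext => t; rewrite /cutr; case: ifPn => // tT.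
  by rewrite f0// nrm0 expr0n.
have Sle : S f <= (2 * (r * 1)%:R) ^+ 2 * \int[mu]_t mx_normsq (cutm T f t).
  rewrite -RintegralZl//; last exact: intg_normsq.
  apply: le_Rintegralr => //; first by apply: integrableZr'; exact: intg_normsq.
  by move=> t; exact: nrm_sq_le_normsq.
apply: (@le_trans _ _ (2 * D ^+ 2 * (1 + T ^+ 2) * S f)); last first.
  rewrite -[leRHS]mulrA; apply: ler_wpM2l => //.
  by apply: mulr_ge0; [rewrite mulr_ge0 ?sqr_ge0|rewrite addr_ge0 ?sqr_ge0].
rewrite -/(S f) [X in _ <= X](_ : _ = 2 * D ^+ 2 * S f + 2 * D ^+ 2 * (T * S f) * T); last by ring.
rewrite lerD2l; apply: ler_wpM2r; first exact: ltW.
by apply: ler_wpM2l => //; rewrite mulr_ge0 ?sqr_ge0.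
Qed.

Lemma bounded_op_ext r (F G : (R -> 'cV[C]_r) -> R -> 'cV[C]_r) :
  (forall f, L2 T f -> forall x, 0 < x < T -> F f x = G f x) ->
  bounded_op T G -> bounded_op T F.
Proof.
move=> FG [G1 G2 G3 [c G4]].
have E f : L2 T f -> L2eq T (F f) (G f) by move=> fL; apply: L2eq_on; exact: FG.
have L2lin (a : C) (f g : R -> 'cV[C]_r) : L2 T f -> L2 T g -> L2 T (fun x => a *: f x + g x).
  move=> /L2_cutm fL /L2_cutm gL; apply: sq_summable_of_cutm.
  rewrite (_ : cutm T _ = (fun x => a *: cutm T f x + cutm T g x)).
    by apply: mxL2D => //; exact: mxL2Z.
  by apply/funext => x; rewrite /cutm; case: ifP => //; rewrite scaler0 addr0.
split.
- move=> f fL; apply: sq_summable_ext (G1 _ fL) => t tT; by rewrite FG.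
- move=> f g fL gL fg; apply: L2eq_trans (E _ fL) _.
  exact: L2eq_trans (G2 _ _ fL gL fg) (L2eq_sym (E _ gL)).
- move=> a f g fL gL; apply: L2eq_trans (E _ (L2lin a f g fL gL)) _.
  apply: L2eq_trans (G3 a _ _ fL gL) _; apply: L2eq_on => t tT.
  by rewrite !FG.
- exists c => f fL; rewrite (_ : L2norm T (F f) = L2norm T (G f)); first exact: G4.
  rewrite !L2norm_cutm; congr Num.sqrt; apply: eq_Rintegral => t _.
  by rewrite /cutm; case: ifP => // tT; rewrite FG.
Qed.

Section Kernel.
Context r (c : R) (k : R -> R -> 'M[C]_r) (hk : vkernel T c k).

(** The scalar [e] is 0 for the Volterra operators [K] and [A], and 1 for [E]. *)
Lemma bounded_op_vop (e : C) :
  bounded_op T (fun (f : R -> 'cV[C]_r) x => e *: f x + vop k (cutm T f) x).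
Proof.
have fi (f : R -> 'cV[C]_r) : L2 T f -> mxint (cutm T f).
  by move=> fL; apply: (@mxL2_mxint _ _ _ T); exact: L2_cutm.
have c0 := vkernel_ge0 hk.
apply: (bounded_op_of_bound (D := absC e + c)).
- by rewrite addr_ge0 ?absC_ge0.
- move=> f fL; rewrite (_ : cutm T _ = (fun x => e *: cutm T f x + vop k (cutm T f) x)).
    apply: mxmeasD; last exact: (vop_meas hk (mxint_meas (fi _ fL))).
    exact: (mxmeasZ _ (mxint_meas (fi _ fL))).
  apply/funext => x; have [xT|xT] := boolP (0 < x < T); first by rewrite !cutm_in.
  by rewrite !cutm_out// (vop_supp hk)// scaler0 addr0.
- move=> f fL x xT; apply: le_trans (nrmD _ _) _.
  have h1 := nrmZ e (f x); have h2 := vop_bound hk x (fi _ fL).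
  apply: le_trans (lerD h1 h2) _.
  set M := Rintegral _ _ _.
  have M0 : 0 <= M by apply: Rintegral_ge0 => t _; exact: nrm_ge0.
  have : 0 <= absC e * M by rewrite mulr_ge0 ?absC_ge0.
  have : 0 <= c * nrm (f x) by rewrite mulr_ge0 ?nrm_ge0.
  lra.
- move=> f g fL gL /L2eqP fg; apply/L2eqP; refine (aeS fg _) => t; apply: (@eq_cutm _ _ _ _ _ T f g) => /= ->.
  by rewrite (vop_ae hk t (mxint_meas (fi _ fL)) (mxint_meas (fi _ gL)) fg).
- move=> a f g fL gL; apply: L2eq_on => t tT.
  have -> : cutm T (fun x => a *: f x + g x) = (fun x => a *: cutm T f x + cutm T g x).
    by apply/funext => x; rewrite /cutm; case: ifP => //; rewrite scaler0 addr0.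
  rewrite (vopD hk) ?(vopZ hk); [|exact: fi|exact: mxintZ (fi _ _)|exact: fi].
  by rewrite !scalerDr addrACA !scalerA mulrC.
Qed.

(** The inverse is [f + h] with [h] taken from [vop_fixpoint] by choice. Uniqueness of bounded
    solutions repairs the arbitrariness: it makes [h] linear in [f] and dependent only on the a.e.
    class of [f]. *)
Lemma volterra_inverse :
  exists2 Einv, bounded_op T Einv &
    @L2inverse _ r T (fun f x => f x + vop k (cutm T f) x) Einv.
Proof.
have [D [D0 hD]] := vop_fixpoint hk.
(* Choice ranges over all functions; where [f] is not integrable the value is a dummy. *)
have /choice [hs hsP] : forall f : R -> 'cV[C]_r, exists h, mxint f ->
    [/\ mxL2 T h, forall x, nrm (h x) <= 1%:R * D * \int[mu]_t nrm (f t) &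
      forall x, h x = - vop k f x - vop k h x].
  move=> f; have [fi|nfi] := pselect (mxint f); last by exists f.
  by have [h hP] := hD 1%N f fi; exists h.
have fi (f : R -> 'cV[C]_r) : L2 T f -> mxint (cutm T f).
  by move=> fL; apply: (@mxL2_mxint _ _ _ T); exact: L2_cutm.
have uniq f h : mxint f -> mxL2 T h -> (exists b : R, forall x, nrm (h x) <= b) ->
    (forall x, h x = - vop k f x - vop k h x) -> hs f = h.
  move=> fint hL [b hb] hE; have [sL sb sE] := hsP f fint; apply/funext.
  set B : R := _ * \int[mu]_t nrm (f t) in sb.
  apply: (vop_uniq (f := fun x => - vop k f x) (b := `|b| + `|B|) hk sL hL).
  - move=> x; apply: le_trans (sb x) _; apply: le_trans (ler_norm _) _.
    by rewrite lerDr.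
  - move=> x; apply: le_trans (hb x) _; apply: le_trans (ler_norm _) _.
    by rewrite lerDl.
  - exact: sE.
  - exact: hE.
have hs_bnd f : mxint f -> exists b : R, forall x, nrm (hs f x) <= b.
  by move=> /hsP[_ sb _]; eexists; exact: sb.
have hs_ae f g : mxint f -> mxint g -> {ae mu, forall t, f t = g t} -> hs f = hs g.
  move=> fint gint fg; have [sL sb sE] := hsP g gint.
  apply: (uniq f (hs g) fint sL (hs_bnd _ gint)) => x.
  rewrite (vop_ae hk x (mxint_meas fint) (mxint_meas gint) fg).
  exact: sE.
exists (fun f x => f x + hs (cutm T f) x).
  apply: (bounded_op_of_bound (D := 1 + D)).
  - by rewrite addr_ge0.
  - move=> f fL; have [[sm _ s0] _ _] := hsP _ (fi _ fL).
    rewrite (_ : cutm T _ = (fun x => cutm T f x + hs (cutm T f) x)).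
      by apply: mxmeasD => //; apply: mxint_meas; exact: fi.
    apply/funext => x; have [xT|xT] := boolP (0 < x < T); first by rewrite !cutm_in.
    by rewrite !cutm_out// s0// addr0.
  - move=> f fL x xT; have [_ sb _] := hsP _ (fi _ fL).
    apply: le_trans (nrmD _ _) _.
    apply: le_trans (lerD (lexx _) (sb x)) _; rewrite mul1r.
    set M := Rintegral _ _ _.
    have M0 : 0 <= M by apply: Rintegral_ge0 => t _; exact: nrm_ge0.
    have : 0 <= D * nrm (f x) by rewrite mulr_ge0 ?nrm_ge0.
    lra.
  - move=> f g fL gL /L2eqP fg; apply/L2eqP.
    have E := hs_ae _ _ (fi _ fL) (fi _ gL) fg.
    by refine (aeS fg _) => t; apply: (@eq_cutm _ _ _ _ _ T f g) => ->; rewrite E.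
  - move=> a f g fL gL; apply: L2eq_on => t tT.
    have -> : cutm T (fun x => a *: f x + g x) = (fun x => a *: cutm T f x + cutm T g x).
      by apply/funext => x; rewrite /cutm; case: ifP => //; rewrite scaler0 addr0.
    have [fs fb fE] := hsP _ (fi _ fL); have [gs gb gE] := hsP _ (fi _ gL).
    have afi := mxintZ a (fi _ fL).
    have hfi := mxL2_mxint fs; have hgi := mxL2_mxint gs.
    rewrite (uniq _ (fun x => a *: hs (cutm T f) x + hs (cutm T g) x)).
    + by rewrite scalerDr addrACA.
    + by apply: mxintD => //; exact: fi.
    + by apply: mxL2D => //; exact: mxL2Z.
    + eexists => x; apply: le_trans (nrmD _ _) _; apply: lerD; last exact: gb.
      apply: le_trans (nrmZ _ _) _; apply: ler_wpM2l; first exact: absC_ge0.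
      exact: fb.
    + move=> x; rewrite (vopD hk) ?(vopZ hk)//; [|exact: fi|exact: fi].
      rewrite (vopD hk _ (mxintZ a hfi) hgi) (vopZ hk _ _ hfi) {1}fE {1}gE.
      by rewrite scalerBr scalerN !opprD addrACA.
move=> f fL; have cfi := fi _ fL; have [sL sb sE] := hsP _ cfi.
have hi := mxL2_mxint sL.
split; apply: L2eq_on => x xT.
  rewrite (_ : cutm T (fun x => f x + hs (cutm T f) x) =
      (fun x => cutm T f x + hs (cutm T f) x)); last first.
    apply/funext => t; have [tT|tT] := boolP (0 < t < T); first by rewrite !cutm_in.
    by case: sL => _ _ s0; rewrite !cutm_out// s0// addr0.
  by rewrite (vopD hk)// {1}sE -addrA -opprD addNr addr0.
have kL := vop_mxL2 hk cfi.
have ki := mxL2_mxint kL.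
rewrite (_ : cutm T (fun x => f x + vop k (cutm T f) x) =
    (fun x => cutm T f x + vop k (cutm T f) x)); last first.
  apply/funext => t; have [tT|tT] := boolP (0 < t < T); first by rewrite !cutm_in.
  by rewrite !cutm_out// (vop_supp hk)// addr0.
(* For the data [f + k f] the solution is [h = - k f], because
   [- k (f + k f) - k (- k f) = - k f]. *)
rewrite (uniq _ (fun x => - vop k (cutm T f) x)).
- by rewrite addrK.
- exact: mxintD.
- exact: mxL2N.
- by eexists => y; rewrite nrmN; exact: (vop_bound hk y cfi).
- by move=> y; rewrite (vopD hk)// (vopN hk)// opprK opprD addrNK.
Qed.

End Kernel.

End BoundedOperators.

(** * The transmutation kernel *)

Section TransmutationKernel.
Context {R : realType}.
Local Notation C := R[i].
Local Notation mu := (@lebesgue_measure R).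
Local Notation RR := (measurableTypeR R).
Local Notation mmeas F := (@mxmeas R _ RR _ _ F).
Local Notation intg b := (mu.-integrable setT (EFin \o b)).
Local Notation mxint := (mx_integrable setT).
Local Notation I := (mx_integral setT).

Lemma intg_shift (f : R -> R) (s : R) : intg f -> (forall t, 0 <= f t) ->
  intg (fun t => f (t + s)).
Proof.
move=> fi f0; have mf := intg_meas fi.
have mfs : measurable_fun [set: RR] (fun t : RR => f (t + s)).
  by apply: (measurableT_comp mf); exact: measurable_funD.
apply/integrableP; split; first exact/measurable_EFinP.
under eq_integral do rewrite /= ger0_norm//.
rewrite (@ge0_integral_shift _ s (EFin \o f)).
- exact: (integrable_lty measurableT fi).
- exact/measurable_EFinP.
- by move=> t; rewrite lee_fin.
Qed.

(** A sum of squares in place of the Cauchy-Schwarz bound: what counts is a bound that stays the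
    same when one factor is translated. *)
Lemma Rintegral_mul_le (f g : R -> R) : measurable_fun [set: RR] f ->
  measurable_fun [set: RR] g ->
  intg (fun t => f t ^+ 2) -> intg (fun t => g t ^+ 2) ->
  intg (fun t => f t * g t) /\
  \int[mu]_t (f t * g t) <= \int[mu]_t f t ^+ 2 + \int[mu]_t g t ^+ 2.
Proof.
move=> mf mg fi gi.
have le t : `|f t * g t| <= f t ^+ 2 + g t ^+ 2.
  rewrite ler_norml; have := sqr_ge0 (f t - g t); have := sqr_ge0 (f t + g t).
  have := sqr_ge0 (f t); have := sqr_ge0 (g t).
  by move=> *; apply/andP; split; nra.
have fgi : intg (fun t => f t * g t).
  by apply: intg_dom le; [exact: measurable_funM|exact: integrableDr].
split => //; rewrite -RintegralD//; apply: le_Rintegralr => //.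
  exact: integrableDr.
by move=> t; exact: le_trans (ler_norm _) (le t).
Qed.

Context (T : R) m1 m2 (v : R -> 'M[C]_(m1, m2)) (hv : mxL2 T v).
Local Notation w := (fun t => (v t)^t*).
Local Notation av := (fun t => nrm (v t)).

Let mv : mmeas v. Proof. by case: hv. Qed.
Let mw : mmeas w. Proof. exact: mxmeas_adj. Qed.
Let mav : measurable_fun [set: RR] av. Proof. exact: measurable_nrm. Qed.
Let av0 t : 0 <= av t. Proof. exact: nrm_ge0. Qed.
Let avsq : intg (fun t => av t ^+ 2). Proof. by case: hv. Qed.

(* With [f(t) = exp (-izt)], the solution of the Dirac system is
   [exp (iz x/2)] times the pair [(i int_0^x L(x,t) f(t) dt,
   f(x) + int_0^x N(x,t) f(t) dt)], and the Dirac system becomes the pair of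
   integral equations [L = trL N], [N = trN L] along characteristics. *)
Definition trL (N : R * R -> 'M[C]_m2) (z : R * R) : 'M[C]_(m1, m2) :=
  if (0 < z.2 < z.1) && (z.1 < T) then
    v z.2 + I (cutm z.1 (fun y => v y *m N (y, z.2)))
  else 0.

(** For [L] vanishing off the triangle the integrand is zero unless [y - x + t > 0], so the
    effective range of integration is []x - t, x[]. *)
Definition trN (L : R * R -> 'M[C]_(m1, m2)) (z : R * R) : 'M[C]_m2 :=
  if (0 < z.2 < z.1) && (z.1 < T) then
    I (cutm z.1 (fun y => (v y)^t* *m L (y, y - z.1 + z.2)))
  else 0.

Lemma measurable_triangle (d : measure_display) (X : measurableType d) (a b : X -> R) :
  measurable_fun setT a -> measurable_fun setT b ->
  measurable_fun setT (fun x => (0 < b x < a x) && (a x < T)).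
Proof.
move=> ma mb; apply: measurable_and; last first.
  by apply: measurable_fun_ltr => //; exact: measurable_cst.
by apply: measurable_and; apply: measurable_fun_ltr => //; exact: measurable_cst.
Qed.

Lemma measurable_segment (d : measure_display) (X : measurableType d) (a b : X -> R) :
  measurable_fun setT a -> measurable_fun setT b ->
  measurable_fun setT (fun x => 0 < b x < a x).
Proof.
by move=> ma mb; apply: measurable_and; apply: measurable_fun_ltr => //;
  exact: measurable_cst.
Qed.

Let meas_fst_fst : measurable_fun setT (fun x : (RR * RR) * RR => (x.1.1 : R)).
Proof. exact: (measurableT_comp measurable_fst measurable_fst). Qed.
Let meas_snd_fst : measurable_fun setT (fun x : (RR * RR) * RR => (x.1.2 : R)).
Proof. exact: (measurableT_comp measurable_snd measurable_fst). Qed.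
Let meas_trd : measurable_fun setT (fun x : (RR * RR) * RR => (x.2 : R)).
Proof. exact: measurable_snd. Qed.

Lemma trL_meas N : @mxmeas R _ (RR * RR)%type _ _ N -> @mxmeas R _ (RR * RR)%type _ _ (trL N).
Proof.
move=> mN; apply: mxmeas_if; last exact: mxmeas_cst.
  by apply: measurable_triangle; [exact: measurable_fst|exact: measurable_snd].
apply: mxmeasD; first exact: mxmeas_comp mv measurable_snd.
apply: (@mxmeas_integral _ _ (RR * RR)%type _ _
  (fun x : (RR * RR) * RR => if 0 < (x.2 : R) < x.1.1 then v x.2 *m N (x.2, x.1.2) else 0)).
apply: mxmeas_if; last exact: mxmeas_cst.
  exact: measurable_segment meas_fst_fst meas_trd.
apply: mxmeasM; first exact: mxmeas_comp mv measurable_snd.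
apply: (@mxmeas_comp _ _ _ _ _ _ _ N (fun x : (RR * RR) * RR => (x.2, x.1.2))) => //.
exact: measurable_fun_pair.
Qed.

Lemma trN_meas L : @mxmeas R _ (RR * RR)%type _ _ L -> @mxmeas R _ (RR * RR)%type _ _ (trN L).
Proof.
move=> mL; apply: mxmeas_if; last exact: mxmeas_cst.
  by apply: measurable_triangle; [exact: measurable_fst|exact: measurable_snd].
apply: (@mxmeas_integral _ _ (RR * RR)%type _ _
  (fun x : (RR * RR) * RR => if 0 < (x.2 : R) < x.1.1 then
    (v x.2)^t* *m L (x.2, (x.2 : R) - x.1.1 + x.1.2) else 0)).
apply: mxmeas_if; last exact: mxmeas_cst.
  exact: measurable_segment meas_fst_fst meas_trd.
apply: mxmeasM; first exact: mxmeas_comp mw measurable_snd.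
apply: (@mxmeas_comp _ _ _ _ _ _ _ L
  (fun x : (RR * RR) * RR => (x.2, ((x.2 : R) - x.1.1 + x.1.2) : RR))) => //.
apply: measurable_fun_pair => //.
by apply: measurable_funD => //; exact: measurable_funB.
Qed.

Section Weight.
Context (l : R) (l0 : 0 < l).
Context (hl : forall x,
  intg (cutr x (fun t => av t * expR (l * t))) /\
  \int[mu]_t cutr x (fun t => av t * expR (l * t)) t <= 2^-1 * expR (l * x)).
Local Notation W := (fun z : RR * RR => expR (l * (z.1 : R))).

(** Each integration against the potential gains the factor [2^-1] of [hl]. Two of them, one with
    [v] and one with [v^*], make up both the kernel iteration and the operator [Bop]. *)
Lemma weighted_av_int p (F : R -> 'M[C]_(m2, p)) (b x : R) : mmeas F ->
  (forall t, nrm (F t) <= b * expR (l * t)) ->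
  mxint (cutm x (fun y => v y *m F y)) /\
  nrm (I (cutm x (fun y => v y *m F y))) <= b * 2^-1 * expR (l * x).
Proof.
move=> mF Fb; have [wi wl] := hl x.
have b0 : 0 <= b by have := le_trans (nrm_ge0 _) (Fb 0); rewrite pmulr_lge0 ?expR_gt0.
have mm : mmeas (cutm x (fun y => v y *m F y)) by apply: mmeas_cutm; exact: mxmeasM.
have bi : intg (fun t => b * cutr x (fun t => av t * expR (l * t)) t) by exact: integrableZr'.
have le t : nrm (cutm x (fun y => v y *m F y) t) <= b * cutr x (fun t => av t * expR (l * t)) t.
  rewrite nrm_cutm /cutr; case: ifP => _; last by rewrite mulr0.
  by apply: le_trans (nrmM _ _) _; rewrite mulrCA ler_wpM2l ?nrm_ge0.
split; first exact: mxint_dom mm bi le.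
apply: le_trans (nrm_mx_integral mm bi le) _.
by rewrite RintegralZl// -mulrA ler_wpM2l.
Qed.

Lemma weighted_aw_int p (F : R -> 'M[C]_(m1, p)) (b x : R) : mmeas F ->
  (forall t, nrm (F t) <= b * expR (l * t)) ->
  mxint (cutm x (fun y => (v y)^t* *m F y)) /\
  nrm (I (cutm x (fun y => (v y)^t* *m F y))) <= b * 2^-1 * expR (l * x).
Proof.
move=> mF Fb; have [wi wl] := hl x.
have b0 : 0 <= b by have := le_trans (nrm_ge0 _) (Fb 0); rewrite pmulr_lge0 ?expR_gt0.
have mm : mmeas (cutm x (fun y => (v y)^t* *m F y)) by apply: mmeas_cutm; exact: mxmeasM.
have bi : intg (fun t => b * cutr x (fun t => av t * expR (l * t)) t) by exact: integrableZr'.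
have le t : nrm (cutm x (fun y => (v y)^t* *m F y) t) <= b * cutr x (fun t => av t * expR (l * t)) t.
  rewrite nrm_cutm /cutr; case: ifP => _; last by rewrite mulr0.
  by apply: le_trans (nrmM _ _) _; rewrite nrm_adj mulrCA ler_wpM2l ?nrm_ge0.
split; first exact: mxint_dom mm bi le.
apply: le_trans (nrm_mx_integral mm bi le) _.
by rewrite RintegralZl// -mulrA ler_wpM2l.
Qed.

Let slice N (r : R) : @mxmeas R _ (RR * RR)%type m2 m2 N -> mmeas (fun y => N (y, r)).
Proof. move=> mN; apply: mxmeas_comp mN _; exact: pair2_measurable. Qed.

Let diag (L : R * R -> 'M[C]_(m1, m2)) (x t : R) : @mxmeas R _ (RR * RR)%type _ _ L ->
  mmeas (fun y => L (y, y - x + t)).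
Proof.
move=> mL; apply: (@mxmeas_comp _ _ _ RR _ _ _ L (fun y : RR => (y, ((y : R) - x + t) : RR))) => //.
apply: measurable_fun_pair => //.
by apply: measurable_funD => //; apply: measurable_funB.
Qed.

(** The inhomogeneous term [v z.2] is only square-summable in [z.2], so [trL N] need not be
    [wbounded]. This mixed bound is what [trN] receives instead. *)
Lemma trL_bound (N : R * R -> 'M[C]_m2) (b : R) : @mxmeas R _ (RR * RR)%type _ _ N ->
  (forall z, nrm (N z) <= b * W z) ->
  forall z, nrm (trL N z) <= av z.2 + b * 2^-1 * W z.
Proof.
move=> mN Nb z; rewrite /trL.
have b0 : 0 <= b by have := le_trans (nrm_ge0 _) (Nb z); rewrite pmulr_lge0 ?expR_gt0.
case: ifP => _; last by rewrite nrm0 addr_ge0// !mulr_ge0 ?expR_ge0.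
apply: le_trans (nrmD _ _) _; rewrite lerD2l.
apply: (weighted_av_int z.1 _ _).2; first exact: slice.
by move=> t; exact: (Nb (t, z.2)).
Qed.

(** The term [v z.2], possibly unbounded, cancels in the difference, which therefore does obey a
    weighted bound. *)
Lemma trL_contraction (N N' : R * R -> 'M[C]_m2) (b : R) :
  @wbounded _ _ (RR * RR)%type W _ _ N -> @wbounded _ _ (RR * RR)%type W _ _ N' ->
  (forall z, nrm (N z - N' z) <= b * W z) ->
  forall z, nrm (trL N z - trL N' z) <= b * 2^-1 * W z.
Proof.
move=> [mN [c Nc]] [mN' [c' Nc']] NN' z; rewrite /trL.
have b0 : 0 <= b by have := le_trans (nrm_ge0 _) (NN' z); rewrite pmulr_lge0 ?expR_gt0.
case: ifP => _; last by rewrite subr0 nrm0 !mulr_ge0 ?expR_ge0.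
have [i1 _] := weighted_av_int z.1 (slice z.2 mN) (fun t => Nc (t, z.2)).
have [i2 _] := weighted_av_int z.1 (slice z.2 mN') (fun t => Nc' (t, z.2)).
rewrite opprD addrACA subrr add0r -mx_integralB//.
rewrite (eq_mx_integral (G := cutm z.1 (fun y => v y *m (N (y, z.2) - N' (y, z.2))))).
  apply: (weighted_av_int z.1 _ _).2; last by move=> t; exact: (NN' (t, z.2)).
  by apply: mxmeasB; exact: slice.
by move=> t; rewrite /cutm; case: ifP; rewrite ?subr0// mulmxBr.
Qed.

(** The product of [|v|] with a translate of itself is integrable by [Rintegral_mul_le], which takes
    care of the unbounded part of [L]. *)
Lemma trN_mxint (L : R * R -> 'M[C]_(m1, m2)) (b x t : R) : @mxmeas R _ (RR * RR)%type _ _ L ->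
  (forall z, nrm (L z) <= av z.2 + b * W z) ->
  mxint (cutm x (fun y => (v y)^t* *m L (y, y - x + t))).
Proof.
move=> mL Lb; have [wi _] := hl x.
have mvs : measurable_fun [set: RR] (fun y : RR => av (y + (t - x))).
  by apply: (measurableT_comp mav); exact: measurable_funD.
have [pi _] := Rintegral_mul_le mav mvs avsq
  (intg_shift (t - x) avsq (fun y => sqr_ge0 _)).
apply: (mxint_dom (b := fun y => av y * av (y + (t - x))
    + b * cutr x (fun t => av t * expR (l * t)) y)).
- by apply: mmeas_cutm; apply: mxmeasM => //; exact: diag.
- by apply: integrableDr => //; exact: integrableZr'.
- move=> y; rewrite nrm_cutm /cutr; case: ifP => _; last by rewrite mulr0 addr0 mulr_ge0.
  apply: le_trans (nrmM _ _) _; rewrite nrm_adj mulrCA -mulrDr ler_wpM2l//.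
  by have := Lb (y, y - x + t); rewrite /= (_ : y - x + t = y + (t - x))//; ring.
Qed.

Lemma trN_contraction (L L' : R * R -> 'M[C]_(m1, m2)) (b : R) :
  @mxmeas R _ (RR * RR)%type _ _ L -> @mxmeas R _ (RR * RR)%type _ _ L' ->
  (exists c : R, forall z, nrm (L z) <= av z.2 + c * W z) ->
  (exists c : R, forall z, nrm (L' z) <= av z.2 + c * W z) ->
  (forall z, nrm (L z - L' z) <= b * W z) ->
  forall z, nrm (trN L z - trN L' z) <= b * 2^-1 * W z.
Proof.
move=> mL mL' [c Lc] [c' Lc'] LL' z; rewrite /trN.
have b0 : 0 <= b by have := le_trans (nrm_ge0 _) (LL' z); rewrite pmulr_lge0 ?expR_gt0.
case: ifP => _; last by rewrite subr0 nrm0 !mulr_ge0 ?expR_ge0.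
rewrite -mx_integralB; [|exact: trN_mxint Lc|exact: trN_mxint Lc'].
rewrite (eq_mx_integral (G := cutm z.1 (fun y => (v y)^t* *m
    (L (y, y - z.1 + z.2) - L' (y, y - z.1 + z.2))))).
  apply: (weighted_aw_int z.1 _ _).2; last by move=> t; exact: (LL' (t, t - z.1 + z.2)).
  by apply: mxmeasB; exact: diag.
by move=> t; rewrite /cutm; case: ifP; rewrite ?subr0// mulmxBr.
Qed.

End Weight.

(** The contraction acts on [N] alone, through [trN] after [trL]; [L] is then defined as [trL N].
    The two factors [2^-1] would give [1/4], of which [1/2] suffices. *)
Lemma transmutation_kernel_ex :
  exists c (N : R -> R -> 'M[C]_m2) (L : R -> R -> 'M[C]_(m1, m2)),
  [/\ vkernel T c N,
      mxmeas (fun z : RR * RR => L z.1 z.2),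
      forall x t, 0 < t < x -> x < T ->
        N x t = I (cutm x (fun y => (v y)^t* *m L y (y - x + t))),
      forall x t, 0 < t < x -> x < T ->
        L x t = v t + I (cutm x (fun y => v y *m N y t)) &
      forall x t, ~~ ((0 < t < x) && (x < T)) -> L x t = 0].
Proof.
have [|l l0 hl] := exp_weight mav avsq av0 (e := 2^-1); first by rewrite invr_gt0.
pose W := fun z : RR * RR => expR (l * (z.1 : R)).
pose S := \int[mu]_t av t ^+ 2.
have S0 : 0 <= S by apply: Rintegral_ge0 => t _; exact: sqr_ge0.
pose Phi (N : RR * RR -> 'M[C]_m2) : RR * RR -> 'M[C]_m2 := trN (trL N).
(* The first iterate is at most the integral of [|v(y)| |v(y - x + t)|], hence at most the sum of
   the squared norms of [v] and of its translate, both equal to [S]. *)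
have [||z|N [mN Nb NE]] := @wcontraction_fixpoint R _ (RR * RR)%type W _ _ Phi (S + S).
- move=> N N' b wN wN' NN' z.
  have hL := trL_contraction hl wN wN' NN'.
  have [[mN [c Nc]] [mN' [c' Nc']]] := (wN, wN').
  have b0 : 0 <= b by have := le_trans (nrm_ge0 _) (NN' z); rewrite pmulr_lge0 ?expR_gt0.
  have := trN_contraction hl (trL_meas mN) (trL_meas mN') _ _ hL z.
  move=> h; apply: le_trans (h _ _) _.
  + by exists (c * 2^-1); exact: (trL_bound hl mN Nc).
  + by exists (c' * 2^-1); exact: (trL_bound hl mN' Nc').
  + by rewrite ler_wpM2r ?expR_ge0// ler_piMr ?mulr_ge0// invf_le1//; lra.
- by move=> N [mN _]; apply: trN_meas; exact: trL_meas.
- rewrite /Phi /trN; case: ifPn => [zT|_]; last by rewrite nrm0 mulr_ge0 ?addr_ge0 ?expR_ge0.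
  set t := z.2; set x := z.1.
  have mvs : measurable_fun [set: RR] (fun y : RR => av (y + (t - x))).
    by apply: (measurableT_comp mav); exact: measurable_funD.
  have shsq := intg_shift (t - x) avsq (fun y => sqr_ge0 _).
  have [pi pl] := Rintegral_mul_le mav mvs avsq shsq.
  have shE : \int[mu]_y av (y + (t - x)) ^+ 2 = S.
    rewrite (@Rintegral_shift _ (t - x) (fun t => av t ^+ 2))//.
    exact: measurable_funX.
  apply: (@le_trans _ _ (S + S)); last first.
    rewrite ler_peMr ?addr_ge0// /W -expR0 ler_expR mulr_ge0// ltW//.
    by move: zT => /andP[/andP[t0 tx] _]; exact: lt_trans t0 tx.
  rewrite shE -/S in pl; apply: le_trans pl.
  apply: nrm_mx_integral pi _.
    apply: mmeas_cutm; apply: mxmeasM => //.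
    apply: (@mxmeas_comp _ _ _ RR _ _ _ (trL (fun=> 0)) (fun y : RR => (y, ((y : R) - x + t) : RR))).
      by apply: trL_meas; exact: mxmeas_cst.
    apply: measurable_fun_pair => //.
    by apply: measurable_funD => //; apply: measurable_funB.
  move=> y; rewrite nrm_cutm /cutr; case: ifP => _; last by rewrite mulr_ge0.
  apply: le_trans (nrmM _ _) _; rewrite nrm_adj ler_wpM2l// /trL.
  case: ifP => _; last by rewrite nrm0.
  rewrite (eq_mx_integral (G := fun=> 0)) ?mx_integral0 ?addr0.
    by rewrite /= (_ : y - x + t = y + (t - x))//; ring.
  by move=> ?; rewrite /cutm mulmx0; case: ifP.
(* The weight increases, so its value at [T] turns the weighted bound on [N] into a plain one. *)
pose c := 4 * (m2 * m2)%:R * (S + S) * expR (l * T).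
exists c, (fun x t => N (x, t)), (fun x t => trL N (x, t)); split.
- split.
  + by have -> : (fun z : RR * RR => N (z.1, z.2)) = N by apply/funext => -[].
  + move=> x t; have [/andP[_ xT]|nT] := boolP ((0 < t < x) && (x < T)).
      apply: le_trans (Nb _) _; rewrite /c ler_wpM2l ?mulr_ge0 ?addr_ge0//.
      by rewrite ler_expR ler_pM2l// ltW.
    rewrite -NE /Phi /trN /= (negbTE nT) nrm0 !mulr_ge0 ?addr_ge0 ?expR_ge0//.
  + by move=> x t nT; rewrite -NE /Phi /trN /= (negbTE nT).
- have -> : (fun z : RR * RR => trL N (z.1, z.2)) = trL N by apply/funext => -[].
  exact: trL_meas.
- by move=> x t xt xT; rewrite -NE /Phi /trN /= xt xT.
- by move=> x t xt xT; rewrite /trL /= xt xT.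
- by move=> x t nT; rewrite /trL /= (negbTE nT).
Qed.

End TransmutationKernel.

(** * The integral identity satisfied by the transmutation operator *)

Section TransmutationIdentity.
Context {R : realType}.
Local Notation C := R[i].
Local Notation mu := (@lebesgue_measure R).
Local Notation RR := (measurableTypeR R).
Local Notation mmeas F := (@mxmeas R _ RR _ _ F).
Local Notation intg b := (mu.-integrable setT (EFin \o b)).
Local Notation mxint := (mx_integrable setT).
Local Notation I := (mx_integral setT).

Lemma mx_Fubini_dom p q (G : R -> R -> 'M[C]_(p, q)) (b : R -> R) :
  mxmeas (fun z : RR * RR => G z.1 z.2) -> intg b ->
  (forall x, exists g : R -> R, [/\ intg g, forall y, nrm (G x y) <= g y &
     \int[mu]_y g y <= b x]) ->
  I (fun x => I (fun y => G x y)) = I (fun y => I (fun x => G x y)).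
Proof.
move=> mG bi Gb; apply: (mx_Fubini mG bi) => x; have [g [gi Gg gb]] := Gb x.
apply: (@le_trans _ _ (\int[mu]_y (g y)%:E)%E).
  apply: ge0_le_integral => //.
  - by move=> y _; rewrite lee_fin nrm_ge0.
  - by apply/measurable_EFinP; apply: measurable_nrm; exact: mxmeas_slice.
  - by apply/measurable_EFinP; exact: (intg_meas gi).
  - by move=> y _; rewrite lee_fin.
rewrite -[leLHS]fineK ?lee_fin//.
exact: (integrable_fin_num measurableT gi).
Qed.

Lemma mxmeas_slice2 p q (k : R -> R -> 'M[C]_(p, q)) t :
  mxmeas (fun z : RR * RR => k z.1 z.2) -> mmeas (fun x => k x t).
Proof.
move=> mk; apply: (@mxmeas_comp _ _ _ RR _ _ _ (fun z => k z.1 z.2) (fun x => (x, t))) => //.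
Qed.

Lemma mx_integral_const_if p q (b : bool) (F : R -> 'M[C]_(p, q)) :
  I (fun t => if b then F t else 0) = if b then I F else 0.
Proof. by case: b; rewrite //= mx_integral0. Qed.

Lemma ae_neq (y : R) : {ae mu, forall t : R, t <> y}.
Proof.
exists [set y]; split => //=; first exact: lebesgue_measure_set1.
by move=> t /= /contrapT.
Qed.

Context (T : R) m1 m2 (v : R -> 'M[C]_(m1, m2)) (hv : mxL2 T v).
Local Notation w := (fun t => (v t)^t*).
Local Notation av := (fun t => nrm (v t)).
Context (c : R) (N : R -> R -> 'M[C]_m2) (L : R -> R -> 'M[C]_(m1, m2)).
Context (hN : vkernel T c N) (mL : mxmeas (fun z : RR * RR => L z.1 z.2)).
Context (NE : forall x t, 0 < t < x -> x < T ->
  N x t = I (cutm x (fun y => (v y)^t* *m L y (y - x + t)))).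
Context (LE : forall x t, 0 < t < x -> x < T ->
  L x t = v t + I (cutm x (fun y => v y *m N y t))).
Context (L0 : forall x t, ~~ ((0 < t < x) && (x < T)) -> L x t = 0).

Let mv : mmeas v. Proof. by case: hv. Qed.
Let mw : mmeas w. Proof. exact: mxmeas_adj. Qed.
Let mav : measurable_fun [set: RR] av. Proof. exact: measurable_nrm. Qed.
Let av0 t : 0 <= av t. Proof. exact: nrm_ge0. Qed.
Let avsq : intg (fun t => av t ^+ 2). Proof. by case: hv. Qed.
Let avi : intg av. Proof. exact: mxL2_intg hv. Qed.
Let c0 : 0 <= c. Proof. exact: vkernel_ge0 hN. Qed.
Let mN : mxmeas (fun z : RR * RR => N z.1 z.2). Proof. by case: hN. Qed.
Let Nc x t : nrm (N x t) <= c. Proof. by case: hN. Qed.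
Let N0 x t : ~~ ((0 < t < x) && (x < T)) -> N x t = 0. Proof. by case: hN => _ _; apply. Qed.

(** A square-summable majorant of [L x t], uniform in [x]: the term [|v(t)|], plus the contribution
    of the bounded kernel [N] integrated against [v]. *)
Let bL (t : R) := av t + c * (\int[mu]_y av y) * cutr T (fun=> 1) t.

Let vav0 : 0 <= \int[mu]_y av y.
Proof. by apply: Rintegral_ge0 => t _; exact: nrm_ge0. Qed.

Let bL0 t : 0 <= bL t.
Proof.
by rewrite addr_ge0 ?mulr_ge0// /cutr; case: ifP.
Qed.

Let mbL : measurable_fun [set: RR] bL.
Proof.
by apply: measurable_funD => //; apply: measurable_funM => //; apply: measurable_cutr.
Qed.

Let bLsq : intg (fun t => bL t ^+ 2).
Proof.
pose d := c * \int[mu]_y av y.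
apply: (intg_dom (b := fun t => 2 * av t ^+ 2 + 2 * d ^+ 2 * cutr T (fun=> 1) t)).
- exact: measurable_funX.
- apply: integrableDr; apply: integrableZr' => //; exact: intg_cutr1.
- move=> t; rewrite ger0_norm ?sqr_ge0// /bL -/d /cutr; case: ifP => _.
    have := sqr_ge0 (av t - d); rewrite !mulr1; nra.
  by rewrite !mulr0 !addr0; have := sqr_ge0 (av t); nra.
Qed.

Let bLi : intg bL.
Proof.
by apply: integrableDr => //; apply: integrableZr'; exact: intg_cutr1.
Qed.

Let L_bound x t : nrm (L x t) <= bL t.
Proof.
have [/andP[tx xT]|nT] := boolP ((0 < t < x) && (x < T)); last first.
  by rewrite L0// nrm0.
rewrite LE//; apply: le_trans (nrmD _ _) _; rewrite lerD2l.
have -> : cutr T (fun=> 1) t = 1.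
  by rewrite /cutr; case/andP: tx => -> tx; rewrite (lt_trans tx xT).
rewrite mulr1 -RintegralZl//.
apply: nrm_mx_integral.
- apply: mmeas_cutm; apply: mxmeasM => //.
  exact: mxmeas_slice2.
- exact: integrableZr'.
- move=> y; rewrite nrm_cutm /cutr; case: ifP => _; last by rewrite mulr_ge0.
  by apply: le_trans (nrmM _ _) _; rewrite mulrC ler_wpM2r.
Qed.

Section Apply.
Context q (f : R -> 'M[C]_(m2, q)) (hf : mxL2 T f).
Local Notation nf := (fun t => nrm (f t)).

Let mf : mmeas f. Proof. by case: hf. Qed.
Let mnf : measurable_fun [set: RR] nf. Proof. exact: measurable_nrm. Qed.
Let nfsq : intg (fun t => nf t ^+ 2). Proof. by case: hf. Qed.
Let nfi : intg nf. Proof. exact: mxL2_intg hf. Qed.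
Let nf_shift s : measurable_fun [set: RR] (fun t : RR => nf ((t : R) + s)).
Proof. by apply: (measurableT_comp mnf); exact: measurable_funD. Qed.
Let mf_shift s : mmeas (fun t => f (t + s)).
Proof.
apply: (@mxmeas_comp _ _ _ RR RR _ _ f (fun t : RR => ((t : R) + s) : RR)) => //.
exact: measurable_funD.
Qed.

(** The operator with kernel [L], applied to [f] translated by [s]. Translates appear because [N]
    integrates [L] along the characteristics, on which [y - t] is constant. *)
Definition trS (x s : R) := I (fun t => L x t *m f (t + s)).

Let K := \int[mu]_t bL t ^+ 2 + \int[mu]_t nf t ^+ 2.

Let K0 : 0 <= K.
Proof. by apply: addr_ge0; apply: Rintegral_ge0 => t _; exact: sqr_ge0. Qed.

Lemma trS_dom s : intg (fun t => bL t * nf (t + s)) /\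
  \int[mu]_t (bL t * nf (t + s)) <= K.
Proof.
have [h1 h2] := Rintegral_mul_le mbL (nf_shift s) bLsq
  (intg_shift s nfsq (fun t => sqr_ge0 _)).
split=> //; apply: le_trans h2 _; rewrite lerD2l.
by rewrite (@Rintegral_shift _ s (fun t => nf t ^+ 2))//; exact: measurable_funX.
Qed.

Let trS_le x s t : nrm (L x t *m f (t + s)) <= bL t * nf (t + s).
Proof. by apply: le_trans (nrmM _ _) _; rewrite ler_wpM2r ?nrm_ge0. Qed.

Let trS_mslice x s : mmeas (fun t => L x t *m f (t + s)).
Proof. by apply: mxmeasM => //; exact: mxmeas_slice. Qed.

Lemma trS_int x s : mxint (fun t => L x t *m f (t + s)).
Proof. by apply: mxint_dom (trS_mslice x s) (trS_dom s).1 _. Qed.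

Lemma trS_bound x s : nrm (trS x s) <= K.
Proof.
by apply: le_trans (trS_dom s).2; exact: nrm_mx_integral (trS_mslice x s) (trS_dom s).1 _.
Qed.

Lemma trS_bounded : exists2 B : R, 0 <= B & forall x s, nrm (trS x s) <= B.
Proof. by exists K => //; exact: trS_bound. Qed.

Lemma trS_meas : mxmeas (fun z : RR * RR => trS z.1 z.2).
Proof.
apply: (@mxmeas_integral _ _ (RR * RR)%type _ _
  (fun x : (RR * RR) * RR => L x.1.1 x.2 *m f ((x.2 : R) + x.1.2))).
apply: mxmeasM.
  apply: (@mxmeas_comp _ _ _ _ _ _ _ _ (fun x : (RR * RR) * RR => (x.1.1, x.2)) mL).
  apply: measurable_fun_pair; first exact: (measurableT_comp measurable_fst measurable_fst).
  exact: measurable_snd.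
apply: mxmeas_comp mf _; apply: measurable_funD; first exact: measurable_snd.
exact: (measurableT_comp measurable_snd measurable_fst).
Qed.

(** Insert the equation of [N], exchange the integrals, and move [t] by [x - y] so that [L] is
    evaluated at its integration variable; the translation then falls on [f]. *)
Lemma vop_char x : 0 < x < T ->
  vop N f x = I (cutm x (fun y => (v y)^t* *m trS y (x - y))).
Proof.
move=> /andP[x0 xT].
pose G (y t : R) := if 0 < t < x then
  cutm x (fun y => (v y)^t* *m (L y (y - x + t) *m f t)) y else 0.
have mshift (y : R) : mmeas (fun t => L y (y - x + t)).
  apply: (@mxmeas_comp _ _ _ RR _ _ _ (L y) (fun t : RR => (y - x + (t : R) : RR))).
    exact: mxmeas_slice.
  exact: measurable_funD.
have mdiag (t : R) : mmeas (fun y => L y (y - x + t)).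
  apply: (@mxmeas_comp _ _ _ RR _ _ _ _ (fun y : RR => (y, ((y : R) - x + t) : RR)) mL).
  apply: measurable_fun_pair => //.
  by apply: measurable_funD => //; apply: measurable_funB.
have Nint (t : R) : 0 < t < x -> mxint (cutm x (fun y => (v y)^t* *m L y (y - x + t))).
  move=> tx.
  have mbs : measurable_fun [set: RR] (fun y : RR => bL ((y : R) + (t - x))).
    by apply: (measurableT_comp mbL); exact: measurable_funD.
  have [h1 _] := Rintegral_mul_le mav mbs avsq (intg_shift (t - x) bLsq (fun y => sqr_ge0 _)).
  apply: mxint_dom h1 _ => [|y].
    by apply: mmeas_cutm; apply: mxmeasM.
  rewrite nrm_cutm /cutr; case: ifP => _; last by rewrite mulr_ge0.
  apply: le_trans (nrmM _ _) _; rewrite nrm_adj ler_wpM2l//.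
  by have := L_bound y (y - x + t); rewrite (_ : y - x + t = y + (t - x))//; ring.
transitivity (I (fun t => I (fun y => G y t))).
  apply: eq_mx_integral => t; rewrite /G mx_integral_const_if; case: ifP => tx; last first.
    by rewrite N0 ?mul0mx ?tx.
  rewrite NE// -mx_integralMr; last exact: Nint.
  by apply: eq_mx_integral => y; rewrite /cutm; case: ifP => _; rewrite ?mul0mx// mulmxA.
rewrite -(mx_Fubini_dom (G := G) (b := fun y => K * av y)).
- apply: eq_mx_integral => y; rewrite /cutm; case: ifPn => yx; last first.
    rewrite -[RHS](mx_integral0 _ _); apply: eq_mx_integral => t.
    by rewrite /G cutm_out//; case: ifP.
  rewrite /trS -mx_integralMl; last exact: trS_int.
  rewrite -(@mx_integral_shift _ _ _ (y - x)
    (fun t => (v y)^t* *m (L y t *m f (t + (x - y))))); last first.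
    by apply: mxmeasM; [exact: mxmeas_cst|exact: trS_mslice].
  apply: eq_mx_integral => t; rewrite /G cutm_in//.
  rewrite (_ : t + (y - x) + (x - y) = t); last by ring.
  rewrite (_ : t + (y - x) = y - x + t); last by ring.
  (* The restriction [0 < t < x] costs nothing: [L y (y - x + t)] vanishes unless
     [x - y < t < x]. *)
  case: ifPn => // tx; rewrite L0 ?mul0mx ?mulmx0//.
  apply: contra tx => /andP[/andP[h1 h2] _].
  by case/andP: yx => y0 yx; apply/andP; split; lra.
- apply: mxmeas_if; last exact: mxmeas_cst.
    by apply: measurable_segment; [exact: measurable_cst|exact: measurable_snd].
  apply: mxmeas_if; last exact: mxmeas_cst.
    by apply: measurable_segment; [exact: measurable_cst|exact: measurable_fst].
  apply: mxmeasM; first exact: mxmeas_comp mw measurable_fst.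
  apply: mxmeasM; last exact: mxmeas_comp mf measurable_snd.
  apply: (@mxmeas_comp _ _ _ _ _ _ _ _
    (fun z : RR * RR => (z.1, ((z.1 : R) - x + z.2) : RR)) mL).
  apply: measurable_fun_pair; first exact: measurable_fst.
  apply: measurable_funD; last exact: measurable_snd.
  by apply: measurable_funB; [exact: measurable_fst|exact: measurable_cst].
- exact: integrableZr'.
- move=> y; exists (fun t => av y * (bL (t + (y - x)) * nf t)); split.
  + apply: integrableZr'; have [h1 _] := trS_dom (x - y).
    have := intg_shift (y - x) h1; rewrite (_ : (fun t => _) = (fun t => bL (t + (y - x)) * nf t)).
      by apply=> t; rewrite mulr_ge0 ?nrm_ge0.
    by apply/funext => t; congr (_ * nrm (f _)); ring.
  + move=> t; rewrite /G; case: ifP => _; last by rewrite nrm0 !mulr_ge0 ?nrm_ge0.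
    rewrite nrm_cutm /cutr; case: ifP => _; last by rewrite !mulr_ge0 ?nrm_ge0.
    apply: le_trans (nrmM _ _) _; rewrite nrm_adj ler_wpM2l//.
    apply: le_trans (nrmM _ _) _; rewrite ler_wpM2r ?nrm_ge0//.
    by rewrite (_ : t + (y - x) = y - x + t)//; ring.
  + have [h1 h2] := trS_dom (x - y).
    have E : (fun t => bL (t + (y - x)) * nf t) =
        (fun t => (fun t => bL t * nf (t + (x - y))) (t + (y - x))).
      by apply/funext => t; congr (_ * nrm (f _)); ring.
    rewrite RintegralZl//; last first.
      by rewrite E; exact: (intg_shift (y - x) h1 (fun t => mulr_ge0 (bL0 t) (nrm_ge0 _))).
    by rewrite E (Rintegral_shift (y - x) (intg_meas h1)) mulrC ler_wpM2r.
Qed.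

(** The equation of [L] is integrated against [f]: its term [v t] gives [v f], and Fubini's theorem
    collects the rest into [v] times [vop N f]. *)
Lemma trS0 x : 0 < x < T ->
  trS x 0 = I (cutm x (fun y => v y *m (f y + vop N f y))).
Proof.
move=> /andP[x0 xT].
pose G (y t : R) := if 0 < t < x then cutm x (fun y => v y *m (N y t *m f t)) y else 0.
have fint := mxL2_mxint hf.
have vNint (t : R) : mxint (cutm x (fun y => v y *m N y t)).
  apply: (mxint_dom (b := fun y => c * av y)).
  - apply: mmeas_cutm; apply: mxmeasM => //.
    exact: mxmeas_slice2.
  - exact: integrableZr'.
  - move=> y; rewrite nrm_cutm /cutr; case: ifP => _; last by rewrite mulr_ge0.
    by apply: le_trans (nrmM _ _) _; rewrite mulrC ler_wpM2r.
have mG : mxmeas (fun z : RR * RR => G z.1 z.2).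
  apply: mxmeas_if; last exact: mxmeas_cst.
    by apply: measurable_segment; [exact: measurable_cst|exact: measurable_snd].
  apply: mxmeas_if; last exact: mxmeas_cst.
    by apply: measurable_segment; [exact: measurable_cst|exact: measurable_fst].
  apply: mxmeasM; first exact: mxmeas_comp mv measurable_fst.
  by apply: mxmeasM => //; exact: mxmeas_comp mf measurable_snd.
have split t : L x t *m f (t + 0) = cutm x (fun t => v t *m f t) t + I (fun y => G y t).
  rewrite addr0 /G mx_integral_const_if /cutm; case: ifP => tx; last first.
    by rewrite addr0 L0 ?mul0mx ?tx.
  rewrite LE// mulmxDl -mx_integralMr//; congr (_ + _).
  by apply: eq_mx_integral => y; rewrite /cutm; case: ifP; rewrite ?mul0mx ?mulmxA.
have i1 := mxint_cutm x (mxL2_mxintM hv hf).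
(* By [split] this is a difference of two functions already known to be integrable. *)
have i2 : mxint (fun t => I (fun y => G y t)).
  rewrite (_ : (fun t => I _) = (fun t => L x t *m f (t + 0) - cutm x (fun t => v t *m f t) t)).
    by apply: mxintB => //; exact: trS_int.
  by apply/funext => t; rewrite split addrC addKr.
rewrite /trS (eq_mx_integral split) mx_integralD//.
rewrite -(mx_Fubini_dom (G := G) (b := fun y => c * (\int[mu]_t nf t) * av y))//.
- have i3 : mxint (cutm x (fun y => v y *m vop N f y)).
    by apply: mxint_cutm; apply: mxL2_mxintM hv _; exact: vop_mxL2.
  rewrite [in RHS](eq_mx_integral (G := fun y => cutm x (fun t => v t *m f t) y +
      cutm x (fun y => v y *m vop N f y) y)); last first.
    by move=> y; rewrite /cutm; case: ifP => _; rewrite ?addr0 ?mulmxDr.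
  rewrite mx_integralD//; congr (_ + _); apply: eq_mx_integral => y.
  rewrite /cutm; case: ifPn => yx; last first.
    rewrite -[RHS](mx_integral0 _ _); apply: eq_mx_integral => t.
    by rewrite /G cutm_out//; case: ifP.
  rewrite /vop -mx_integralMl; last exact: (vop_mxint hN).
  apply: eq_mx_integral => t; rewrite /G cutm_in//; case: ifPn => // tx.
  rewrite N0 ?mul0mx ?mulmx0//; apply: contra tx => /andP[/andP[-> ty] _].
  by case/andP: yx => _; exact: lt_trans.
- exact: integrableZr'.
- move=> y; exists (fun t => av y * (c * nf t)); split.
  + by do 2 apply: integrableZr'.
  + move=> t; rewrite /G; case: ifP => _; last by rewrite nrm0 !mulr_ge0 ?nrm_ge0.
    rewrite nrm_cutm /cutr; case: ifP => _; last by rewrite !mulr_ge0 ?nrm_ge0.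
    apply: le_trans (nrmM _ _) _; rewrite ler_wpM2l//.
    by apply: le_trans (nrmM _ _) _; rewrite ler_wpM2r ?nrm_ge0.
  + by rewrite RintegralZl ?RintegralZl// 1?mulrC//; exact: integrableZr'.
Qed.

End Apply.

Lemma mxint_cutm_adj q (g : R -> 'M[C]_(m1, q)) (B x : R) : mmeas g ->
  (forall t, nrm (g t) <= B) -> mxint (cutm x (fun y => (v y)^t* *m g y)).
Proof.
move=> mg gB; have B0 := le_trans (nrm_ge0 _) (gB 0).
apply: (mxint_dom (b := fun y => B * av y)).
- by apply: mmeas_cutm; exact: mxmeasM.
- exact: integrableZr'.
- move=> y; rewrite nrm_cutm /cutr; case: ifP => _; last by rewrite mulr_ge0.
  by apply: le_trans (nrmM _ _) _; rewrite nrm_adj mulrC ler_wpM2r.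
Qed.

Section Primitive.
Context q (f : R -> 'M[C]_(m2, q)) (hf : mxL2 T f) (F0 : 'M[C]_(m2, q)).
Local Notation nf := (fun t => nrm (f t)).
Let F x := F0 + I (cutm x f).
(** A primitive does not vanish off []0, T[]; [h] is its version in [mxL2], and [vop N] does not
    distinguish the two. *)
Let h := cutm T F.
Let mf : mmeas f. Proof. by case: hf. Qed.
Let fint : mxint f. Proof. exact: mxL2_mxint hf. Qed.
Let nfi : intg nf. Proof. exact: mxL2_intg hf. Qed.

Let hh : mxL2 T h.
Proof.
apply: (mxL2_bounded (c := nrm F0 + \int[mu]_t nf t)).
  apply: mxmeasD; first exact: mxmeas_cst.
  apply: (@mxmeas_integral _ _ RR _ _
    (fun z : RR * RR => if 0 < (z.2 : R) < z.1 then f z.2 else 0)).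
  apply: mxmeas_if; last exact: mxmeas_cst.
    by apply: measurable_segment; [exact: measurable_fst|exact: measurable_snd].
  exact: mxmeas_comp mf measurable_snd.
move=> t _; apply: le_trans (nrmD _ _) _; rewrite lerD2l.
apply: nrm_mx_integral => //; first exact: mmeas_cutm.
by move=> y; rewrite nrm_cutm /cutr; case: ifP => // _; exact: nrm_ge0.
Qed.

(** The interval is half-open so that its translate is exactly the difference of the cuts at
    [r + (x - y)] and at [r], with no null set to discard. *)
Let F_increment x y r : 0 < r -> y <= x ->
  F (r + (x - y)) = F r + I (fun t => if y <= t < x then f (t + (r - y)) else 0).
Proof.
move=> r0 yx; rewrite /F -addrA; congr (_ + _).
rewrite -(mx_integral_shift (y - r) (F := fun t => if y <= t < x then f (t + (r - y)) else 0)); last first.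
  apply: mxmeas_if; last exact: mxmeas_cst.
    apply: measurable_and; first by apply: measurable_fun_ler.
    by apply: measurable_fun_ltr.
  apply: (@mxmeas_comp _ _ _ RR RR _ _ f (fun t : RR => ((t : R) + (r - y)) : RR)) => //.
  exact: measurable_funD.
rewrite (eq_mx_integral (F := fun t => if y <= t + (y - r) < x then _ else _)
  (G := fun t => cutm (r + (x - y)) f t - cutm r f t)); last first.
  move=> t; rewrite (_ : t + (y - r) + (r - y) = t); last by ring.
  rewrite (_ : (y <= t + (y - r) < x) = (r <= t < r + (x - y))); last first.
    by apply/idP/idP => /andP[t1 t2]; apply/andP; split; lra.
  rewrite /cutm; case: (ltP 0 t) => t0 /=; last first.
    by rewrite subr0 ifF//; apply/negP => /andP[t1 _]; lra.
  case: (ltP t r) => tr /=; last by rewrite subr0.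
  by rewrite (_ : t < r + (x - y)) ?subrr//; lra.
by rewrite mx_integralB ?(addrC _ (- _)) ?addNKr//; exact: mxint_cutm.
Qed.

(** Trades the translation by [x - y] for an integral of translates of the derivative [f]:
    [F_increment] is applied under the integral of [trS], followed by Fubini's theorem. *)
Let trS_increment x y : 0 < y < x -> x < T ->
  trS h y (x - y) = trS h y 0 +
    I (fun t => if y <= t < x then trS f y (t - y) else 0).
Proof.
move=> /andP[y0 yx] xT.
pose G (r t : R) := if y <= t < x then L y r *m f (r + (t - y)) else 0.
have mseg : measurable_fun [set: RR] (fun t : RR => y <= (t : R) < x).
  apply: measurable_and; first by apply: measurable_fun_ler.
  by apply: measurable_fun_ltr.
have mfr (r : R) : mmeas (fun t => f (t + (r - y))).
  apply: (@mxmeas_comp _ _ _ RR RR _ _ f (fun t : RR => ((t : R) + (r - y)) : RR)) => //.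
  exact: measurable_funD.
have fri (r : R) : mxint (fun t => if y <= t < x then f (t + (r - y)) else 0).
  apply: (mxint_dom (b := fun t => nf (t + (r - y)))).
  - by apply: mxmeas_if => //; exact: mxmeas_cst.
  - exact: (intg_shift (r - y) nfi (fun t => nrm_ge0 _)).
  - by move=> t; case: ifP => _; rewrite ?nrm0 ?nrm_ge0.
have split r : L y r *m h (r + (x - y)) = L y r *m h (r + 0) + I (fun t => G r t).
  have [/andP[/andP[r0 ry] _]|nr] := boolP ((0 < r < y) && (y < T)); last first.
    rewrite L0// !mul0mx add0r -[LHS](mx_integral0 _ _); apply: eq_mx_integral => t.
    by rewrite /G L0// mul0mx; case: ifP.
  (* Since [0 < r < y], the point [r + (x - y)] stays below [x < T], where [h] and [F] coincide. *)
  rewrite addr0 /h !cutm_in; [|apply/andP; split; lra..].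
  rewrite F_increment ?(ltW yx)// mulmxDr; congr (_ + _).
  rewrite -mx_integralMl//; apply: eq_mx_integral => t; rewrite /G.
  case: ifP => _; last by rewrite mulmx0.
  by rewrite (_ : t + (r - y) = r + (t - y))//; ring.
have i1 := trS_int hh y 0; have i2 := trS_int hh y (x - y).
have i3 : mxint (fun r => I (fun t => G r t)).
  rewrite (_ : (fun r => I _) = (fun r => L y r *m h (r + (x - y)) - L y r *m h (r + 0))).
    exact: mxintB.
  by apply/funext => r; rewrite split addrC addKr.
rewrite {1}/trS (eq_mx_integral split) mx_integralD//; congr (_ + _).
rewrite (mx_Fubini_dom (G := G) (b := fun r => (\int[mu]_t nf t) * bL r)).
- apply: eq_mx_integral => t; rewrite /G mx_integral_const_if; case: ifP => // _.
- apply: mxmeas_if; last exact: mxmeas_cst.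
    by apply: (measurableT_comp mseg); exact: measurable_snd.
  apply: mxmeasM.
    apply: (@mxmeas_comp _ _ _ (RR * RR)%type RR _ _ (L y) (fun z : RR * RR => z.1)).
      exact: mxmeas_slice.
    exact: measurable_fst.
  apply: (@mxmeas_comp _ _ _ (RR * RR)%type RR _ _ f (fun z : RR * RR => (z.1 : R) + ((z.2 : R) - y) : RR)) => //.
  apply: measurable_funD; first exact: measurable_fst.
  by apply: measurable_funB; [exact: measurable_snd|exact: measurable_cst].
- exact: integrableZr'.
- move=> r; exists (fun t => bL r * nf (t + (r - y))); split.
  + by apply: integrableZr'; exact: (intg_shift (r - y) nfi (fun t => nrm_ge0 _)).
  + move=> t; rewrite /G; case: ifP => _; last by rewrite nrm0 mulr_ge0 ?nrm_ge0.
    apply: le_trans (nrmM _ _) _; rewrite (_ : r + (t - y) = t + (r - y)); last by ring.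
    by rewrite ler_wpM2r ?nrm_ge0.
  + rewrite RintegralZl//; last exact: (intg_shift (r - y) nfi (fun t => nrm_ge0 _)).
    by rewrite (Rintegral_shift (r - y) (intg_meas nfi)) mulrC.
Qed.

(** [vop_char] expresses [vop N F x] by translates of [h], which [trS_increment] splits. The
    untranslated part is the double integral of [v^*] and [v], by [trS0]. In the increments the
    integration over [y] is performed first; [vop_char], now read backwards for [f], turns them into
    the integral of [vop N f]. *)
Lemma transmutation_identity x : 0 < x < T ->
  F x + vop N F x = F0
    + I (cutm x (fun y => (v y)^t* *m I (cutm y (fun t => v t *m (F t + vop N F t)))))
    + I (cutm x (fun y => f y + vop N f y)).
Proof.
move=> xT; have /andP[x0 xT'] := xT; have T0 := lt_trans x0 xT'.
have vopF y : vop N F y = vop N h y by rewrite -(vop_cutm hN).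
have [B B0 hB] := trS_bounded hh; have [D D0 fD] := trS_bounded hf.
have mtrS (s : R -> R) : measurable_fun [set: RR] (s : RR -> RR) ->
    mmeas (fun y => trS h y (s y)).
  move=> ms; apply: (@mxmeas_comp _ _ _ RR _ _ _ (fun z : RR * RR => trS h z.1 z.2)
    (fun y : RR => (y, s y))); first exact: trS_meas.
  exact: measurable_fun_pair.
have i1 : mxint (cutm x (fun y => (v y)^t* *m trS h y 0)).
  by apply: (mxint_cutm_adj (B := B)) => //; apply: mtrS.
have i2 : mxint (cutm x (fun y => (v y)^t* *m trS h y (x - y))).
  apply: (mxint_cutm_adj (B := B)) => //; apply: mtrS.
  by apply: measurable_funB.
pose G (y t : R) := cutm x (fun y => if y <= t < x then (v y)^t* *m trS f y (t - y) else 0) y.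
have mfS (y : R) : mmeas (fun t => trS f y (t - y)).
  apply: (@mxmeas_comp _ _ _ RR RR _ _ (trS f y) (fun t : RR => ((t : R) - y) : RR)).
    exact: (mxmeas_slice y (trS_meas hf)).
  by apply: measurable_funB.
have mseg (y : R) : measurable_fun [set: RR] (fun t : RR => y <= (t : R) < x).
  apply: measurable_and; first by apply: measurable_fun_ler.
  by apply: measurable_fun_ltr.
have Sint (y : R) : mxint (fun t => if (0 < y) && (y <= t < x) then trS f y (t - y) else 0).
  apply: (mxint_dom (b := fun t => D * cutr x (fun=> 1) t)).
  - apply: mxmeas_if; [|exact: mfS|exact: mxmeas_cst].
    by apply: measurable_and => //; exact: measurable_cst.
  - by apply: integrableZr'; exact: intg_cutr1.
  - move=> t; rewrite /cutr; case: ifP => [/andP[y0 /andP[yt tx]]|_].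
      by rewrite (lt_le_trans y0 yt) tx mulr1.
    by rewrite nrm0 mulr_ge0//; case: ifP.
have split y : cutm x (fun y => (v y)^t* *m trS h y (x - y)) y =
    cutm x (fun y => (v y)^t* *m trS h y 0) y + I (fun t => G y t).
  have [yx|yx] := boolP (0 < y < x); last first.
    have G0 t : G y t = 0 by rewrite /G /cutm (negbTE yx).
    by rewrite (eq_mx_integral G0) mx_integral0 addr0 /cutm (negbTE yx).
  have y0 : 0 < y by case/andP: yx.
  have Sy := Sint y; rewrite y0 /= in Sy.
  have GE t : G y t = (v y)^t* *m (if y <= t < x then trS f y (t - y) else 0).
    by rewrite /G /cutm yx; case: ifP => _; rewrite ?mulmx0.
  rewrite (eq_mx_integral GE) (mx_integralMl _ Sy) /cutm yx.
  by rewrite trS_increment// mulmxDr.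
have i3 : mxint (fun y => I (fun t => G y t)).
  rewrite (_ : (fun y => I _) = (fun y => cutm x (fun y => (v y)^t* *m trS h y (x - y)) y
      - cutm x (fun y => (v y)^t* *m trS h y 0) y)).
    exact: mxintB.
  apply/funext => y; apply/esym/eqP; rewrite subr_eq addrC; apply/eqP; exact: (split y).
have swap : I (fun y => I (fun t => G y t)) = I (cutm x (vop N f)).
  rewrite (mx_Fubini_dom (G := G) (b := fun y => D * x * av y)).
  - apply: eq_mx_integral => t; have [tx|tx] := boolP (0 < t < x); last first.
      rewrite cutm_out// -[RHS](mx_integral0 _ _); apply: eq_mx_integral => y.
      rewrite /G; have [yx|yx] := boolP (0 < y < x); last by rewrite cutm_out.
      rewrite cutm_in// ifF//; apply/negP => /andP[yt tx'].
      move/negP: tx; apply; rewrite tx' andbT.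
      by case/andP: yx => y0 _; exact: lt_le_trans y0 yt.
    have tT : 0 < t < T by case/andP: tx => -> tx; exact: lt_trans tx xT'.
    rewrite cutm_in// (vop_char hf tT); apply: ae_mx_integral.
    + apply: mmeas_cutm; apply: mxmeas_if; last exact: mxmeas_cst.
        apply: measurable_and; last exact: measurable_cst.
        by apply: measurable_fun_ler.
      apply: mxmeasM => //.
      apply: (@mxmeas_comp _ _ _ RR _ _ _ (fun z : RR * RR => trS f z.1 z.2)
        (fun y : RR => (y, (t - (y : R)) : RR))); first exact: trS_meas.
      by apply: measurable_fun_pair => //; apply: measurable_funB.
    + apply: mmeas_cutm; apply: mxmeasM => //.
      apply: (@mxmeas_comp _ _ _ RR _ _ _ (fun z : RR * RR => trS f z.1 z.2)
        (fun y : RR => (y, (t - (y : R)) : RR))); first exact: trS_meas.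
      by apply: measurable_fun_pair => //; apply: measurable_funB.
    (* [G] lives on [y <= t] and [vop_char] on [y < t]; the diagonal is a single point for each
       [t]. *)
    + refine (aeS (ae_neq t) _) => y /eqP yt; rewrite /G /cutm.
      case/andP: tx => t0 tx; rewrite tx andbT.
      have -> : (0 < y < t) = (0 < y < x) && (y <= t).
        rewrite [y <= t]le_eqVlt (negbTE yt) /= -andbA; congr (_ && _).
        by apply/idP/idP => [yt'|/andP[]//]; rewrite yt' (lt_trans yt' tx).
      by case: (0 < y < x).
  - apply: mxmeas_if; last exact: mxmeas_cst.
      by apply: measurable_segment; [exact: measurable_cst|exact: measurable_fst].
    apply: mxmeas_if; last exact: mxmeas_cst.
      apply: measurable_and; first by apply: measurable_fun_ler; [exact: measurable_fst|exact: measurable_snd].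
      by apply: measurable_fun_ltr; [exact: measurable_snd|exact: measurable_cst].
    apply: mxmeasM; first exact: mxmeas_comp mw measurable_fst.
    apply: (@mxmeas_comp _ _ _ _ _ _ _ (fun z : RR * RR => trS f z.1 z.2)
      (fun z : RR * RR => (z.1, ((z.2 : R) - z.1) : RR))); first exact: trS_meas.
    apply: measurable_fun_pair; first exact: measurable_fst.
    by apply: measurable_funB; [exact: measurable_snd|exact: measurable_fst].
  - exact: integrableZr'.
  - move=> y; exists (fun t => D * av y * cutr x (fun=> 1) t); split.
    + by apply: integrableZr'; exact: intg_cutr1.
    + move=> t; rewrite /G /cutm /cutr; case: ifP => [/andP[y0 yx]|_]; last first.
        by rewrite nrm0 !mulr_ge0//; case: ifP.
      case: ifP => [/andP[yt tx]|_]; last by rewrite nrm0 !mulr_ge0//; case: ifP.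
      rewrite (lt_le_trans y0 yt) tx mulr1; apply: le_trans (nrmM _ _) _.
      by rewrite nrm_adj mulrC ler_wpM2r.
    + by rewrite RintegralZl ?Rintegral_cutr1//; [rewrite mulrAC|exact: intg_cutr1].
rewrite vopF (vop_char hh xT) (eq_mx_integral split) mx_integralD// swap.
rewrite (_ : I (cutm x (fun y => (v y)^t* *m trS h y 0)) =
    I (cutm x (fun y => (v y)^t* *m I (cutm y (fun t => v t *m (F t + vop N F t)))))); last first.
  apply: eq_mx_integral => y; apply: cutm_congr => yx.
  have yT : 0 < y < T by case/andP: yx => -> yx; exact: lt_trans yx xT'.
  rewrite (trS0 hh yT); apply: (congr1 (mulmx _)); apply: eq_mx_integral => t.
  apply: cutm_congr => ty; apply: (congr1 (mulmx _)); rewrite vopF /h cutm_in//.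
  by case/andP: ty => -> ty; case/andP: yT => _; exact: lt_trans.
rewrite (eq_mx_integral (F := cutm x (fun y => f y + _))
  (G := fun y => cutm x f y + cutm x (vop N f) y)); last first.
  by move=> y; rewrite /cutm; case: ifP => // _; rewrite addr0.
rewrite mx_integralD; [|exact: mxint_cutm|]; last first.
  by apply: mxint_cutm; apply: (mxL2_mxint (T := T)); exact: vop_mxL2.
by rewrite /F addrACA addrA.
Qed.

End Primitive.

End TransmutationIdentity.

(** Here [L] disappears: the bound on [N] and the identity are all that the similarity takes from
    the construction. *)
Lemma transmutation_kernel (R : realType) (T : R) m1 m2 (v : R -> 'M[R[i]]_(m1, m2)) :
  mxL2 T v -> exists c (N : R -> R -> 'M[R[i]]_m2), vkernel T c N /\
  forall q (F0 : 'M[R[i]]_(m2, q)) (f F : R -> 'M[R[i]]_(m2, q)), mxL2 T f ->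
    (forall x, F x = F0 + mx_integral setT (cutm x f)) ->
    forall x, 0 < x < T ->
    F x + vop N F x = F0
      + mx_integral setT (cutm x (fun y => (v y)^t* *m
          mx_integral setT (cutm y (fun t => v t *m (F t + vop N F t)))))
      + mx_integral setT (cutm x (fun y => f y + vop N f y)).
Proof.
move=> hv; have [c [N [L [hN mL NE LE L0]]]] := transmutation_kernel_ex hv.
exists c, N; split=> // q F0 f F hf FE x xT.
have -> : F = (fun x => F0 + mx_integral setT (cutm x f)) by exact/funext.
exact: (transmutation_identity hv hN mL NE LE L0 hf F0 xT).
Qed.

Lemma addrACAC (V : zmodType) (a b c d e : V) :
  (a + b) + (c + (d + e)) = a + ((c + d) + (b + e)).
Proof.
rewrite -!addrA; apply: (congr1 (+%R a)).
by rewrite [LHS]addrCA; apply: (congr1 (+%R c)); rewrite [LHS]addrCA.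
Qed.

(** * Integration by parts and the Dirac system *)

Section IntegrationByParts.
Context {R : realType}.
Local Notation C := R[i].
Local Notation mu := (@lebesgue_measure R).
Local Notation RR := (measurableTypeR R).
Local Notation mmeas F := (@mxmeas R _ RR _ _ F).
Local Notation intg b := (mu.-integrable setT (EFin \o b)).
Local Notation mxint := (mx_integrable setT).
Local Notation I := (mx_integral setT).

Lemma mxint_mkcond p q T (F : R -> 'M[C]_(p, q)) :
  mx_integrable `]0, T[ F -> mxint (cutm T F).
Proof.
move=> Fi i k; have [F1 F2] := Fi i k; split.
  have := (@integrable_mkcond _ RR R mu _ _ (measurable_itv _)).1 F1; congr integrable.
  apply/funext => t; rewrite patchE mem_itvoo /cutm /=.
  by case: ifP => //; rewrite mxE.
have := (@integrable_mkcond _ RR R mu _ _ (measurable_itv _)).1 F2; congr integrable.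
apply/funext => t; rewrite patchE mem_itvoo /cutm /=.
by case: ifP => //; rewrite mxE.
Qed.

Lemma mx_integral_adj p q (F : R -> 'M[C]_(p, q)) : mxint F ->
  mxint (fun t => (F t)^t*) /\ I (fun t => (F t)^t*) = (I F)^t*.
Proof.
move=> Fi; split.
  apply: (mxint_dom (b := fun t => nrm (F t))).
  - by apply: mxmeas_adj; exact: mxint_meas.
  - exact: mxint_nrm.
  - by move=> t; rewrite nrm_adj.
apply/matrixP => i k; rewrite !mxE /cintegral.
have [_ F2] := Fi k i.
have -> : (fun t => complex.Re ((F t)^t* i k)) = (fun t => complex.Re (F t k i)).
  by apply/funext => t; rewrite !mxE; case: (F t k i).
have -> : (fun t => complex.Im ((F t)^t* i k)) = (fun t => -1 * complex.Im (F t k i)).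
  by apply/funext => t; rewrite !mxE mulN1r; case: (F t k i).
by rewrite RintegralZl// mulN1r.
Qed.

(** An absolutely continuous function given by its initial value and its derivative. When [a] is cut
    off at [T], it extends as a constant beyond [T]. *)
Definition prim p q (A0 : 'M[C]_(p, q)) (a : R -> 'M[C]_(p, q)) (x : R) := A0 + I (cutm x a).

Lemma prim_meas p q (A0 : 'M[C]_(p, q)) a : mmeas a -> mmeas (prim A0 a).
Proof.
move=> ma; apply: mxmeasD; first exact: mxmeas_cst.
apply: (@mxmeas_integral _ _ RR _ _
  (fun z : RR * RR => if 0 < (z.2 : R) < z.1 then a z.2 else 0)).
apply: mxmeas_if; last exact: mxmeas_cst.
  by apply: measurable_segment; [exact: measurable_fst|exact: measurable_snd].
exact: mxmeas_comp ma measurable_snd.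
Qed.

Lemma prim_bound p q (A0 : 'M[C]_(p, q)) a x : mxint a ->
  nrm (prim A0 a x) <= nrm A0 + \int[mu]_t nrm (a t).
Proof.
move=> ai; apply: le_trans (nrmD _ _) _; rewrite lerD2l.
apply: nrm_mx_integral.
- by apply: mmeas_cutm; exact: mxint_meas.
- exact: mxint_nrm.
- by move=> y; rewrite nrm_cutm /cutr; case: ifP => // _; exact: nrm_ge0.
Qed.

Lemma prim_mxintM p q r (A0 : 'M[C]_(p, q)) a (b : R -> 'M[C]_(q, r)) :
  mxint a -> mxint b -> mxint (fun t => prim A0 a t *m b t).
Proof.
move=> ai bi.
apply: (mxint_dom (b := fun t => (nrm A0 + \int[mu]_t nrm (a t)) * nrm (b t))).
- by apply: mxmeasM; [exact: prim_meas (mxint_meas ai)|exact: mxint_meas].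
- by apply: integrableZr'; exact: mxint_nrm.
- move=> t; apply: le_trans (nrmM _ _) _.
  by apply: ler_wpM2r; [exact: nrm_ge0|exact: prim_bound].
Qed.

Lemma mxintM_prim p q r (a : R -> 'M[C]_(p, q)) (B0 : 'M[C]_(q, r)) b :
  mxint a -> mxint b -> mxint (fun t => a t *m prim B0 b t).
Proof.
move=> ai bi.
apply: (mxint_dom (b := fun t => (nrm B0 + \int[mu]_t nrm (b t)) * nrm (a t))).
- by apply: mxmeasM; [exact: mxint_meas|exact: prim_meas (mxint_meas bi)].
- by apply: integrableZr'; exact: mxint_nrm.
- move=> t; apply: le_trans (nrmM _ _) _; rewrite mulrC.
  by apply: ler_wpM2r; [exact: nrm_ge0|exact: prim_bound].
Qed.

Lemma ae_cutm_integral p q (f g : R -> 'M[C]_(p, q)) x : mmeas f -> mmeas g ->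
  {ae mu, forall t, f t = g t} -> I (cutm x f) = I (cutm x g).
Proof.
move=> mf mg fg; apply: ae_mx_integral; [exact: mmeas_cutm|exact: mmeas_cutm|].
by refine (aeS fg _) => t h; apply: cutm_congr => _.
Qed.

(* Fubini's theorem on the square ]0, x[^2 cut along its diagonal. *)
Lemma prodmx_integral p q r (a : R -> 'M[C]_(p, q)) (b : R -> 'M[C]_(q, r)) x :
  mxint a -> mxint b ->
  I (cutm x a) *m I (cutm x b) =
    I (cutm x (fun t => a t *m prim 0 b t)) + I (cutm x (fun t => prim 0 a t *m b t)).
Proof.
move=> ai bi.
have ma := mxint_meas ai; have mb := mxint_meas bi.
have na := mxint_nrm ai; have nb := mxint_nrm bi.
pose G (t s : R) := cutm x (fun t => if t <= s < x then a t *m b s else 0) t.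
have mseg (y : R) : measurable_fun [set: RR] (fun t : RR => y <= (t : R) < x).
  apply: measurable_and; first by apply: measurable_fun_ler.
  by apply: measurable_fun_ltr.
have tail (t : R) : mxint (fun s => if t <= s < x then b s else 0).
  apply: (mxint_dom (b := fun s => nrm (b s))) => //.
  - by apply: mxmeas_if; [exact: mseg|exact: mb|exact: mxmeas_cst].
  - by move=> s; case: ifP => _; rewrite ?nrm0 ?nrm_ge0.
have split t : cutm x a t *m I (cutm x b) =
    cutm x (fun t => a t *m prim 0 b t) t + I (fun s => G t s).
  have [tx|tx] := boolP (0 < t < x); last first.
    have G0 s : G t s = 0 by rewrite /G /cutm (negbTE tx).
    by rewrite (eq_mx_integral G0) mx_integral0 addr0 /cutm (negbTE tx) mul0mx.
  have GE s : G t s = a t *m (if t <= s < x then b s else 0).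
    by rewrite /G /cutm tx; case: ifP => _; rewrite ?mulmx0.
  rewrite (eq_mx_integral GE) (mx_integralMl _ (tail t)) {1 3}/cutm tx -mulmxDr.
  rewrite /prim add0r -mx_integralD//; last exact: mxint_cutm.
  congr (_ *m _); apply: eq_mx_integral => s; case/andP: tx => t0 tx.
  rewrite /cutm; have [st|ts] := ltP s t.
    by rewrite (lt_trans st tx) addr0.
  by rewrite (lt_le_trans t0 ts) /= add0r.
have i1 := mxint_cutm x (mxintM_prim 0 ai bi).
have i2 := mxint_cutm x ai.
have i3 : mxint (fun t => I (fun s => G t s)).
  rewrite (_ : (fun t => I _) = (fun t => cutm x a t *m I (cutm x b) -
      cutm x (fun t => a t *m prim 0 b t) t)).
    by apply: mxintB => //; exact: mxintMr.
  apply/funext => t; apply/esym/eqP; rewrite subr_eq addrC; apply/eqP; exact: (split t).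
rewrite -mx_integralMr// (eq_mx_integral split) mx_integralD//; congr (_ + _).
rewrite (mx_Fubini_dom (G := G) (b := fun t => (\int[mu]_s nrm (b s)) * nrm (a t))).
- apply: eq_mx_integral => s; have [sx|sx] := boolP (0 < s < x); last first.
    rewrite cutm_out// -[RHS](mx_integral0 _ _); apply: eq_mx_integral => t.
    rewrite /G /cutm; case: ifP => // /andP[t0 tx]; rewrite ifF//.
    apply/negP => /andP[ts sx']; move/negP: sx; apply; rewrite sx' andbT.
    exact: lt_le_trans t0 ts.
  rewrite cutm_in// /prim add0r -mx_integralMr; last exact: mxint_cutm.
  apply: ae_mx_integral.
  + apply: mmeas_cutm; apply: mxmeas_if; last exact: mxmeas_cst.
      apply: measurable_and; last exact: measurable_cst.
      by apply: measurable_fun_ler.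
    by apply: mxmeasM => //; exact: mxmeas_cst.
  + by apply: mxmeasM; [exact: mmeas_cutm|exact: mxmeas_cst].
  + refine (aeS (ae_neq s) _) => t /eqP ts; rewrite /G /cutm.
    case/andP: sx => s0 sx; rewrite sx andbT.
    have -> : (0 < t < s) = (0 < t < x) && (t <= s).
      rewrite [t <= s]le_eqVlt (negbTE ts) /= -andbA; congr (_ && _).
      by apply/idP/idP => [ts'|/andP[]//]; rewrite ts' (lt_trans ts' sx).
    by case: (0 < t < x); case: (t <= s); rewrite /= ?mul0mx.
- apply: mxmeas_if; last exact: mxmeas_cst.
    by apply: measurable_segment; [exact: measurable_cst|exact: measurable_fst].
  apply: mxmeas_if; last exact: mxmeas_cst.
    apply: measurable_and; first by apply: measurable_fun_ler; [exact: measurable_fst|exact: measurable_snd].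
    by apply: measurable_fun_ltr; [exact: measurable_snd|exact: measurable_cst].
  by apply: mxmeasM; [exact: mxmeas_comp ma measurable_fst|exact: mxmeas_comp mb measurable_snd].
- exact: integrableZr'.
- move=> t; exists (fun s => nrm (a t) * nrm (b s)); split.
  + exact: integrableZr'.
  + move=> s; rewrite /G /cutm; case: ifP => _; last by rewrite nrm0 mulr_ge0 ?nrm_ge0.
    by case: ifP => _; [exact: nrmM|rewrite nrm0 mulr_ge0 ?nrm_ge0].
  + by rewrite RintegralZl// mulrC.
Qed.

(** The Leibniz rule in integrated form: the initial values are split off by bilinearity, which
    leaves [prodmx_integral]. *)
Lemma prim_mul p q r (A0 : 'M[C]_(p, q)) a (B0 : 'M[C]_(q, r)) b x :
  mxint a -> mxint b ->
  prim A0 a x *m prim B0 b x =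
    prim (A0 *m B0) (fun t => a t *m prim B0 b t + prim A0 a t *m b t) x.
Proof.
move=> ai bi.
have h1 : I (cutm x (fun t => a t *m prim B0 b t)) =
    I (cutm x a) *m B0 + I (cutm x (fun t => a t *m prim 0 b t)).
  rewrite -mx_integralMr; last exact: mxint_cutm.
  rewrite -mx_integralD; last exact: mxint_cutm (mxintM_prim _ ai bi).
    apply: eq_mx_integral => t; rewrite /cutm; case: ifP => _; last by rewrite mul0mx addr0.
    by rewrite -mulmxDr /prim add0r.
  by apply: mxintMr; exact: mxint_cutm.
have h2 : I (cutm x (fun t => prim A0 a t *m b t)) =
    A0 *m I (cutm x b) + I (cutm x (fun t => prim 0 a t *m b t)).
  rewrite -mx_integralMl; last exact: mxint_cutm.
  rewrite -mx_integralD; last exact: mxint_cutm (prim_mxintM _ ai bi).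
    apply: eq_mx_integral => t; rewrite /cutm; case: ifP => _; last by rewrite mulmx0 addr0.
    by rewrite -mulmxDl /prim add0r.
  by apply: mxintMl; exact: mxint_cutm.
have -> : prim (A0 *m B0) (fun t => a t *m prim B0 b t + prim A0 a t *m b t) x =
    A0 *m B0 + (I (cutm x (fun t => a t *m prim B0 b t)) +
      I (cutm x (fun t => prim A0 a t *m b t))).
  congr (_ + _); rewrite -mx_integralD.
  - by apply: eq_mx_integral => t; rewrite /cutm; case: ifP => // _; rewrite addr0.
  - exact: mxint_cutm (mxintM_prim _ ai bi).
  - exact: mxint_cutm (prim_mxintM _ ai bi).
rewrite h1 h2 {1 2}/prim mulmxDl !mulmxDr prodmx_integral//.
exact: addrACAC.
Qed.

End IntegrationByParts.

Lemma cutmD (R : realType) p q x (F G : R -> 'M[R[i]]_(p, q)) t :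
  cutm x (fun t => F t + G t) t = cutm x F t + cutm x G t.
Proof. by rewrite /cutm; case: ifP => // _; rewrite addr0. Qed.

Lemma cutmZ (R : realType) p q x a (F : R -> 'M[R[i]]_(p, q)) t :
  cutm x (fun t => a *: F t) t = a *: cutm x F t.
Proof. by rewrite /cutm; case: ifP => // _; rewrite scaler0. Qed.

(** * The Dirac system at zero spectral parameter and the equation for [K] *)

Section DiracSystem.
Context {R : realType}.
Local Notation C := R[i].
Local Notation mu := (@lebesgue_measure R).
Local Notation RR := (measurableTypeR R).
Local Notation mmeas F := (@mxmeas R _ RR _ _ F).
Local Notation intg b := (mu.-integrable setT (EFin \o b)).
Local Notation mxint := (mx_integrable setT).
Local Notation I := (mx_integral setT).

Lemma adjmxM p q r (A : 'M[C]_(p, q)) (B : 'M[C]_(q, r)) :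
  (A *m B)^t* = B^t* *m A^t*.
Proof. by rewrite trmx_mul map_mxM. Qed.

Lemma adjmxZ p q a (A : 'M[C]_(p, q)) : (a *: A)^t* = Num.conj a *: A^t*.
Proof. by rewrite linearZ /= map_mxZ. Qed.

Lemma adjmxK p q (A : 'M[C]_(p, q)) : (A^t*)^t* = A.
Proof. by apply/matrixP => i k; rewrite !mxE conjCK. Qed.

Lemma adjmx1 n : (1%:M : 'M[C]_n)^t* = 1%:M.
Proof. by rewrite trmx1 map_mx1. Qed.

Lemma conj_i : Num.conj ('i%C : C) = - 'i%C.
Proof. by apply/eqP; rewrite eq_complex /= oppr0 !eqxx. Qed.

Lemma mul_ii : 'i%C * 'i%C = -1 :> C.
Proof. by rewrite -expr2 sqr_i. Qed.

Definition Bop m1 m2 (v : R -> 'M[C]_(m1, m2)) q (g : R -> 'M[C]_(m2, q)) (x : R) :=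
  I (cutm x (fun y => (v y)^t* *m I (cutm y (fun t => v t *m g t)))).

Context {m1 m2 : nat}.
Local Notation J := (@jmx R m1 m2).
Local Notation P1 := (row_mx 1%:M 0 : 'M[C]_(m1, m1 + m2)).
Local Notation P2 := (row_mx 0 1%:M : 'M[C]_(m2, m1 + m2)).

Lemma jmx_sq : J *m J = 1%:M.
Proof.
rewrite /jmx mulmx_block !mulmx0 !mul0mx !addr0 !add0r mul1mx mulmxN mulmx1 opprK.
by rewrite -scalar_mx_block.
Qed.

Lemma jmx_Vmx (v : R -> 'M[C]_(m1, m2)) t :
  J *m Vmx v t = block_mx 0 (v t) (- (v t)^t*) 0.
Proof.
by rewrite /jmx /Vmx mulmx_block !mulmx0 !mul0mx !addr0 !add0r mul1mx mulNmx mul1mx.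
Qed.

Lemma P1_jmx_Vmx (v : R -> 'M[C]_(m1, m2)) t : P1 *m (J *m Vmx v t) = v t *m P2.
Proof.
rewrite jmx_Vmx mul_row_block mul_mx_row !mulmx0 !mul0mx !addr0 mul1mx mulmx1.
by [].
Qed.

Lemma P2_jmx_Vmx (v : R -> 'M[C]_(m1, m2)) t :
  P2 *m (J *m Vmx v t) = - ((v t)^t* *m P1).
Proof.
rewrite jmx_Vmx mul_row_block mul_mx_row !mulmx0 !mul0mx !addr0 !add0r mul1mx mulmx1.
by rewrite opp_row_mx oppr0.
Qed.

Lemma jmx_Vmx_adj (v : R -> 'M[C]_(m1, m2)) t :
  (J *m Vmx v t)^t* *m J = J *m (J *m Vmx v t).
Proof.
rewrite mulmxA jmx_sq mul1mx jmx_Vmx tr_block_mx map_block_mx !trmx0 !map_mx0.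
rewrite /jmx mulmx_block !mulmx0 !mul0mx !addr0 !add0r mulmx1 mulmxN mulmx1.
by rewrite linearN /= map_mxN opprK adjmxK.
Qed.

Context (T : R) (T0 : 0 < T) (v : R -> 'M[C]_(m1, m2)) (u : R -> C -> 'M[C]_(m1 + m2)).
Context (hv : sq_summable T v) (hu : fundamental_solution T v u).

(** At [z = 0] the term [z j] drops out. Cutting the derivative off at [T] extends [u(., 0)] from
    [[0, T]] to a bounded function on the whole line. *)
Lemma fundamental_solution0 : exists w : R -> 'M[C]_(m1 + m2),
  [/\ mxint w,
      forall x, 0 <= x <= T -> u x 0 = prim 1%:M w x &
      {ae mu, forall t, w t =
         if 0 < t < T then 'i%C *: ((J *m Vmx v t) *m prim 1%:M w t) else 0}].
Proof.
have [u0 [w [wi uE wE]]] := hu 0.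
exists (cutm T w).
have UE x : 0 <= x <= T -> u x 0 = prim 1%:M (cutm T w) x.
  move=> xT; rewrite uE// u0 /antiderivative mx_integral_cutm; apply: (congr1 (+%R _)).
  apply: eq_mx_integral => t; apply: cutm_congr => /andP[t0 tx].
  by rewrite cutm_in// t0 (lt_le_trans tx)//; case/andP: xT.
split => //; first exact: mxint_mkcond.
refine (aeS wE _) => t h; rewrite /cutm; case: ifP => // tT.
rewrite h ?scale0r ?add0r; last by rewrite /= in_itv.
by rewrite UE//; case/andP: tT => t0 tT; rewrite !ltW.
Qed.

(** [b] and [g] are the block rows of [u(., 0)], and [j V] couples each to the other through [v] and
    [v^*]. The last two relations are blocks of [U j U^* = j]. *)
Lemma gamma_beta : exists (b : R -> 'M[C]_(m1, m1 + m2)) (g : R -> 'M[C]_(m2, m1 + m2)),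
  [/\ [/\ mmeas b, mmeas g & exists B : R, forall x, nrm (b x) <= B /\ nrm (g x) <= B],
      forall x, 0 <= x <= T -> gammamx u x = g x,
      forall x, b x = prim P1 (fun t => 'i%C *: (cutm T v t *m g t)) x,
      forall x, g x = prim P2 (fun t => - 'i%C *: ((cutm T v t)^t* *m b t)) x &
      forall x, 0 <= x <= T -> g x *m J *m (g x)^t* = - 1%:M /\ b x *m J *m (g x)^t* = 0].
Proof.
have [w [wi uE wE]] := fundamental_solution0.
have v0L := sq_summable_mxL2 hv.
have [mv0 _ _] := v0L.
set U := prim 1%:M w in uE wE *.
have mU : mmeas U by exact: prim_meas (mxint_meas wi).
have [D UD] : exists D : R, forall x, nrm (U x) <= D.
  by eexists => x; exact: prim_bound.
have mw := mxint_meas wi.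
have mPU p (P : 'M[C]_(p, _)) : mmeas (fun x => P *m U x).
  by apply: mxmeasM => //; exact: mxmeas_cst.
have PU p (P : 'M[C]_(p, _)) x : P *m U x = prim P (fun t => P *m w t) x.
  rewrite /U /prim mulmxDr mulmx1 -mx_integralMl; last exact: mxint_cutm.
  apply: (congr1 (+%R _)); apply: eq_mx_integral => t; rewrite /cutm.
  by case: ifP => // _; rewrite mulmx0.
(* The derivative of [U^* j U] vanishes almost everywhere: [(j V)^* j = j (j V)], and conjugation
   changes the sign of [i]. *)
have UjU x : (U x)^t* *m J *m U x = J.
  have wadj := (mx_integral_adj wi).1.
  have ai : mxint (fun t => (w t)^t* *m J) by exact: mxintMr.
  have AE y : (U y)^t* *m J = prim J (fun t => (w t)^t* *m J) y.
    have cw := mx_integral_adj (mxint_cutm y wi).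
    rewrite /U /prim linearD /= map_mxD adjmx1 mulmxDl mul1mx.
    apply: (congr1 (+%R _)); rewrite -(cw).2 -mx_integralMr; last exact: cw.1.
    apply: eq_mx_integral => t; rewrite /cutm; case: ifP => // _.
    by rewrite trmx0 map_mx0 mul0mx.
  rewrite AE prim_mul// mulmx1 /prim.
  rewrite (ae_cutm_integral (g := fun=> 0)).
  - rewrite (eq_mx_integral (G := fun=> 0)) ?mx_integral0 ?addr0//.
    by move=> t; rewrite /cutm; case: ifP.
  - apply: mxmeasD; apply: mxmeasM.
    + by apply: mxmeasM; [exact: mxmeas_adj|exact: mxmeas_cst].
    + exact: mU.
    + exact: prim_meas (mxint_meas ai).
    + exact: mw.
  - exact: mxmeas_cst.
  - refine (aeS wE _) => t; rewrite -/(prim J (fun t => (w t)^t* *m J) t) -AE -/(U t).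
    move=> ->; case: ifP => _; last by rewrite trmx0 map_mx0 !mul0mx mulmx0 addr0.
    rewrite adjmxZ adjmxM conj_i -!scalemxAl -scalemxAr scaleNr.
    have -> : (U t)^t* *m (J *m Vmx v t)^t* *m J *m U t =
        (U t)^t* *m J *m (J *m Vmx v t *m U t).
      by rewrite -(mulmxA ((U t)^t*)) jmx_Vmx_adj !mulmxA.
    by rewrite addNr.
(* [UjU] makes [j U^* j] a left inverse of the square matrix [U], hence also a right inverse. *)
have UjUadj x : U x *m J *m (U x)^t* = J.
  have h1 : (J *m (U x)^t* *m J) *m U x = 1%:M.
    by rewrite -!mulmxA (mulmxA (_^t*)) UjU jmx_sq.
  have h2 := mulmx1C h1.
  by rewrite -[RHS]mul1mx -h2 -!mulmxA jmx_sq mulmx1.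
exists (fun x => P1 *m U x), (fun x => P2 *m U x); split.
- split; [exact: mPU|exact: mPU|].
  exists (nrm P1 * D + nrm P2 * D) => x.
  have D0 : 0 <= D by exact: le_trans (nrm_ge0 _) (UD 0).
  split; apply: le_trans (nrmM _ _) _.
    apply: le_trans (ler_wpM2l (nrm_ge0 _) (UD x)) _.
    by rewrite lerDl mulr_ge0 ?nrm_ge0.
  apply: le_trans (ler_wpM2l (nrm_ge0 _) (UD x)) _.
  by rewrite lerDr mulr_ge0 ?nrm_ge0.
- by move=> x xT; rewrite /gammamx uE.
- move=> x; rewrite PU /prim; apply: (congr1 (+%R _)); apply: ae_cutm_integral.
  + by apply: mxmeasM => //; exact: mxmeas_cst.
  + by apply: mxmeasZ; apply: mxmeasM.
  + refine (aeS wE _) => t ->; rewrite /cutm; case: ifP => _; last first.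
      by rewrite mul0mx mulmx0 scaler0.
    by rewrite -scalemxAr !mulmxA -(mulmxA P1) P1_jmx_Vmx -!mulmxA.
- move=> x; rewrite PU /prim; apply: (congr1 (+%R _)); apply: ae_cutm_integral.
  + by apply: mxmeasM => //; exact: mxmeas_cst.
  + by apply: mxmeasZ; apply: mxmeasM => //; exact: mxmeas_adj.
  + refine (aeS wE _) => t ->; rewrite /cutm; case: ifP => _; last first.
      by rewrite mulmx0 trmx0 map_mx0 mul0mx scaler0.
    rewrite -scalemxAr !mulmxA -(mulmxA P2) P2_jmx_Vmx mulNmx scalerN scaleNr.
    by rewrite -!mulmxA.
- move=> x _; have E p (P : 'M[C]_(p, m1 + m2)) :
      (P *m U x) *m J *m (P2 *m U x)^t* = P *m J *m P2^t*.
    by rewrite adjmxM -(mulmxA P) -(mulmxA P) (mulmxA (U x *m J)) UjUadj mulmxA.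
  have P2a : P2^t* = col_mx 0 1%:M by rewrite tr_row_mx map_col_mx trmx0 map_mx0 adjmx1.
  rewrite !E P2a /jmx !mul_row_block !mul_row_col.
  by rewrite !(mulmx0, mul0mx, addr0, add0r, mul1mx, mulmx1).
Qed.

Section Kernel.
Context (b : R -> 'M[C]_(m1, m1 + m2)) (g : R -> 'M[C]_(m2, m1 + m2)) (B : R).
Context (mb : mmeas b) (mg : mmeas g) (bB : forall x, nrm (b x) <= B /\ nrm (g x) <= B).
Local Notation v0 := (cutm T v).
Context (bE : forall x, b x = prim P1 (fun t => 'i%C *: (v0 t *m g t)) x).
Context (gE : forall x, g x = prim P2 (fun t => - 'i%C *: ((v0 t)^t* *m b t)) x).
Context (gjg : forall x, 0 <= x <= T ->
  g x *m J *m (g x)^t* = - 1%:M /\ b x *m J *m (g x)^t* = 0).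

Let v0L : mxL2 T v0. Proof. exact: sq_summable_mxL2. Qed.

Lemma mxintM_bounded p q r (F : R -> 'M[C]_(p, q)) (G : R -> 'M[C]_(q, r)) (D : R) :
  mxint F -> mmeas G -> (forall x, nrm (G x) <= D) -> mxint (fun t => F t *m G t).
Proof.
move=> Fi mG GD; apply: (mxint_dom (b := fun t => D * nrm (F t))).
- by apply: mxmeasM => //; exact: mxint_meas.
- by apply: integrableZr'; exact: mxint_nrm.
- move=> t; apply: le_trans (nrmM _ _) _; rewrite mulrC.
  by apply: ler_wpM2r; [exact: nrm_ge0|exact: GD].
Qed.

Let v0gi : mxint (fun t => 'i%C *: (v0 t *m g t)).
Proof.
apply: mxintZ; apply: (mxintM_bounded (mxL2_mxint v0L) mg (D := B)) => x.
by case: (bB x).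
Qed.

Let v0bi : mxint (fun t => - 'i%C *: ((v0 t)^t* *m b t)).
Proof.
apply: mxintZ; apply: (mxintM_bounded (mxL2_mxint (mxL2_adj v0L)) mb (D := B)) => x.
by case: (bB x).
Qed.

(** On vectors [col_mx 0 e] the initial value of [b] vanishes, so [b] becomes a pure integral of
    [v g]. Substituting it into the equation of [g] gives [Bop], with the factor [(-i) i = 1]. *)
Lemma gamma_col q (e : 'M[C]_(m2, q)) x :
  g x *m col_mx 0 e = e + Bop v0 (fun t => g t *m col_mx 0 e) x.
Proof.
have col p (A0 : 'M[C]_(p, m1 + m2)) a y : mxint a ->
    prim A0 a y *m col_mx 0 e = prim (A0 *m col_mx 0 e) (fun t => a t *m col_mx 0 e) y.
  move=> ai; rewrite /prim mulmxDl -mx_integralMr; last exact: mxint_cutm.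
  apply: (congr1 (+%R _)); apply: eq_mx_integral => t.
  by rewrite /cutm; case: ifP => // _; rewrite mul0mx.
rewrite {1}gE col// /prim mul_row_col mul0mx add0r mul1mx; apply: (congr1 (+%R e)).
apply: eq_mx_integral => y; apply: cutm_congr => _.
rewrite -scalemxAl -mulmxA bE col// /prim mul_row_col mulmx0 mul0mx addr0 add0r.
rewrite (eq_mx_integral (G := fun t => 'i%C *: cutm y (fun t => v0 t *m (g t *m col_mx 0 e)) t)).
  rewrite mx_integralZ; first by rewrite -scalemxAr scalerA mulNr mul_ii opprK scale1r.
  apply: mxint_cutm; under eq_fun do rewrite mulmxA; apply: mxintMr.
  by apply: (mxintM_bounded (mxL2_mxint v0L) mg (D := B)) => z; case: (bB z).
move=> t; rewrite [LHS]/cutm [in RHS]/cutm; case: ifP => _; last by rewrite scaler0.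
by rewrite -scalemxAl mulmxA.
Qed.

Definition kerK (x t : R) : 'M[C]_m2 :=
  if (0 < t < x) && (x < T) then 'i%C *: (g x *m J *m (g t)^t*) else 0.

Lemma kerK_vkernel : vkernel T (absC 'i%C * (B * nrm J * B)) kerK.
Proof.
have B0 : 0 <= B by case: (bB 0) => h _; exact: le_trans (nrm_ge0 _) h.
split.
- apply: mxmeas_if; last exact: mxmeas_cst.
    by apply: measurable_triangle; [exact: measurable_fst|exact: measurable_snd].
  apply: mxmeasZ; apply: mxmeasM.
    by apply: mxmeasM; [exact: mxmeas_comp mg measurable_fst|exact: mxmeas_cst].
  by apply: mxmeas_adj; exact: mxmeas_comp mg measurable_snd.
- move=> x t; rewrite /kerK; case: ifP => _; last first.
    by rewrite nrm0 !mulr_ge0 ?absC_ge0 ?nrm_ge0.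
  apply: le_trans (nrmZ _ _) _; apply: ler_wpM2l; first exact: absC_ge0.
  apply: le_trans (nrmM _ _) _; apply: ler_pM; rewrite ?nrm_ge0 ?nrm_adj//.
    apply: le_trans (nrmM _ _) _; apply: ler_wpM2r; first exact: nrm_ge0.
    by case: (bB x).
  by case: (bB t).
- by move=> x t /negbTE nT; rewrite /kerK nT.
Qed.

Section Apply.
Context q (f : R -> 'M[C]_(m2, q)) (hf : mxL2 T f).

Let gf := (fun t => (g t)^t* *m f t).

Let gfi : mxint gf.
Proof.
apply: (mxL2_mxint (T := T)); apply: (mxL2Ml_bounded (c := B)) => //.
  exact: mxmeas_adj.
by move=> t; rewrite nrm_adj; case: (bB t).
Qed.

Let jgf := (fun t => J *m gf t).
Let jgfi : mxint jgf. Proof. exact: mxintMl. Qed.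

Lemma vop_kerK x : 0 < x < T -> vop kerK f x = 'i%C *: (g x *m prim 0 jgf x).
Proof.
move=> /andP[x0 xT]; rewrite /prim add0r -mx_integralMl; last exact: mxint_cutm.
rewrite -mx_integralZ; last by apply: mxintMl; exact: mxint_cutm.
apply: eq_mx_integral => t; rewrite /kerK /cutm xT andbT; case: ifP => _.
  by rewrite -scalemxAl /jgf /gf !mulmxA.
by rewrite mul0mx mulmx0 scaler0.
Qed.

(** In the Leibniz rule the term [b j g^* f] is zero, and the derivative [i v g] of [b], multiplied
    by the integral of [j g^* f], is [v] times [K f]. *)
Lemma beta_jgf x : x <= T -> b x *m prim 0 jgf x =
  I (cutm x (fun t => v0 t *m vop kerK f t)).
Proof.
move=> xT; rewrite bE prim_mul// /prim mulmx0 add0r; apply: eq_mx_integral => t.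
apply: cutm_congr => /andP[t0 tx]; rewrite -/(prim 0 jgf t) -/(prim P1 _ t) -bE.
have tT : 0 < t < T by rewrite t0 (lt_le_trans tx xT).
rewrite /jgf /gf !mulmxA (gjg _).2; last by case/andP: tT => /ltW -> /ltW ->.
by rewrite mul0mx addr0 vop_kerK// -scalemxAr -scalemxAl !mulmxA.
Qed.

(** The Leibniz rule for [g] times the integral of [j g^* f]: the relation [g j g^* = -1] produces
    [- i f], while the derivative of [g] brings in [b] times the same integral, which [beta_jgf]
    evaluates. *)
Lemma vop_kerK_eq x : 0 < x < T ->
  vop kerK f x = Bop v0 (vop kerK f) x - 'i%C *: I (cutm x f).
Proof.
move=> xT; rewrite vop_kerK// {1}gE prim_mul// /prim mulmx0 add0r.
rewrite -scaleNr -!(mx_integralZ _ (mxint_cutm x (mxL2_mxint hf))).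
have Bi : mxint (cutm x (fun y => (v0 y)^t* *m I (cutm y (fun t => v0 t *m vop kerK f t)))).
  have vi : mxint (fun t => v0 t *m vop kerK f t).
    by apply: mxL2_mxintM v0L _; exact: (vop_mxL2 kerK_vkernel (mxL2_mxint hf)).
  have := mxint_cutm x (mxintM_prim 0 (mxL2_mxint (mxL2_adj v0L)) vi).
  by rewrite /prim; under [X in cutm _ X]eq_fun do rewrite add0r.
rewrite -mx_integralD//; last by apply: mxintZ; apply: mxint_cutm; exact: mxL2_mxint hf.
rewrite -mx_integralZ; last first.
  apply: mxint_cutm; apply: mxintD; first exact: mxintM_prim.
  by have := prim_mxintM P2 v0bi jgfi; rewrite /prim.
apply: eq_mx_integral => t; rewrite -!cutmZ -cutmD; apply: cutm_congr => /andP[t0 tx].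
have tT : 0 < t < T by rewrite t0; case/andP: xT => _; exact: lt_trans.
rewrite -/(prim 0 jgf t) -/(prim P2 _ t) -gE {2}/jgf /gf !mulmxA (gjg _).1; last first.
  by case/andP: tT => /ltW -> /ltW ->.
rewrite mulNmx mul1mx scalerDr scalerN !scaleNr; apply: (congr1 (fun z => z - 'i%C *: f t)).
rewrite mulNmx scalerN -scalemxAl scalerA mul_ii scaleN1r opprK -mulmxA beta_jgf//.
by case/andP: tT => _ /ltW.
Qed.

End Apply.

End Kernel.

End DiracSystem.

(** * The similarity *)

Section UniqueSolvability.
Context {R : realType}.
Local Notation C := R[i].
Local Notation mu := (@lebesgue_measure R).
Local Notation RR := (measurableTypeR R).
Local Notation mmeas F := (@mxmeas R _ RR _ _ F).
Local Notation intg b := (mu.-integrable setT (EFin \o b)).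
Local Notation mxint := (mx_integrable setT).
Local Notation I := (mx_integral setT).

Lemma ae_forall_ord n (P : 'I_n -> R -> Prop) :
  (forall k, {ae mu, forall t, P k t}) -> {ae mu, forall t, forall k, P k t}.
Proof.
move=> h; have FF : Filter (almost_everywhere mu).
  exact: (@ae_filter_ringOfSetsType _ RR R mu).
exact: (@filter_forall _ _ P).
Qed.

Lemma mxL2Mr_bounded p q r T (F : R -> 'M[C]_(p, q)) (H : R -> 'M[C]_(q, r)) (c : R) :
  mmeas H -> (forall t, nrm (H t) <= c) -> mxL2 T F ->
  mxL2 T (fun t => F t *m H t).
Proof.
move=> mH Hc FL.
have Hc' t : nrm ((H t)^t*) <= c by rewrite nrm_adj.
have /mxL2_adj := mxL2Ml_bounded (mxmeas_adj mH) Hc' (mxL2_adj FL).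
by under eq_fun do rewrite -adjmxM adjmxK.
Qed.

Lemma nrm_cutmB p q T (f g : R -> 'M[C]_(p, q)) (y b : R) : 0 <= b ->
  nrm (f y - g y) <= b -> nrm (cutm T f y - cutm T g y) <= b.
Proof. by move=> b0 fg; rewrite /cutm; case: ifP => // _; rewrite subr0 nrm0. Qed.

(** The class of functions in which [h = a + B h] has at most one solution; only values on []0, T[]
    count. *)
Definition bmeas p q T (g : R -> 'M[C]_(p, q)) :=
  mmeas (cutm T g) /\ exists b : R, forall x, nrm (cutm T g x) <= b.

Lemma cutm_cutm p q T (g : R -> 'M[C]_(p, q)) : cutm T (cutm T g) = cutm T g.
Proof. by apply/funext => x; rewrite /cutm; case: (0 < x < T). Qed.

Lemma bmeas_L2 p q T (g : R -> 'M[C]_(p, q)) : bmeas T g -> mxL2 T (cutm T g).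
Proof. by move=> [mg [b gb]]; rewrite -cutm_cutm; apply: (mxL2_bounded (c := b)). Qed.

Lemma bmeas_of p q T (g : R -> 'M[C]_(p, q)) (b : R) : mmeas g ->
  (forall x, nrm (g x) <= b) -> bmeas T g.
Proof.
move=> mg gb; split; first exact: mmeas_cutm.
exists b => x; rewrite nrm_cutm /cutr; case: ifP => _; first exact: gb.
exact: le_trans (nrm_ge0 _) (gb x).
Qed.

Lemma bmeas_prim p q T (A0 : 'M[C]_(p, q)) a : mxint a -> bmeas T (prim A0 a).
Proof.
move=> ai; apply: bmeas_of; first exact: prim_meas (mxint_meas ai).
by move=> x; exact: prim_bound.
Qed.

Lemma bmeas_vop p q r T c (k : R -> R -> 'M[C]_(p, q)) (f : R -> 'M[C]_(q, r)) :
  vkernel T c k -> mxint f -> bmeas T (vop k f).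
Proof.
move=> hk fi; apply: bmeas_of; first exact: (vop_meas hk (mxint_meas fi)).
by move=> x; exact: (vop_bound hk x fi).
Qed.

Lemma bmeasD p q T (f g : R -> 'M[C]_(p, q)) : bmeas T f -> bmeas T g ->
  bmeas T (fun x => f x + g x).
Proof.
move=> [mf [a fa]] [mg [b gb]]; split.
  rewrite (_ : cutm T _ = (fun x => cutm T f x + cutm T g x)); first exact: mxmeasD.
  by apply/funext => x; rewrite -cutmD.
exists (a + b) => x; rewrite cutmD; apply: le_trans (nrmD _ _) _.
exact: lerD.
Qed.

Context (T : R) m1 m2 (v : R -> 'M[C]_(m1, m2)) (hv : mxL2 T v).

Let mv : mmeas v. Proof. by case: hv. Qed.

Lemma mulv_cutm q (g : R -> 'M[C]_(m2, q)) t : v t *m cutm T g t = v t *m g t.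
Proof.
rewrite /cutm; case: ifPn => // tT; case: hv => _ _ v0.
by rewrite v0// !mul0mx.
Qed.

Lemma Bop_cutm q (g : R -> 'M[C]_(m2, q)) x : Bop v (cutm T g) x = Bop v g x.
Proof.
apply: eq_mx_integral => y; apply: cutm_congr => _; apply: (congr1 (mulmx _)).
by apply: eq_mx_integral => t; apply: cutm_congr => _; exact: mulv_cutm.
Qed.

Definition Bder q (g : R -> 'M[C]_(m2, q)) (y : R) :=
  (v y)^t* *m I (cutm y (fun t => v t *m g t)).

Lemma BopE q (g : R -> 'M[C]_(m2, q)) x : Bop v g x = I (cutm x (Bder g)).
Proof. by []. Qed.

Lemma Bder_L2 q (g : R -> 'M[C]_(m2, q)) : bmeas T g -> mxL2 T (Bder g).
Proof.
move=> gT; have vi : mxint (fun t => v t *m g t).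
  rewrite (_ : (fun t => _) = (fun t => v t *m cutm T g t)).
    by apply: mxL2_mxintM hv _; exact: bmeas_L2.
  by apply/funext => t; rewrite mulv_cutm.
rewrite (_ : Bder g = (fun y => (v y)^t* *m prim 0 (fun t => v t *m g t) y)).
  apply: mxL2Mr_bounded (mxL2_adj hv); first exact: prim_meas (mxint_meas vi).
  by move=> t; exact: prim_bound.
by apply/funext => y; rewrite /Bder /prim add0r.
Qed.

(** Both integrations in [Bop] halve the weighted bound, so [g |-> a + B g] is a contraction for a
    weight chosen as for the kernel; [a] cancels in differences. *)
Lemma Bop_uniq q (a g h : R -> 'M[C]_(m2, q)) : bmeas T g -> bmeas T h ->
  (forall x, 0 < x < T -> g x = a x + Bop v g x) ->
  (forall x, 0 < x < T -> h x = a x + Bop v h x) ->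
  forall x, 0 < x < T -> g x = h x.
Proof.
move=> gT hT gE hE x xT.
have vsq : intg (fun t => nrm (v t) ^+ 2) by case: hv.
have half0 : 0 < 2^-1 :> R by rewrite invr_gt0.
have [l l0 hl] := exp_weight (measurable_nrm mv) vsq (fun t => nrm_ge0 _) half0.
pose W := fun y : RR => expR (l * (y : R)).
pose Phi (G : RR -> 'M[C]_(m2, q)) : RR -> 'M[C]_(m2, q) :=
  cutm T (fun x => a x + Bop v G x).
have inner (G : R -> 'M[C]_(m2, q)) (b y : R) : mmeas G ->
    (forall t, nrm (G t) <= b * expR (l * t)) ->
    mxint (cutm y (fun t => v t *m G t)) /\
    nrm (I (cutm y (fun t => v t *m G t))) <= b * 2^-1 * expR (l * y).
  by move=> mG Gb; exact: (weighted_av_int hv hl).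
have minner (G : R -> 'M[C]_(m2, q)) : mmeas G -> mmeas (fun y => I (cutm y (fun t => v t *m G t))).
  move=> mG; have := @prim_meas R m1 q 0 (fun t => v t *m G t) (mxmeasM mv mG).
  by rewrite /prim; under eq_fun do rewrite add0r.
have cPhi : wcontraction W Phi.
  move=> G H b [mG [cG Gb]] [mH [cH Hb]] GH; rewrite /W in GH *; move=> y.
  have b0 : 0 <= b by have := le_trans (nrm_ge0 _) (GH y); rewrite pmulr_lge0 ?expR_gt0.
  apply: nrm_cutmB; first by rewrite !mulr_ge0 ?expR_ge0.
  rewrite opprD addrACA subrr add0r /Bop.
  have [i1 _] := weighted_aw_int hv hl y (minner G mG) (fun t => (inner G cG t mG Gb).2).
  have [i2 _] := weighted_aw_int hv hl y (minner H mH) (fun t => (inner H cH t mH Hb).2).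
  rewrite -mx_integralB//.
  have IE t : I (cutm t (fun s => v s *m G s)) - I (cutm t (fun s => v s *m H s)) =
      I (cutm t (fun s => v s *m (G s - H s))).
    rewrite -mx_integralB; [|exact: (inner G cG t mG Gb).1|exact: (inner H cH t mH Hb).1].
    apply: eq_mx_integral => s; rewrite /cutm; case: ifP => _; last by rewrite subr0.
    by rewrite mulmxBr.
  rewrite (eq_mx_integral (G := cutm y (fun t => (v t)^t* *m I (cutm t (fun s => v s *m (G s - H s)))))); last first.
    move=> t; rewrite [RHS](cutm_congr (G := fun t => (v t)^t* *m I (cutm t (fun s => v s *m G s)) +
        - ((v t)^t* *m I (cutm t (fun s => v s *m H s))))); last first.
      by move=> _; rewrite -IE mulmxBr.
    by rewrite cutmD; apply: (congr1 (+%R _)); rewrite /cutm; case: ifP => // _; rewrite oppr0.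
  have mGH := mxmeasB mG mH.
  apply: le_trans (weighted_aw_int hv hl y (minner _ mGH) (fun t => (inner _ b t mGH GH).2)).2 _.
  by rewrite ler_wpM2r ?expR_ge0// ler_piMr ?mulr_ge0// invf_le1//; lra.
have wb (f : R -> 'M[C]_(m2, q)) : bmeas T f -> wbounded W (cutm T f).
  move=> [mf [b fb]]; split => //; exists b => y.
  have b0 := le_trans (nrm_ge0 _) (fb y).
  have [yT|yT] := boolP (0 < (y : R) < T); last by rewrite (cutm_out _ yT) nrm0 mulr_ge0 ?expR_ge0.
  apply: le_trans (fb y) _; rewrite ler_peMr// /W -expR0 ler_expR mulr_ge0//; apply: ltW => //.
  by case/andP: yT.
have fixp (f : R -> 'M[C]_(m2, q)) : (forall x, 0 < x < T -> f x = a x + Bop v f x) ->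
    Phi (cutm T f) =1 cutm T f.
  by move=> fE y; apply: cutm_congr => yT; rewrite Bop_cutm -fE.
have := wcontraction_uniq cPhi (wb _ gT) (wb _ hT) (fixp _ gE) (fixp _ hE) x.
by rewrite !cutm_in.
Qed.

End UniqueSolvability.

(** * Properties of [E] deduced from the identity *)

Section Similarity.
Context {R : realType}.
Local Notation C := R[i].
Local Notation mu := (@lebesgue_measure R).
Local Notation RR := (measurableTypeR R).
Local Notation mmeas F := (@mxmeas R _ RR _ _ F).
Local Notation intg b := (mu.-integrable setT (EFin \o b)).
Local Notation mxint := (mx_integrable setT).
Local Notation I := (mx_integral setT).

Context (T : R) (T0 : 0 < T).

Lemma vkernel_HS c r (N : R -> R -> 'M[C]_r) : vkernel T c N -> HSkernel T N.
Proof.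
move=> hN; have c0 := vkernel_ge0 hN; case: hN => mN Nc N0; split.
  by move=> i k; have [h1 h2] := mN i k; split; exact: measurable_funTS.
have mn : measurable_fun setT (fun z : RR * RR => mx_normsq (N z.1 z.2)).
  apply: measurable_sum => i; apply: measurable_sum => k.
  have [h1 h2] := mN i k.
  rewrite (_ : (fun _ => _) = (fun z => complex.Re (N z.1 z.2 i k) ^+ 2 +
      complex.Im (N z.1 z.2 i k) ^+ 2)).
    by apply: measurable_funD; exact: measurable_funX.
  by apply/funext => z; exact: normc_sq.
pose h (z : RR * RR) : \bar R := (mx_normsq (N z.1 z.2))%:E.
have mh : measurable_fun setT h by exact/measurable_EFinP.
have h0 z : (0 <= h z)%E by rewrite lee_fin mx_normsq_ge0.
have slice x : (\int[mu]_t h (x, t) <= (c ^+ 2 * T)%:E)%E.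
  apply: (@le_trans _ _ (\int[mu]_t (c ^+ 2 * cutr T (fun=> 1) t)%:E)%E).
    apply: ge0_le_integral => //.
    - by apply: (measurableT_comp mh); exact: pair1_measurable.
    - apply/measurable_EFinP; apply: measurable_funM => //.
      exact: measurable_cutr.
    - move=> t _; rewrite lee_fin /cutr.
      have [tT|tT] := ifP.
        rewrite mulr1; apply: le_trans (mx_normsq_le_nrm _) _.
        by rewrite lerXn2r ?nnegrE ?nrm_ge0.
      rewrite /= N0 ?mulr0; last first.
        apply/negP => /andP[/andP[t0 tx] xT].
        by move/negP: tT; apply; rewrite t0 (lt_trans tx xT).
      by apply: le_trans (mx_normsq_le_nrm _) _; rewrite nrm0 expr0n.
  have ci := integrableZr' (c ^+ 2) (intg_cutr1 T).
  rewrite -[leLHS]fineK ?lee_fin; last exact: (integrable_fin_num measurableT ci).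
  rewrite -/(Rintegral mu setT (fun t => c ^+ 2 * cutr T (fun=> 1) t)).
  by rewrite RintegralZl ?Rintegral_cutr1//; exact: intg_cutr1.
have slice' x : 0 < x < T ->
    (\int[mu]_(t in `]0%R, x[) (mx_normsq (N x t))%:E = \int[mu]_t h (x, t))%E.
  move=> /andP[x0 xT]; rewrite integral_mkcond; apply: eq_integral => t _.
  rewrite patchE mem_itvoo /h /=; case: ifP => // tx.
  rewrite N0 ?tx//; apply/esym/eqP; rewrite eqe eq_le mx_normsq_ge0 andbT.
  by apply: le_trans (mx_normsq_le_nrm _) _; rewrite nrm0 expr0n.
have mF : measurable_fun setT (fun x : RR => (\int[mu]_t h (x, t))%E).
  exact: (measurable_fun_fubini_tonelli_F h).
rewrite (_ : (\int[mu]_(x in `]0%R, T[) _ = \int[mu]_(x in `]0%R, T[) \int[mu]_t h (x, t))%E); last first.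
  by apply: eq_integral => x; rewrite mem_itvoo => xT; rewrite slice'.
apply: (@le_lt_trans _ _ (\int[mu]_(x in `]0%R, T[) (c ^+ 2 * T)%:E)%E).
  apply: ge0_le_integral => //.
  - by move=> x _; apply: integral_ge0 => t _.
  - exact: measurable_funTS.
rewrite integral_cst//= lebesgue_measure_itv/= lte_fin T0 sube0.
by rewrite -EFinM ltry.
Qed.

(** Presents [A] as a Volterra operator, so that its boundedness is a case of [bounded_op_vop]. *)
Definition kerA r (x t : R) : 'M[C]_r :=
  if (0 < t < x) && (x < T) then (- 'i%C)%:M else 0.

Lemma kerA_vkernel r : vkernel T (nrm ((- 'i%C)%:M : 'M[C]_r)) (@kerA r).
Proof.
split.
- apply: mxmeas_if; [|exact: mxmeas_cst|exact: mxmeas_cst].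
  by apply: measurable_triangle; [exact: measurable_fst|exact: measurable_snd].
- by move=> x t; rewrite /kerA; case: ifP => // _; rewrite nrm0 nrm_ge0.
- by move=> x t /negbTE nT; rewrite /kerA nT.
Qed.

Lemma opA_prim r (f : R -> 'cV[C]_r) x : L2 T f -> x <= T ->
  opA f x = prim 0 (fun t => - 'i%C *: cutm T f t) x.
Proof.
move=> fL xT; rewrite /opA mx_integral_cutm /prim add0r.
rewrite -mx_integralZ; last first.
  rewrite (_ : cutm x f = cutm x (cutm T f)).
    apply: mxint_cutm; apply: (mxL2_mxint (T := T)); exact: L2_cutm.
  apply/funext => t; apply: cutm_congr => /andP[t0 tx].
  by rewrite cutm_in// t0 (lt_le_trans tx).
apply: eq_mx_integral => t; rewrite -cutmZ; apply: cutm_congr => /andP[t0 tx].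
by rewrite cutm_in// t0 (lt_le_trans tx).
Qed.

Lemma opA_vop r (f : R -> 'cV[C]_r) x : 0 < x < T -> L2 T f ->
  opA f x = 0 *: f x + vop (@kerA r) (cutm T f) x.
Proof.
move=> xT fL; rewrite opA_prim//; last by case/andP: xT => _ /ltW.
rewrite scale0r add0r /prim add0r; apply: eq_mx_integral => t.
rewrite /kerA /cutm; case/andP: xT => _ ->; rewrite andbT.
by case: (0 < t < x); rewrite ?mul0mx// mul_scalar_mx.
Qed.

Lemma antiderivative_prim p q (F0 : 'M[C]_(p, q)) f x : x <= T ->
  antiderivative F0 f x = prim F0 (cutm T f) x.
Proof.
move=> xT; rewrite /antiderivative mx_integral_cutm; apply: (congr1 (+%R _)).
apply: eq_mx_integral => t; apply: cutm_congr => /andP[t0 tx].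
by rewrite cutm_in// t0 (lt_le_trans tx).
Qed.

Lemma bmeas_sq_summable p q (g : R -> 'M[C]_(p, q)) : bmeas T g -> sq_summable T g.
Proof. by move=> gT; apply: sq_summable_of_cutm; exact: bmeas_L2. Qed.

Section Transmutation.
Context m1 m2 (v : R -> 'M[C]_(m1, m2)) (hv : mxL2 T v).
Context (c : R) (N : R -> R -> 'M[C]_m2) (hN : vkernel T c N).
Context (tr : forall q (F0 : 'M[C]_(m2, q)) (f F : R -> 'M[C]_(m2, q)), mxL2 T f ->
    (forall x, F x = F0 + I (cutm x f)) ->
    forall x, 0 < x < T ->
    F x + vop N F x = F0 + Bop v (fun t => F t + vop N F t) x
      + I (cutm x (fun y => f y + vop N f y))).
Local Notation E := (fun (f : R -> 'cV[C]_m2) x => f x + vop N (cutm T f) x).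

Let bE : bounded_op T E.
Proof.
apply: (bounded_op_ext _ (bounded_op_vop T0 hN 1)) => f fL x xT.
by rewrite scale1r.
Qed.

Lemma bmeas_trans q (F : R -> 'M[C]_(m2, q)) : bmeas T F ->
  bmeas T (fun x => F x + vop N F x).
Proof.
move=> FT; apply: bmeasD => //.
rewrite (_ : vop N F = vop N (cutm T F)).
  by apply: bmeas_vop hN _; apply: (mxL2_mxint (T := T)); exact: bmeas_L2.
by apply/funext => x; rewrite (vop_cutm hN).
Qed.

(** With [f = 0] the identity says that [E e] solves [h = e + B h]; bounded solutions are unique. *)
Lemma trans_const (e : 'cV[C]_m2) (h : R -> 'cV[C]_m2) : bmeas T h ->
  (forall x, 0 < x < T -> h x = e + Bop v h x) ->
  forall x, 0 < x < T -> E (fun=> e) x = h x.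
Proof.
move=> hT hE x xT; rewrite /= (vop_cutm hN).
have z0 : mxL2 T (fun=> 0 : 'cV[C]_m2).
  rewrite (_ : (fun=> _) = cutm T (fun=> 0)); last first.
    by apply/funext => t; rewrite /cutm; case: ifP.
  by apply: (mxL2_bounded (c := 0)); [exact: mxmeas_cst|move=> t _; rewrite nrm0].
have eE y : e = e + I (cutm y (fun=> 0)).
  rewrite (eq_mx_integral (G := fun=> 0)) ?mx_integral0 ?addr0// => t.
  by rewrite /cutm; case: ifP.
have eT : bmeas T (fun=> e).
  by apply: (bmeas_of T (b := nrm e)); [exact: mxmeas_cst|].
apply: (Bop_uniq hv (a := fun=> e) (bmeas_trans eT) hT _ hE xT) => y yT.
rewrite [LHS](tr z0 eE yT) (eq_mx_integral (G := fun=> 0)) ?mx_integral0 ?addr0// => t.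
rewrite /cutm; case: ifP => // _; rewrite add0r /vop (eq_mx_integral (G := fun=> 0)) ?mx_integral0//.
by move=> s; rewrite mulmx0.
Qed.

(** Both sides solve [h = B h - i J E f]: the left one by the equation of [k] applied to [E f], the
    right one by the identity with [F0 = 0] and derivative [- i f], since [E] commutes with
    scalars. *)
Lemma trans_kerK (k : R -> R -> 'M[C]_m2) d : vkernel T d k ->
  (forall f : R -> 'cV[C]_m2, mxL2 T f -> forall x, 0 < x < T ->
    vop k f x = Bop v (vop k f) x - 'i%C *: I (cutm x f)) ->
  forall f, L2 T f -> forall x, 0 < x < T -> vop k (cutm T (E f)) x = E (opA f) x.
Proof.
move=> hk kE f fL x xT.
have cfL := L2_cutm fL; set cf := cutm T f in cfL *.
have cfi := mxL2_mxint cfL.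
pose f1 t := - 'i%C *: cf t.
have f1L : mxL2 T f1 by exact: mxL2Z.
have f1i := mxL2_mxint f1L.
pose F1 := prim 0 f1.
have E1 : cutm T (opA f) = cutm T F1.
  by apply/funext => t; apply: cutm_congr => /andP[_ /ltW tT]; exact: opA_prim.
have -> : E (opA f) x = F1 x + vop N F1 x.
  by rewrite /= E1 (vop_cutm hN) opA_prim//; case/andP: xT => _ /ltW.
pose ef t := cf t + vop N cf t.
have efL : mxL2 T ef by apply: mxL2D => //; exact: (vop_mxL2 hN cfi).
have efE : cutm T (E f) = ef.
  apply/funext => t; rewrite cutmD; apply: (congr1 (+%R _)).
  by rewrite (cutm_id (vop_mxL2 hN cfi)).
rewrite efE.
have F1T : bmeas T F1 by exact: bmeas_prim.
apply: (Bop_uniq hv (a := fun x => - 'i%C *: I (cutm x ef)) _ (bmeas_trans F1T) _ _ xT).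
- exact: (bmeas_vop hk (mxL2_mxint efL)).
- by move=> y yT; rewrite kE// addrC scaleNr.
- move=> y yT; have := tr (F0 := 0) (F := F1) f1L (fun=> erefl) yT.
  move=> ->; rewrite add0r addrC; apply: (congr1 (fun z => z + _)).
  rewrite -mx_integralZ; last by apply: mxint_cutm; exact: mxL2_mxint efL.
  apply: eq_mx_integral => t; rewrite -cutmZ; apply: cutm_congr => _.
  by rewrite (vopZ hN)// /ef scalerDr.
Qed.

(** The right-hand side of the identity is already a primitive, starting at [f0], with derivative
    the sum of [Bder] of [E F] and of [E f']. *)
Lemma trans_differentiable (f : R -> 'cV[C]_m2) : L2differentiable T f ->
  L2differentiable T (E f).
Proof.
move=> [fL [f0 [f' [f'L fE]]]]; have [b1 b2 b3 b4] := bE.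
split; first exact: b1.
have cL := L2_cutm f'L; set cf := cutm T f' in cL.
pose F := prim f0 cf.
have FT : bmeas T F by apply: bmeas_prim; exact: mxL2_mxint cL.
have EFT := bmeas_trans FT.
have fF : L2eq T f F.
  apply: L2eq_trans fE _; apply: L2eq_on => t /andP[_ /ltW tT].
  exact: antiderivative_prim.
pose D t := Bder v (fun t => F t + vop N F t) t + (cf t + vop N cf t).
have BL := Bder_L2 hv EFT.
have sL : mxL2 T (fun t => cf t + vop N cf t).
  by apply: mxL2D => //; exact: (vop_mxL2 hN (mxL2_mxint cL)).
have DL : mxL2 T D by exact: mxL2D.
exists f0, D; split; first exact: mxL2_sq_summable.
apply: L2eq_trans (b2 _ _ fL (bmeas_sq_summable FT) fF) _.
apply: L2eq_on => t tT; rewrite /= (vop_cutm hN) (tr (F0 := f0) cL (fun=> erefl) tT).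
rewrite /antiderivative mx_integral_cutm -addrA; apply: (congr1 (+%R _)).
rewrite BopE -mx_integralD.
- by apply: eq_mx_integral => s; rewrite -cutmD.
- by apply: mxint_cutm; exact: mxL2_mxint BL.
- by apply: mxint_cutm; exact: mxL2_mxint sL.
Qed.

(** The identity is solved for its derivative: let [Y] start at [f0] with derivative
    [y = E^-1 (f' - (B F)')]. Then [E Y = f0 + B E Y + J f' - B F], and [F] solves the same
    equation, so [E Y = F] and [Y] represents [E^-1 f]. *)
Lemma trans_inv_differentiable Einv : bounded_op T Einv -> L2inverse T E Einv ->
  forall f, L2differentiable T f -> L2differentiable T (Einv f).
Proof.
move=> bEinv hinv f [fL [f0 [f' [f'L fE]]]].
have [b1 b2 b3 b4] := bE; have [i1 i2 i3 i4] := bEinv.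
split; first exact: i1.
have cL := L2_cutm f'L; set cf := cutm T f' in cL.
have cfi := mxL2_mxint cL.
pose F := prim f0 cf.
have FT : bmeas T F by exact: bmeas_prim.
have fF : L2eq T f F.
  apply: L2eq_trans fE _; apply: L2eq_on => t /andP[_ /ltW tT].
  exact: antiderivative_prim.
have BL := Bder_L2 hv FT.
pose l t := cf t - Bder v F t.
have lL : mxL2 T l by exact: mxL2B.
have lL' := mxL2_sq_summable lL.
pose y := Einv l.
have yL : L2 T y by exact: i1.
have cyL := L2_cutm yL; set cy := cutm T y in cyL.
have cyi := mxL2_mxint cyL.
pose Y := prim f0 cy.
have YT : bmeas T Y by exact: bmeas_prim.
have vyL := vop_mxL2 hN cyi.
have Jl x : I (cutm x (fun t => cy t + vop N cy t)) = I (cutm x l).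
  apply: ae_cutm_integral.
  - by apply: mxmeasD; [exact: mxint_meas cyi|exact: mxint_meas (mxL2_mxint vyL)].
  - exact: mxint_meas (mxL2_mxint lL).
  - have /L2eqP := (hinv _ lL').1.
    rewrite (cutm_id lL) => h; refine (aeS h _) => t <-.
    by rewrite cutmD (cutm_id vyL).
have EY x : 0 < x < T -> Y x + vop N Y x = F x.
  move=> xT.
  apply: (Bop_uniq hv (a := fun x => f0 + (I (cutm x cf) - Bop v F x)) (bmeas_trans YT) FT _ _ xT).
    move=> z zT; rewrite (tr (F0 := f0) cyL (fun=> erefl) zT) Jl.
    rewrite addrAC; apply: (congr1 (fun u => f0 + u + _)).
    rewrite BopE -mx_integralB; [|exact: mxint_cutm|by apply: mxint_cutm; exact: mxL2_mxint BL].
    by apply: eq_mx_integral => t; rewrite /cutm; case: ifP => // _; rewrite subr0.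
  by move=> z zT; rewrite -addrA subrK.
exists f0, cy; split; first exact: mxL2_sq_summable.
apply: L2eq_trans (i2 _ _ fL (bmeas_sq_summable FT) fF) _.
have YL := bmeas_sq_summable YT.
have EYF : L2eq T F (E Y).
  by apply: L2eq_on => t tT; rewrite /= (vop_cutm hN) EY.
apply: L2eq_trans (i2 _ _ (bmeas_sq_summable FT) (b1 _ YL) EYF) _.
apply: L2eq_trans (hinv _ YL).2 _.
apply: L2eq_on => t /andP[_ /ltW tT].
by rewrite antiderivative_prim// /cy cutm_cutm.
Qed.

End Transmutation.

End Similarity.

Theorem proposition3p1 (R : realType) (m1 m2 : nat) (T : R)
    (v : R -> 'M[R[i]]_(m1, m2)) (u : R -> R[i] -> 'M[R[i]]_(m1 + m2))
    (hm1 : (1 <= m1)%N) (hm2 : (1 <= m2)%N) (hT : 0 < T)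
    (hv : sq_summable T v) (hu : fundamental_solution T v u) :
  let gamma : R -> 'M[R[i]]_(m2, m1 + m2) := gammamx u in
  [/\ bounded_op T (opK gamma),
      bounded_op T (@opA R m2) &
      exists (E Einv : (R -> 'cV[R[i]]_m2) -> (R -> 'cV[R[i]]_m2))
             (N : R -> R -> 'M[R[i]]_m2),
        [/\ bounded_op T E, bounded_op T Einv & L2inverse T E Einv] /\
        [/\ forall f, L2 T f -> L2eq T (opK gamma f) (E (opA (Einv f))),
            HSkernel T N,
            forall f, L2 T f ->
              L2eq T (E f)
                (fun x => f x + mx_integral `]0, x[ (fun t => N x t *m f t)),
            (forall k, L2 T (fun x => col k (rsubmx (gamma x)))) /\
            L2eq T (columnwise Einv (fun x => rsubmx (gamma x))) (fun=> 1%:M) &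
            forall f, L2differentiable T f ->
              L2differentiable T (E f) /\ L2differentiable T (Einv f)]].
Proof.
move=> gamma.
have v0L := sq_summable_mxL2 hv.
have [b [g [[mb mg [B bB]] gammaE bE gE gjg]]] := gamma_beta hv hu.
have hK := kerK_vkernel T mg bB.
have [c [N [hN tr]]] := transmutation_kernel v0L.
have [Einv bEinv hinv] := volterra_inverse hT hN.
pose E (f : R -> 'cV[R[i]]_m2) x := f x + vop N (cutm T f) x.
have gamma_in x : 0 < x < T -> gamma x = g x.
  by move=> /andP[x0 xT]; apply: gammaE; rewrite !ltW.
have opK_vop f : L2 T f -> forall x, 0 < x < T ->
    opK gamma f x = 0 *: f x + vop (kerK T g) (cutm T f) x.
  move=> fL x xT; have fi := mxL2_mxint (L2_cutm fL).
  have x0T : x < T by case/andP: xT.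
  rewrite scale0r add0r (vop_cutm hK) /opK mx_integral_cutm -mx_integralZ.
    apply: eq_mx_integral => t; rewrite /cutm /kerK x0T andbT.
    case: ifP => [/andP[t0 tx]|_]; last by rewrite mul0mx scaler0.
    by rewrite !gamma_in// ?t0 ?(lt_trans tx)// -scalemxAl.
  (* The integrability still owed: the factor [i] stands outside the integral in [opK] but inside
     [kerK], whence [- i]. *)
  rewrite (_ : cutm x _ = (fun t => - 'i%C *: (kerK T g x t *m cutm T f t))).
    by apply: mxintZ; exact: (vop_mxint hK).
  apply/funext => t; rewrite /cutm /kerK x0T andbT.
  case: ifP => [/andP[t0 tx]|_]; last by rewrite mul0mx scaler0.
  rewrite t0 (lt_trans tx x0T) -scalemxAl scalerA mulNr mul_ii opprK scale1r.
  by rewrite !gamma_in// ?t0 ?(lt_trans tx).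
have bK : bounded_op T (opK gamma).
  exact: (bounded_op_ext opK_vop (bounded_op_vop hT hK 0)).
have bA : bounded_op T (@opA R m2).
  apply: (bounded_op_ext _ (bounded_op_vop hT (@kerA_vkernel R T m2) 0)) => f fL x xT.
  exact: opA_vop.
have bEop : bounded_op T E.
  by apply: (bounded_op_ext _ (bounded_op_vop hT hN 1)) => f fL x xT; rewrite scale1r.
have KE : forall f, L2 T f -> forall x, 0 < x < T -> opK gamma (E f) x = E (opA f) x.
  have [EL _ _ _] := bEop.
  move=> f fL x xT; rewrite (opK_vop _ (EL _ fL) _ xT) scale0r add0r.
  apply: (trans_kerK v0L hN tr hK _ fL xT) => f1 f1L y yT.
  exact: (vop_kerK_eq hv mb mg bB bE gE gjg f1L yT).
have [K1 K2 K3 K4] := bK; have [E1 E2 E3 E4] := bEop; have [I1 I2 I3 I4] := bEinv.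
have gcT (e : 'cV[R[i]]_m2) : bmeas T (fun x => g x *m col_mx 0 e).
  apply: (bmeas_of T (b := B * nrm (col_mx (0 : 'cV[R[i]]_m1) e))).
    by apply: mxmeasM => //; exact: mxmeas_cst.
  move=> x; apply: le_trans (nrmM _ _) _; apply: ler_wpM2r; first exact: nrm_ge0.
  by case: (bB x).
have colE k x : 0 < x < T -> col k (rsubmx (gamma x)) = g x *m col_mx 0 (delta_mx k 0).
  move=> xT; rewrite gamma_in// colE -{2}(hsubmxK (g x)) mul_row_col mulmx0 add0r.
  by [].
have colL k : L2 T (fun x => col k (rsubmx (gamma x))).
  apply: sq_summable_ext (bmeas_sq_summable (gcT (delta_mx k 0))) => x xT.
  by rewrite colE.
split; [exact: bK|exact: bA|]; exists E, Einv, N; split; first by split.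
split.
- move=> f fL; have EL := I1 _ fL.
  (* [K f] is replaced by [K (E (E^-1 f))], which is legitimate because [K] respects a.e. equality;
     then [K E = E A] is used at [E^-1 f]. *)
  apply: L2eq_trans (L2eq_sym (K2 _ _ (E1 _ EL) fL (hinv _ fL).1)) _.
  by apply: L2eq_on => x xT; exact: KE.
- exact: (vkernel_HS hT hN).
- by move=> f fL; apply: L2eq_on => x xT; rewrite /E (vopE hN).
- split; first exact: colL.
  (* Column [k] of [gamma_2] is [E] applied to the constant [delta_mx k 0], because both solve
     [h = delta_mx k 0 + B h]. *)
  have ek (k : 'I_m2) : L2eq T (Einv (fun x => col k (rsubmx (gamma x)))) (fun=> delta_mx k 0).
    have eL : L2 T (fun=> delta_mx k 0 : 'cV[R[i]]_m2).
      apply: bmeas_sq_summable.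
      by apply: (bmeas_of T (b := nrm (delta_mx k 0 : 'cV[R[i]]_m2))); [exact: mxmeas_cst|].
    apply: L2eq_trans (hinv _ eL).2; apply: I2 => //; first exact: E1.
    apply: L2eq_on => x xT; rewrite colE//; apply/esym.
    apply: (trans_const v0L hN tr (gcT _)) => // y yT.
    exact: (gamma_col hv mb mg bB bE gE).
  (* One exceptional null set per column; their finite union serves the whole matrix. *)
  have := ae_forall_ord (fun k => (L2eqP T _ _).1 (ek k)).
  move=> h; apply/L2eqP; refine (aeS h _) => t ht.
  apply/matrixP => i k; have := congr1 (fun M : 'cV[R[i]]_m2 => M i 0) (ht k).
  rewrite /cutm; case: ifP => // _; rewrite !mxE => ->.
  by rewrite eqxx andbT.
- move=> f fD; split; first exact: (trans_differentiable hT v0L hN tr).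
  exact: (trans_inv_differentiable hT v0L hN tr bEinv hinv).
Qed.
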